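(* For each $n \in \mathbb{N}$ there exist positive constants $c_1 = c_1(n)$ and $c_2 = c_2(n)$, depending only on $n$, such that $$c_1\, \mathcal{I}(R) \leq N(R) \leq c_2\, \mathcal{I}(R)$$ for every rectangle $R \subset \mathbb{R}^n$, i.e. every $n$-dimensional rectangle (box) with arbitrary side lengths $\ell_1, \ldots, \ell_n > 0$.
   Context: For a bounded Lipschitz domain $\Omega \subset \mathbb{R}^n$, let $0 < \lambda_1 < \lambda_2 \leq \cdots$ be the Dirichlet eigenvalues and $0 = \mu_1 < \mu_2 \leq \mu_3 \leq \cdots$ the Neumann eigenvalues of $-\Delta$ on $\Omega$, each repeated according to multiplicity. Define $$N(\Omega) = \#\{k \in \mathbb{N} : \mu_k \leq \lambda_1\},$$ where $\mathbb{N} = \{1,2,3,\ldots\}$. The isoperimetric ratio of $\Omega$ is $$\mathcal{I}(\Omega) = \frac{|\partial\Omega|^n}{|\Omega|^{n-1}},$$ where $|\Omega|$ is the Lebesgue measure of $\Omega$ and $|\partial\Omega|$ is the $(n-1)$-dimensional Hausdorff measure of its boundary. *)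

(* Defs.v *)
From HB Require Import structures.
From mathcomp Require Import all_boot all_order all_algebra.
From mathcomp Require Import all_classical all_reals all_analysis.

Set Implicit Arguments.
Unset Strict Implicit.
Unset Printing Implicit Defensive.
Import Order.TTheory GRing.Theory Num.Theory.
Import numFieldNormedType.Exports.

Local Open Scope classical_set_scope.
Local Open Scope ring_scope.

(* The sigma-algebra on R^n = ['rV[R]_n] is generated by the coordinate
   projections, as the library does for [n.-tuple T]; it is the Borel one. *)

Definition rV_display : measure_display. Proof. exact: default_measure_display. Qed.

Section rV_measurable.
Context {R : realType}.
Variable n : nat.

Let coord (i : 'I_n) (x : 'rV[R]_n) : measurableTypeR R := x 0 i.

Let rV_set0 : g_sigma_preimage coord set0.
Proof. exact: sigma_algebra0. Qed.

Let rV_setC A : g_sigma_preimage coord A -> g_sigma_preimage coord (~` A).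
Proof. exact: sigma_algebraC. Qed.

Let rV_bigcup (F : (set 'rV[R]_n)^nat) :
  (forall i, g_sigma_preimage coord (F i)) ->
  g_sigma_preimage coord (\bigcup_i (F i)).
Proof. exact: sigma_algebra_bigcup. Qed.

HB.instance Definition _ := @isMeasurable.Build rV_display
  'rV[R]_n (g_sigma_preimage coord) rV_set0 rV_setC rV_bigcup.

Lemma measurable_coord (i : 'I_n) :
  measurable_fun [set: 'rV[R]_n] (fun x => x 0 i : measurableTypeR R).
Proof.
move=> _ Y mY; rewrite setTI; apply: sub_sigma_algebra => /=.
rewrite -bigcup_seq/=; exists i => /=; first by rewrite mem_index_enum.
by exists Y => //; rewrite setTI.
Qed.

Lemma measurable_fun_rV d (T : measurableType d) (f : T -> 'rV[R]_n) :
  (forall i, measurable_fun [set: T] (fun x => f x 0 i : measurableTypeR R)) ->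
  measurable_fun [set: T] f.
Proof.
move=> mf; suff sub : g_sigma_preimage coord `<=`
    [set A | measurable (f @^-1` A)].
  by move=> _ A /sub; rewrite setTI.
apply: smallest_sub => /=.
  split=> /= [|A mA|F mF].
  - by rewrite preimage_set0.
  - by rewrite setTD preimage_setC; exact: measurableC.
  - by rewrite preimage_bigcup; exact: bigcupT_measurable.
move=> A; rewrite -bigcup_seq => -[i _ [B mB <-]] /=.
have := mf i measurableT B mB; rewrite !setTI; exact.
Qed.

End rV_measurable.

Section lebesgue_step.
Context {R : realType}.
Variables (n : nat) (mu : {sigma_finite_measure set 'rV[R]_n -> \bar R}).

Definition rV_cons (p : measurableTypeR R * 'rV[R]_n) : 'rV[R]_n.+1 :=
  row_mx (const_mx p.1 : 'rV[R]_1) p.2.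

Definition rV_uncons (x : 'rV[R]_n.+1) : measurableTypeR R * 'rV[R]_n :=
  (x 0 ord0, \row_j x 0 (lift ord0 j)).

Lemma measurable_rV_cons : measurable_fun setT rV_cons.
Proof.
apply: measurable_fun_rV => i; rewrite /rV_cons.
case: (@splitP 1 n i) => [j ij|k ik].
  have -> : i = lshift n j by apply: ord_inj.
  rewrite (_ : (fun _ => _) = fst)//; apply/funext => -[r y] /=.
  by apply: etrans (row_mxEl _ y 0 _) _; rewrite mxE.
have -> : i = rshift 1 k by apply: ord_inj.
rewrite (_ : (fun _ => _) = (fun y : 'rV[R]_n => y 0 k) \o snd).
  by apply: measurableT_comp => //; exact: measurable_coord.
by apply/funext => -[r y]; exact: (row_mxEr _ y 0).
Qed.

Lemma measurable_rV_uncons : measurable_fun setT rV_uncons.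
Proof.
apply/measurable_fun_pairP; split; first exact: measurable_coord.
apply: measurable_fun_rV => i /=.
rewrite (_ : (fun _ => _) = fun x : 'rV[R]_n.+1 => x 0 (lift ord0 i)).
  exact: measurable_coord.
by apply/funext => x; rewrite mxE.
Qed.

Lemma rV_consK : cancel rV_cons rV_uncons.
Proof.
move=> [r y]; rewrite /rV_uncons /rV_cons /=; congr pair.
  have -> : ord0 = lshift n (ord0 : 'I_1) by apply: ord_inj.
  by apply: etrans (row_mxEl _ y 0 _) _; rewrite mxE.
apply/rowP => j; rewrite mxE.
have -> : lift ord0 j = rshift 1 j by apply: ord_inj.
exact: (row_mxEr _ y 0).
Qed.

Let prod_mu :
    {measure set (measurableTypeR R * 'rV[R]_n)%type -> \bar R} :=
  (@lebesgue_measure R \x mu)%E.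

Definition lebesgue_step : set 'rV[R]_n.+1 -> \bar R :=
  pushforward ((@lebesgue_measure R) \x mu)%E rV_cons.

Let lebesgue_step0 : lebesgue_step set0 = 0%E.
Proof. exact: (@measure0 _ _ _ prod_mu). Qed.

Let lebesgue_step_ge0 A : (0 <= lebesgue_step A)%E.
Proof. exact: (@measure_ge0 _ _ _ prod_mu). Qed.

Let lebesgue_step_sigma_additive : semi_sigma_additive lebesgue_step.
Proof.
move=> F mF tF mUF; rewrite /lebesgue_step /pushforward preimage_bigcup.
have mP A : measurable A -> measurable (rV_cons @^-1` A).
  by move=> mA; rewrite -[X in measurable X]setTI; exact: measurable_rV_cons.
apply: (@measure_semi_sigma_additive _ _ _ prod_mu).
- by move=> k; exact: mP.
- apply/trivIsetP => /= i j _ _ ij; rewrite -preimage_setI.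
  by move/trivIsetP : tF => /(_ _ _ _ _ ij) ->//; rewrite preimage_set0.
- by rewrite -preimage_bigcup; exact: mP.
Qed.

HB.instance Definition _ := isMeasure.Build _ _ _ lebesgue_step
  lebesgue_step0 lebesgue_step_ge0 lebesgue_step_sigma_additive.

Let lebesgue_step_sigma_finite : sigma_finite setT lebesgue_step.
Proof.
have /sigma_finiteP[F [TF ndF Foo]] := sigma_finiteT (@lebesgue_measure R).
have /sigma_finiteP[G [TG ndG Goo]] := sigma_finiteT mu.
exists (fun k => rV_uncons @^-1` (F k `*` G k)).
  apply/esym; rewrite -subTset => x _.
  have : setT (rV_uncons x).1 by [].
  have : setT (rV_uncons x).2 by [].
  rewrite {1}TG {1}TF => -[j _ Gj] [i _ Fi]; exists (maxn i j) => //; split.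
  - by move: Fi; exact/subsetPset/ndF/leq_maxl.
  - by move: Gj; exact/subsetPset/ndG/leq_maxr.
move=> k; have [mF Fk] := Foo k; have [mG Gk] := Goo k; split.
  rewrite -[X in measurable X]setTI; apply: measurable_rV_uncons => //.
  exact: measurableX.
rewrite /lebesgue_step /pushforward -comp_preimage.
rewrite (_ : rV_uncons \o rV_cons = id); last exact/funext/rV_consK.
by rewrite preimage_id product_measure1E// lte_mul_pinfty// ge0_fin_numE.
Qed.

HB.instance Definition _ := Measure_isSigmaFinite.Build _ _ _ lebesgue_step
  lebesgue_step_sigma_finite.

End lebesgue_step.

Fixpoint lebesgue_rV (R : realType) (n : nat) :
    {sigma_finite_measure set 'rV[R]_n -> \bar R} :=
  match n with
  | 0 => (\d_ (0 : 'rV[R]_0))%R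
  | m.+1 => lebesgue_step (lebesgue_rV R m)
  end.

Section geometry.
Context {R : realType} {n : nat}.
Implicit Types (A B Omega : set 'rV[R]_n).

(* The norm [`|x|] of the library on ['rV_n] is the sup norm. *)
Definition eucl_norm (x : 'rV[R]_n) : R := Num.sqrt (\sum_i x 0 i ^+ 2).

Definition diam A : \bar R :=
  ereal_sup [set (eucl_norm (p.1 - p.2))%:E | p in A `*` A].

Definition boundary A : set 'rV[R]_n := closure A `\` A^°.

End geometry.

Definition unit_ball_volume (R : realType) (m : nat) : \bar R :=
  lebesgue_rV R m [set x | eucl_norm x <= 1].

Section hausdorff.
Context {R : realType} {n : nat}.
Local Open Scope ereal_scope.

(* The normalisation makes the m-dimensional Hausdorff measure agree with
   m-dimensional area; for m = 0 it is the counting measure, since [x ^+ 0 = 1]. *)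
Definition hausdorff_gauge (m : nat) (A : set 'rV[R]_n) : \bar R :=
  if A == set0 then 0
  else unit_ball_volume R m * ((2^-1)%R%:E * diam A) ^+ m.

Definition hausdorff_content (m : nat) (delta : R) (A : set 'rV[R]_n) : \bar R :=
  ereal_inf [set \sum_(k <oo) hausdorff_gauge m (U k)
    | U in [set U : (set 'rV[R]_n)^nat |
        A `<=` \bigcup_k U k /\ forall k, diam (U k) <= delta%:E]].

Definition hausdorff_measure (m : nat) (A : set 'rV[R]_n) : \bar R :=
  ereal_sup [set hausdorff_content m delta A | delta in [set d : R | (0 < d)%R]].

Definition isoperimetric_ratio (Omega : set 'rV[R]_n) : \bar R :=
  hausdorff_measure n.-1 (boundary Omega) ^+ n / lebesgue_rV R n Omega ^+ n.-1.

End hausdorff.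

(* Elements of L^2 and H^1 on the open set [Omega] are represented by functions
   on the whole of R^n of which only the restriction to [Omega] matters.  A
   Sobolev function comes together with a representative of its weak gradient. *)

Section sobolev.
Context {R : realType} {n : nat}.
Variable Omega : set 'rV[R]_n.
Implicit Types (u v f phi : 'rV[R]_n -> R) (g h : 'I_n -> 'rV[R]_n -> R).

Definition partial (i : 'I_n) f : 'rV[R]_n -> R := 'D_(delta_mx 0 i) f.

Fixpoint is_Ck (k : nat) f : Prop :=
  continuous f /\
  if k is k'.+1 then
    forall i, (forall x, derivable f x (delta_mx 0 i)) /\ is_Ck k' (partial i f)
  else True.

Definition test_function phi : Prop :=
  (forall k, is_Ck k phi) /\
  exists K : set 'rV[R]_n,
    [/\ compact K, K `<=` Omega & forall x, ~ K x -> phi x = 0].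

Definition inner u v : R := \int[lebesgue_rV R n]_(x in Omega) (u x * v x).

Definition grad_inner g h : R := \sum_i inner (g i) (h i).

Definition sq_integrable u : Prop :=
  measurable_fun Omega (u : 'rV[R]_n -> measurableTypeR R) /\
  (\int[lebesgue_rV R n]_(x in Omega) (u x ^+ 2)%:E < +oo)%E.

Definition weak_gradient u g : Prop :=
  forall i phi, test_function phi -> inner u (partial i phi) = - inner (g i) phi.

Definition H1 u g : Prop :=
  [/\ sq_integrable u, forall i, sq_integrable (g i) & weak_gradient u g].

(* The closure of the test functions in H^1. *)
Definition H10 u g : Prop :=
  H1 u g /\
  exists phi : nat -> 'rV[R]_n -> R,
    [/\ forall k, test_function (phi k),
        inner (u \- phi k) (u \- phi k) @[k --> \oo] --> (0 : R)
      & forall i, inner (g i \- partial i (phi k)) (g i \- partial i (phi k))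
                    @[k --> \oo] --> (0 : R)].

(* The form domain of minus the Laplacian: [H1] for the Neumann and [H10] for the
   Dirichlet boundary condition. *)
Variable V : ('rV[R]_n -> R) -> ('I_n -> 'rV[R]_n -> R) -> Prop.

Definition eigenspace (t : R) u : Prop :=
  exists2 g, V u g & forall v h, V v h -> grad_inner g h = t * inner u v.

Definition lin_indep_ae (k : nat) (f : 'I_k -> 'rV[R]_n -> R) : Prop :=
  forall a : 'I_k -> R,
    {ae lebesgue_rV R n, forall x, Omega x -> \sum_j a j * f j x = 0} ->
    forall j, a j = 0.

Local Open Scope ereal_scope.

(* The dimension of the weak eigenspace modulo equality almost everywhere; it is 0
   when [t] is not an eigenvalue. *)
Definition multiplicity (t : R) : \bar R :=
  ereal_sup [set k%:R%:E | k in [set k : nat |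
    exists2 f : 'I_k -> 'rV[R]_n -> R,
      forall j, eigenspace t (f j) & lin_indep_ae f]].

Definition eigenvalue_count (t : R) : \bar R :=
  \esum_(s in [set s : R | (s <= t)%R]) multiplicity s.

(* The k-th eigenvalue, for k >= 1, in the nondecreasing enumeration with
   multiplicities ([+oo] if there are fewer than k eigenvalues). *)
Definition nth_eigenvalue (k : nat) : \bar R :=
  ereal_inf [set t%:E | t in [set t : R | k%:R%:E <= eigenvalue_count t]].

End sobolev.

Section counting.
Context {R : realType} {n : nat}.
Variable Omega : set 'rV[R]_n.

Definition dirichlet_eigenvalue (k : nat) : \bar R :=
  nth_eigenvalue Omega (H10 Omega) k.

Definition neumann_eigenvalue (k : nat) : \bar R :=
  nth_eigenvalue Omega (H1 Omega) k.

Definition neumann_count : \bar R :=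
  counting [set k : nat | (0 < k)%N /\
    (neumann_eigenvalue k <= dirichlet_eigenvalue 1)%E].

End counting.

(* An open box with side lengths [l], corner [a] and orthonormal edge directions
   the rows of [Q]. *)
Definition rectangle (R : realType) (n : nat) (a : 'rV[R]_n) (Q : 'M[R]_n)
    (l : 'I_n -> R) : set 'rV[R]_n :=
  [set a + y *m Q | y in [set y : 'rV[R]_n | forall i, 0 < y 0 i < l i]].

(* Main.v *)
(* In the coordinates [y] of a rectangle with sides [l i], the Neumann eigenvalues
   are [lam k = \sum_i (k i * pi / l i) ^+ 2] for [k] in N^n, with eigenfunctions
   [\prod_i cos (k i * pi * y i / l i)].  No spectral theorem is needed: a square
   integrable function orthogonal to all these cosines vanishes almost everywhere,
   which bounds every multiplicity from above by the number of [k] with that [lam k].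
   The first Dirichlet eigenvalue only has to be located up to a constant: the
   product of sines gives [lambda_1 <= lam (1, .., 1)], and integrating
   [u ^+ 2] by parts against [y i] in the direction of the i-th edge gives
   [1 / (16 * l i ^+ 2) <= lambda_1].  So the count is comparable to the number of
   [k] with [k i] at most a multiple of [l i * S], where [S = \sum_i (l i)^-1], i.e.
   to [(\prod_i l i) * S ^+ n].  The boundary has Hausdorff measure comparable to
   the sum [(\prod_i l i) * S] of the areas of the facets: a covering by small
   cells bounds it from above, projecting coverings onto a facet from below.
   Hence the isoperimetric ratio is comparable to [(\prod_i l i) * S ^+ n] too. *)

Require Import Defs.
From HB Require Import structures.
From mathcomp Require Import all_boot all_order all_algebra.
From mathcomp Require Import finmap all_classical all_reals all_analysis.
From mathcomp Require Import measurable_realfun ring lra.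
Set Implicit Arguments.
Unset Strict Implicit.
Unset Printing Implicit Defensive.
Import Order.TTheory GRing.Theory Num.Theory.
Import numFieldNormedType.Exports.
Local Open Scope classical_set_scope.
Local Open Scope ring_scope.

(** * Lebesgue measure on R^n *)

(** The obstacle is that a weak gradient may only be tested against functions with compact support
    in the open box, while the cosines do not vanish at the facets. The way out is to split
    everything along the edges. To integrate [v] against the derivative of a product function in
    edge direction i, every factor is multiplied by a cutoff; only the i-th cutoff gets
    differentiated, so only the i-th factor has to vanish at the ends of its interval, and linear
    decay suffices. The derivative of a cosine mode along edge i has a sine as i-th factor and
    decays in this way. Rectangles may be rotated, whereas the measure is an iterated product along
    the coordinate axes. Its invariance under orthogonal matrices comes from measuring one set in
    two ways, with the Euclidean unit ball as the reference body. Eigenvalues are infima of levels,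
    so an upper bound for the first Dirichlet eigenvalue controls Neumann counts only at strictly
    higher levels; doubling the level provides this room and costs only a constant. *)

Section measurable_rV.
Context {R : realType}.

Lemma measurable_ball_rV n (x : 'rV[R]_n) (e : R) :
  0 < e -> measurable (ball x e : set 'rV[R]_n).
Proof.
move=> e0.
rewrite (_ : ball x e = \bigcap_(i in [set: 'I_n])
    ((fun y : 'rV[R]_n => y 0 i : measurableTypeR R) @^-1` ball (x 0 i) e)).
  apply: fin_bigcap_measurable => // i _.
  rewrite -[X in measurable X]setTI; apply: measurable_coord => //.
  by rewrite ball_itv; exact: measurable_itv.
apply/seteqP; split => [y [_ H] i _|y H]; first exact: H.
by split => // i j; rewrite [i]ord1; exact: H.
Qed.

(** The sigma-algebra is generated by coordinates and sup-norm balls are boxes, so it is enough that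
    an open set is the union of the countably many balls with rational centre and radius
    [1 / (m + 1)] that it contains. *)
Lemma open_measurable_rV n (U : set 'rV[R]_n) : open U -> measurable U.
Proof.
move=> oU.
pose D := [set p : 'rV[rat]_n * nat |
  ball (map_mx ratr p.1 : 'rV[R]_n) p.2.+1%:R^-1 `<=` U].
rewrite (_ : U = \bigcup_(p in [set: 'rV[rat]_n * nat])
  (if p \in D then ball (map_mx ratr p.1 : 'rV[R]_n) p.2.+1%:R^-1 else set0)).
  apply: countable_bigcupT_measurable => // p.
  by case: ifP => // _; exact: measurable_ball_rV.
apply/seteqP; split => [x Ux|x [p _]]; last first.
  by case: ifPn => // /[!inE] pD; exact: pD.
have /nbhs_ballP[/= e e0 xeU] : nbhs x U by exact: open_nbhs_nbhs.
have [m me] : exists m, (m.+1%:R^-1 : R) < e / 2.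
  have e20 : 0 < e / 2 by rewrite divr_gt0.
  have [m _ /(_ m (leqnn m)) ?] := near_infty_natSinv_lt (PosNum e20).
  by exists m.
have m0 : 0 < (m.+1%:R^-1 : R) by rewrite invr_gt0.
have /choice[q qP] : forall i, exists q : rat, `|x 0 i - ratr q| < m.+1%:R^-1.
  move: m0; move: (m.+1%:R^-1 : R) => d d0 i.
  have [|q] := @rat_in_itvoo R (x 0 i - d) (x 0 i + d); first by lra.
  rewrite in_itv/= => /andP[? ?]; exists q.
  by rewrite ltr_norml; apply/andP; split; lra.
have qx : ball (map_mx ratr (\row_i q i) : 'rV[R]_n) m.+1%:R^-1 x.
  by split => // i j; rewrite [i]ord1 !mxE /ball/= distrC; exact: qP.
exists (\row_i q i, m) => //; rewrite ifT// inE => y /= qy.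
apply: xeU; apply: le_ball (ball_triangle (ball_sym qx) qy).
by move: me; move: (m.+1%:R^-1 : R) => d; lra.
Qed.

Lemma continuous_measurable_rV n (f : 'rV[R]_n -> R) (D : set 'rV[R]_n) :
  measurable D -> continuous f ->
  measurable_fun D (f : 'rV[R]_n -> measurableTypeR R).
Proof.
move=> mD cf; apply: (@measurable_funS _ _ _ _ setT) => //.
apply: (measurability _ (RGenOInfty.measurableE R)) => _ [_ [r ->] <-]; rewrite setTI.
apply: open_measurable_rV; apply: open_comp; last exact: interval_open.
by move=> x _; exact: cf.
Qed.

End measurable_rV.

Section lebesgue_rV_theory.
Context {R : realType}.
Local Notation mu n := (lebesgue_rV R n).
Local Notation lambda := (@lebesgue_measure R).

Lemma rV_cons0 n (p : measurableTypeR R * 'rV[R]_n) : rV_cons p 0 ord0 = p.1.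
Proof. exact: (congr1 fst (rV_consK p)). Qed.

Lemma rV_consS n (p : measurableTypeR R * 'rV[R]_n) i :
  rV_cons p 0 (lift ord0 i) = p.2 0 i.
Proof. by have /rowP/(_ i) := congr1 snd (rV_consK p); rewrite mxE. Qed.

Lemma rV_eqP n (x y : 'rV[R]_n.+1) : x 0 ord0 = y 0 ord0 ->
  (forall i, x 0 (lift ord0 i) = y 0 (lift ord0 i)) -> x = y.
Proof. by move=> h0 hS; apply/rowP => i; case: (unliftP ord0 i) => [j ->|->]. Qed.

Lemma lebesgue_rVS n (A : set 'rV[R]_n.+1) :
  mu n.+1 A = (lambda \x mu n)%E (@rV_cons R n @^-1` A).
Proof. by []. Qed.

Lemma lebesgue_rV_box n (S : 'I_n -> set R) (r : 'I_n -> R) :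
  (forall i, measurable (S i : set (measurableTypeR R))) ->
  (forall i, lambda (S i) = (r i)%:E) ->
  mu n [set x | forall i, S i (x 0 i)] = (\prod_i r i)%:E.
Proof.
elim: n S r => [|n ih] S r mS Sr.
  by rewrite big_ord0 /= diracE mem_set//= => -[].
rewrite lebesgue_rVS big_ord_recl EFinM.
rewrite (_ : _ @^-1` _ =
  S ord0 `*` [set y : 'rV[R]_n | forall i, S (lift ord0 i) (y 0 i)]); last first.
  apply/seteqP; split => [[x y] /= H|[x y] /= [H0 H] i].
    split => [|i]; first by have := H ord0; rewrite rV_cons0.
    by have := H (lift ord0 i); rewrite rV_consS.
  by case: (unliftP ord0 i) => [j ->|->]; rewrite ?rV_cons0 ?rV_consS.
rewrite product_measure1E//.
  rewrite -[LHS]/(lambda (S ord0) * mu n _)%E Sr; congr (_ * _)%E.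
  by apply: (ih (fun i => S (lift ord0 i)) (fun i => r (lift ord0 i))) => i.
rewrite (_ : [set y | _] = \bigcap_(i in [set: 'I_n])
    ((fun y : 'rV[R]_n => y 0 i : measurableTypeR R) @^-1` S (lift ord0 i))).
  apply: fin_bigcap_measurable => // i _.
  by rewrite -[X in measurable X]setTI; exact: measurable_coord.
by apply/seteqP; split => [y H i _|y H i]; exact: H.
Qed.

Lemma lebesgue_measure_translate (v : R) (A : set (measurableTypeR R)) :
  measurable A -> lambda ((fun x => x + v) @^-1` A) = lambda A.
Proof.
move=> mA.
have mv : @measurable_fun _ _ (measurableTypeR R) (measurableTypeR R) setT
  (fun x => x + v).
  exact: (@measurable_funD _ (measurableTypeR R) R setT id (cst v)).
pose f : {mfun measurableTypeR R >-> measurableTypeR R} :=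
  HB.pack (fun x : measurableTypeR R => x + v : measurableTypeR R)
    (isMeasurableFun.Build _ _ _ _ _ mv).
apply/esym; have := @lebesgue_measure_unique R (pushforward lambda f).
apply => //= _ [[a b]] _ <-; rewrite /pushforward.
rewrite (_ : _ @^-1` _ = `]a - v, b - v]%classic).
  rewrite !lebesgue_measure_itv/= !lte_fin ltrD2r; case: ifP => // _.
  by rewrite -!EFinB; congr EFin; ring.
by apply/seteqP; split => x /=; rewrite !in_itv/= ltrBlDr lerBrDr.
Qed.

Lemma measurable_translate n (v : 'rV[R]_n) :
  measurable_fun setT (fun x : 'rV[R]_n => x + v).
Proof.
apply: measurable_fun_rV => i.
under eq_fun do rewrite mxE.
by apply: measurable_funD => //; exact: measurable_coord.
Qed.

(** Induction through the iterated integral: in each section the tail of [v] is absorbed by the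
    induction hypothesis, and the head by the invariance of the one-dimensional measure. *)
Lemma lebesgue_rV_translate n (v : 'rV[R]_n) (A : set 'rV[R]_n) :
  measurable A -> mu n ((fun x => x + v) @^-1` A) = mu n A.
Proof.
elim: n v A => [|n ih] v A mA.
  by congr (lebesgue_rV R 0 _); apply/seteqP; split => x /=; rewrite (thinmx0 v) addr0.
rewrite !lebesgue_rVS /product_measure1.
set A' := @rV_cons R n @^-1` A.
have mA' : measurable A'.
  by rewrite -[X in measurable X]setTI; exact: measurable_rV_cons.
pose F x := mu n (xsection A' x).
have mF : measurable_fun setT F by exact: measurable_fun_xsection.
pose s (x : measurableTypeR R) : measurableTypeR R := (x : R) + v 0 ord0.
have ms : measurable_fun setT s.
  exact: (@measurable_funD _ (measurableTypeR R) R setT id (cst (v 0 ord0))).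
transitivity (\int[lambda]_x (F (s x)))%E.
  apply: eq_integral => x _ /=; rewrite /F.
  rewrite -(ih (\row_j v 0 (lift ord0 j)) _ (measurable_xsection _ mA')).
  have e y : rV_cons (x, y) + v = rV_cons (s x, y + \row_j v 0 (lift ord0 j)).
    by apply: rV_eqP => [|i]; rewrite mxE ?rV_cons0 ?rV_consS /= ?mxE.
  by congr (mu n _); apply/seteqP; split=> y; rewrite /xsection/= !inE/= ?e// -e.
rewrite -[LHS]/(\int[lambda]_(x in s @^-1` setT) (F \o s) x)%E.
rewrite -ge0_integral_pushforward//.
apply: eq_measure_integral => B mB _.
exact: lebesgue_measure_translate.
Qed.

End lebesgue_rV_theory.

(** * Rotation invariance of Lebesgue measure *)

Section lebesgue_rV_rotate.
Context {R : realType}.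
Local Notation mu n := (lebesgue_rV R n).

Lemma sum_sqr_mulmx n (x : 'rV[R]_n) : \sum_i x 0 i ^+ 2 = (x *m x^T) 0 0.
Proof. by rewrite mxE; apply: eq_bigr => i _; rewrite mxE expr2. Qed.

Lemma eucl_norm_mulmx n (Q : 'M[R]_n) (x : 'rV[R]_n) :
  Q *m Q^T = 1%:M -> eucl_norm (x *m Q) = eucl_norm x.
Proof.
move=> QQ; rewrite /eucl_norm !sum_sqr_mulmx.
by rewrite trmx_mul mulmxA -(mulmxA x) QQ mulmx1.
Qed.

Lemma eucl_normN n (x : 'rV[R]_n) : eucl_norm (- x) = eucl_norm x.
Proof.
by rewrite /eucl_norm; under eq_bigr do rewrite mxE sqrrN.
Qed.

Lemma measurable_mulmx n m (Q : 'M[R]_(n, m)) :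
  measurable_fun setT (fun x : 'rV[R]_n => x *m Q).
Proof.
apply: measurable_fun_rV => i.
under eq_fun do rewrite mxE.
apply: measurable_sum => j.
by apply: measurable_funM => //; exact: measurable_coord.
Qed.

Lemma measurable_eucl_norm n :
  measurable_fun setT (fun x : 'rV[R]_n => eucl_norm x : measurableTypeR R).
Proof.
apply: (measurableT_comp (f := (Num.sqrt : measurableTypeR R -> measurableTypeR R))).
  by apply: continuous_measurable_fun; exact: sqrt_continuous.
apply: measurable_sum => i; apply: measurable_funX; exact: measurable_coord.
Qed.

Lemma measurable_eucl_ball n : measurable [set x : 'rV[R]_n | eucl_norm x <= 1].
Proof.
rewrite (_ : mkset _ = (@eucl_norm R n) @^-1` `]-oo, 1]).
  by rewrite -[X in measurable X]setTI; apply: measurable_eucl_norm.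
by apply/seteqP; split => x /=; rewrite in_itv.
Qed.

Lemma lebesgue_rV_cube n (c : 'I_n -> R) (r : R) : 0 <= r ->
  mu n [set x | forall i, x 0 i \in `[c i - r, c i + r]] = ((2 * r) ^+ n)%:E.
Proof.
move=> r0.
have := @lebesgue_rV_box R n (fun i => `[c i - r, c i + r]%classic) (fun=> 2 * r).
rewrite prodr_const card_ord; apply => i //.
rewrite lebesgue_measure_itv/= lte_fin; case: ifPn => [_|].
  by rewrite -EFinB; congr EFin; ring.
by rewrite -leNgt => h; congr EFin; move: h r0; lra.
Qed.

Lemma measurable_cube n (c : 'I_n -> R) (r : R) :
  measurable [set x : 'rV[R]_n | forall i, x 0 i \in `[c i - r, c i + r]].
Proof.
rewrite (_ : mkset _ = \bigcap_(i in [set: 'I_n])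
    ((fun y : 'rV[R]_n => y 0 i : measurableTypeR R) @^-1` `[c i - r, c i + r])).
  apply: fin_bigcap_measurable => // i _.
  by rewrite -[X in measurable X]setTI; exact: measurable_coord.
by apply/seteqP; split => [y H i _|y H i]; exact: H.
Qed.

Lemma abs_coord_eucl_norm n (x : 'rV[R]_n) i : `|x 0 i| <= eucl_norm x.
Proof.
rewrite -sqrtr_sqr /eucl_norm ler_wsqrtr// (bigD1 i)//= lerDl.
by apply: sumr_ge0 => j _; exact: sqr_ge0.
Qed.

Lemma eucl_norm_le n (x : 'rV[R]_n) (r : R) : 0 <= r ->
  (forall i, `|x 0 i| <= r) -> eucl_norm x <= n%:R * r.
Proof.
move=> r0 xr.
have nr0 : 0 <= n%:R * r :> R by rewrite mulr_ge0.
rewrite -[leRHS](ger0_norm nr0) -sqrtr_sqr /eucl_norm ler_wsqrtr//.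
have -> : (n%:R * r) ^+ 2 = n%:R * (n%:R * r ^+ 2) by ring.
apply: (@le_trans _ _ (n%:R * r ^+ 2)).
  rewrite mulr_natl -[X in _ *+ X]card_ord -sumr_const; apply: ler_sum => i _.
  by rewrite -real_normK ?num_real// lerXn2r ?nnegrE//.
case: n {x xr nr0} => [|n]; first by rewrite !mul0r.
by rewrite ler_peMl ?mulr_ge0 ?sqr_ge0// ler1n.
Qed.

Lemma unit_ball_volume_pos n : exists2 w : R, 0 < w & unit_ball_volume R n = w%:E.
Proof.
rewrite /unit_ball_volume; set E := [set x | _].
have mE : measurable E by exact: measurable_eucl_ball.
have up : (mu n E <= ((2 * 1) ^+ n)%:E)%E.
  rewrite -(@lebesgue_rV_cube n (fun=> 0) 1)//; apply: le_measure.
  - by rewrite inE.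
  - by rewrite inE; exact: measurable_cube.
  - move=> x /= x1 i; rewrite in_itv/= sub0r add0r -ler_norml.
    exact: le_trans (abs_coord_eucl_norm _ _) x1.
(* [n.+1] instead of [n] keeps the half side of the inner cube positive in dimension 0. *)
have d0 : 0 < (n.+1%:R : R)^-1 by rewrite invr_gt0.
have lo : (((2 * n.+1%:R^-1) ^+ n)%:E <= mu n E)%E.
  rewrite -(@lebesgue_rV_cube n (fun=> 0) _ (ltW d0)).
  apply: le_measure.
  - by rewrite inE; exact: measurable_cube.
  - by rewrite inE.
  - move=> x /= xi; apply: le_trans (eucl_norm_le (ltW d0) _) _.
      by move=> i; have := xi i; rewrite in_itv/= sub0r add0r -ler_norml.
    by rewrite ler_pdivrMr// mul1r ler_nat.
have fE : mu n E \is a fin_num.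
  by rewrite ge0_fin_numE// (le_lt_trans up)// ltry.
exists (fine (mu n E)); last by rewrite fineK.
rewrite -lte_fin fineK//; apply: lt_le_trans lo.
by rewrite lte_fin exprn_gt0// mulr_gt0.
Qed.

(** With [E] the unit ball, let [W1] be the pairs with [x] in [E] and [x + y *m Q] in [B], and [W2]
    those with [x] in [B] and [x - y *m Q] in [E]. For fixed y the sections of [W1] and [W2] are
    translates of each other, so both sets have the same measure by Tonelli. For fixed x the
    sections are translates of the preimage of [B] and, since [E] is invariant under [Q], of [E]. So
    the preimage of [B] and [B] agree after multiplication by the measure of [E], which is positive
    and finite. *)
Lemma lebesgue_rV_rotate n (Q : 'M[R]_n) (B : set 'rV[R]_n) :
  Q *m Q^T = 1%:M -> measurable B ->
  mu n ((fun x => x *m Q) @^-1` B) = mu n B.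
Proof.
move=> QQ mB.
have [w w0 wE] := unit_ball_volume_pos n.
pose E := [set x : 'rV[R]_n | eucl_norm x <= 1].
have mE : measurable E by exact: measurable_eucl_ball.
have muE : mu n E = w%:E by [].
have mQ : measurable_fun setT (fun x : 'rV[R]_n => x *m Q).
  exact: measurable_mulmx.
have m1 : measurable_fun setT (fun z : 'rV[R]_n * 'rV[R]_n => z.1 + z.2 *m Q).
  apply: measurable_fun_rV => i; under eq_fun do rewrite mxE.
  apply: measurable_funD.
    exact: (measurableT_comp (measurable_coord i) measurable_fst).
  exact: (measurableT_comp (measurable_coord i) (measurableT_comp mQ measurable_snd)).
have m2 : measurable_fun setT (fun z : 'rV[R]_n * 'rV[R]_n => z.1 - z.2 *m Q).
  apply: measurable_fun_rV => i; under eq_fun do rewrite mxE.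
  apply: measurable_funD.
    exact: (measurableT_comp (measurable_coord i) measurable_fst).
  under eq_fun do rewrite mxE; apply: measurableT_comp => //.
  exact: (measurableT_comp (measurable_coord i) (measurableT_comp mQ measurable_snd)).
pose W1 := (fst @^-1` E) `&` ((fun z : 'rV[R]_n * 'rV[R]_n => z.1 + z.2 *m Q) @^-1` B).
pose W2 := (fst @^-1` B) `&` ((fun z : 'rV[R]_n * 'rV[R]_n => z.1 - z.2 *m Q) @^-1` E).
have mW1 : measurable W1.
  by apply: measurableI; rewrite -[X in measurable X]setTI; [exact: measurable_fst|exact: m1].
have mW2 : measurable W2.
  by apply: measurableI; rewrite -[X in measurable X]setTI; [exact: measurable_fst|exact: m2].
have tonelli (W : set ('rV[R]_n * 'rV[R]_n)) : measurable W ->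
    (\int[mu n]_x mu n (xsection W x) = \int[mu n]_y mu n (ysection W y))%E.
  move=> mW; apply: (product_measure_unique (m' := (mu n \x^ mu n)%E)) => //.
  by move=> ? ? ? ?; exact: product_measure2E.
have sec (A : set 'rV[R]_n) (F : 'rV[R]_n -> set 'rV[R]_n) (b : \bar R) :
    measurable A -> (forall x, mu n (F x) = b) ->
    (\int[mu n]_x mu n (xsection [set z | A z.1 /\ F z.1 z.2] x) = b * mu n A)%E.
  move=> mA Fb; rewrite -integral_cst// [RHS]integral_mkcond.
  apply: eq_integral => x _; rewrite patchE; case: ifPn => xA.
    rewrite -(Fb x); congr (mu n _); apply/seteqP; split => y;
      rewrite /xsection/= inE/=; first by case.
    by move=> ?; split=> //; rewrite inE in xA.
  rewrite (_ : xsection _ _ = set0) ?measure0//; apply/seteqP; split => y//.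
  by rewrite /xsection/= inE/= => -[Ax]; rewrite notin_setE in xA.
have QT : Q^T *m Q = 1%:M by exact: mulmx1C.
have e1 : (\int[mu n]_x mu n (xsection W1 x) =
    mu n ((fun x => x *m Q) @^-1` B) * mu n E)%E.
  apply: (sec E (fun x => [set y | B (x + y *m Q)])) => // x.
  rewrite -[RHS](lebesgue_rV_translate (x *m Q^T)).
    congr (mu n _); apply/seteqP; split => y /=;
      by rewrite mulmxDl -mulmxA QT mulmx1 addrC.
  by rewrite -[X in measurable X]setTI; exact: mQ.
have e2 : (\int[mu n]_x mu n (xsection W2 x) = mu n E * mu n B)%E.
  apply: (sec B (fun x => [set y | E (x - y *m Q)])) => // x.
  rewrite -[RHS](lebesgue_rV_translate (- (x *m Q^T)))//.
  have ee y : eucl_norm (x - y *m Q) = eucl_norm (y - x *m Q^T).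
    rewrite -eucl_normN opprB -[RHS](eucl_norm_mulmx _ QQ).
    by rewrite mulmxBl -mulmxA QT mulmx1.
  by congr (mu n _); apply/seteqP; split => y; rewrite /E/= ee.
have e3 : (\int[mu n]_y mu n (ysection W1 y) = \int[mu n]_y mu n (ysection W2 y))%E.
  apply: eq_integral => y _.
  rewrite -[RHS](lebesgue_rV_translate (y *m Q)); last exact: measurable_ysection.
  congr (mu n _); apply/seteqP; split => x; rewrite /ysection/= !inE /W1 /W2/=;
    by rewrite addrK => -[].
move: e1; rewrite tonelli// e3 -tonelli// e2 muE muleC => /esym.
move=> /(congr1 (fun x => x * (w^-1)%:E)%E).
by rewrite -!muleA -!EFinM mulfV ?gt_eqF// !mule1.
Qed.

End lebesgue_rV_rotate.

(** * Integration by parts *)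

Section integration.
Context d (T : measurableType d) (R : realType).
Variables (m : {measure set T -> \bar R}) (D : set T).
Hypothesis mD : measurable D.

Lemma bounded_fun_integrable (f : T -> R) (C : R) : (m D < +oo)%E ->
  measurable_fun D f -> (forall x, D x -> `|f x| <= C) ->
  m.-integrable D (EFin \o f).
Proof.
move=> Dfin mf fC; apply: measurable_bounded_integrable => //.
by exists C; split; rewrite ?num_real// => M CM x Dx; apply: le_trans (ltW CM); exact: fC.
Qed.

Lemma cvg_Rintegral (f_ : nat -> T -> R) (f g : T -> R) :
  (forall k, measurable_fun D (f_ k)) ->
  (forall x, D x -> f_ ^~ x @ \oo --> f x) ->
  (forall k x, D x -> `|f_ k x| <= g x) ->
  m.-integrable D (EFin \o g) ->
  \int[m]_(x in D) f_ k x @[k --> \oo] --> \int[m]_(x in D) f x.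
Proof.
move=> mf_ f_f f_g ig.
have mf : measurable_fun D f by exact: measurable_fun_cvg f_f.
have [|||||if_ _ cf] := @dominated_convergence _ _ _ m D mD
    (fun k => EFin \o f_ k) (EFin \o f) (EFin \o g).
- by move=> k; exact/measurable_EFinP.
- exact/measurable_EFinP.
- by apply: aeW => x Dx; apply: cvg_EFin; [exact: nearW|exact: f_f].
- exact: ig.
- by apply: aeW => x k Dx; rewrite lee_fin; exact: f_g.
by apply: fine_cvg; rewrite fineK//; exact: integrable_fin_num.
Qed.

Lemma Rintegral_sum I (s : seq I) (f : I -> T -> R) :
  (forall i, m.-integrable D (EFin \o f i)) ->
  \int[m]_(x in D) (\sum_(i <- s) f i x) = \sum_(i <- s) \int[m]_(x in D) f i x.
Proof.
move=> fi; elim: s => [|i s ih].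
  rewrite big_nil; under eq_Rintegral do rewrite big_nil.
  by rewrite Rintegral_cst// mul0r.
rewrite big_cons -ih -RintegralD//; first by under eq_Rintegral do rewrite big_cons.
rewrite (_ : EFin \o _ = fun x => \sum_(j <- s) (f j x)%:E)%E; last first.
  by apply/funext => x; rewrite /= sumEFin.
by apply: (integrable_sum mD) => i' _; exact: fi.
Qed.

End integration.

Section ibp.
Context {R : realType}.
Local Notation mu n := (lebesgue_rV R n).

Lemma Rintegral_translate n (v : 'rV[R]_n) (f : 'rV[R]_n -> R) :
  measurable_fun setT (f : 'rV[R]_n -> measurableTypeR R) ->
  (mu n).-integrable setT (EFin \o f \o (fun x => x + v)) ->
  \int[mu n]_x f (x + v) = \int[mu n]_x f x.
Proof.
move=> mf int; congr fine.
have mv := @measurable_translate R n v.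
have := @integral_pushforward _ _ _ _ _ _ mv (mu n) setT (EFin \o f).
rewrite preimage_setT => <-//; last exact/measurable_EFinP.
apply: eq_measure_integral => A mA _; exact: lebesgue_rV_translate.
Qed.

Lemma is_derive_line n (f : 'rV[R]_n -> R) (x v : 'rV[R]_n) (t : R) :
  derivable f (t *: v + x) v ->
  is_derive t 1 (fun s : R => f (s *: v + x)) ('D_v f (t *: v + x)).
Proof.
have e : (fun h : R => h^-1 *: (f (h *: v + (t *: v + x)) - f (t *: v + x))) =
  (fun h : R => h^-1 *: (f ((h *: 1 + t) *: v + x) - f (t *: v + x))).
  by apply/funext => h; rewrite [h *: 1]mulr1 scalerDl addrA.
by move=> df; apply: DeriveDef; [rewrite /derivable -e|rewrite /derive -e].
Qed.

Lemma mean_value_line n (f : 'rV[R]_n -> R) (x v : 'rV[R]_n) (h : R) : 0 < h ->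
  (forall y, derivable f y v) ->
  exists s, f (h *: v + x) - f x = 'D_v f (s *: v + x) * h.
Proof.
move=> h0 df.
have [||s _] := @MVT R (fun s : R => f (s *: v + x)) (fun s => 'D_v f (s *: v + x)) 0 h h0.
- by move=> t _; exact: is_derive_line.
- apply: derivable_within_continuous => t _.
  by have [] := @is_derive_line n f x v t (df _).
- by rewrite scale0r add0r subr0 => ->; exists s.
Qed.

Lemma compact_coord_bounded n (K : set 'rV[R]_n) : compact K ->
  exists2 r : R, 0 < r & forall x, K x -> forall i, `|x 0 i| <= r.
Proof.
move=> /compact_bounded [M [_ MK]]; exists (`|M| + 1).
  by rewrite ltr_wpDl.
move=> x Kx i; apply: le_trans (MK (`|M| + 1) _ x Kx); last first.
  by rewrite ltr_pwDr// ler_norm.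
rewrite [leRHS]mx_normrE.
exact: (le_bigmax _ (fun ij : 'I_1 * 'I_n => `|x ij.1 ij.2|) (0, i)).
Qed.

Lemma compact_fun_bounded n (K : set 'rV[R]_n) (f : 'rV[R]_n -> R) :
  compact K -> continuous f -> exists2 C, 0 < C & forall x, K x -> `|f x| <= C.
Proof.
move=> cK cf; have /compact_bounded [M [_ MK]] : compact (f @` K).
  by apply: continuous_compact => //; exact: continuous_subspaceT.
exists (`|M| + 1); first by rewrite ltr_wpDl.
by move=> x Kx; apply: MK; [rewrite ltr_pwDr// ler_norm|exists x].
Qed.

Lemma derive_outside n (K : set 'rV[R]_n) (f : 'rV[R]_n -> R) v x :
  compact K -> (forall y, ~ K y -> f y = 0) -> ~ K x -> 'D_v f x = 0.
Proof.
move=> cK f0 nKx; have cl : closed K.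
  by apply: compact_closed => //; exact: norm_hausdorff.
rewrite (@near_eq_derive _ _ _ f (cst 0)) ?derive_cst//.
have oK : open (~` K) by exact: closed_openC.
by apply: filterS (open_nbhs_nbhs (conj oK nKx)) => y; exact: f0.
Qed.

(** By translation invariance each difference quotient of [f] along [v] has integral 0. The
    quotients converge to the derivative, and the mean value theorem dominates them by the maximum
    of the derivative on one fixed cube. *)
Lemma Rintegral_derive0 n (K : set 'rV[R]_n) (f : 'rV[R]_n -> R) v :
  compact K -> (forall x, ~ K x -> f x = 0) ->
  continuous f -> (forall x, derivable f x v) -> continuous ('D_v f) ->
  \int[mu n]_x 'D_v f x = 0.
Proof.
move=> cK f0 cf df cDf.
have [r r0 Kr] := compact_coord_bounded cK.
have [C C0 DC] : exists2 C, 0 < C & forall x, `|'D_v f x| <= C.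
  have [C C0 KC] := compact_fun_bounded cK cDf; exists C => // x.
  have [/KC//|nKx] := pselect (K x).
  by rewrite (derive_outside v cK f0 nKx) normr0 ltW.
have [Cf Cf0 fC] : exists2 C, 0 < C & forall x, `|f x| <= C.
  have [Cf Cf0 KCf] := compact_fun_bounded cK cf; exists Cf => // x.
  by have [/KCf//|/f0->] := pselect (K x); rewrite normr0 ltW.
(* Enlarging by the norm of [v] makes the cube contain the supports of all translates by [t *: v]
   with [0 <= t <= 1]. *)
pose r' := r + `|v|.
have r'0 : 0 <= r' by rewrite addr_ge0 // ltW.
pose A := [set x : 'rV[R]_n | forall i, x 0 i \in `[0 - r', 0 + r']].
have mA : measurable A by exact: (measurable_cube (fun=> 0)).
have Afin : (mu n A < +oo)%E by rewrite (@lebesgue_rV_cube R n (fun=> 0))// ltry.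
have coordv i : `|v 0 i| <= `|v|.
  rewrite [leRHS]mx_normrE.
  exact: (le_bigmax _ (fun ij : 'I_1 * 'I_n => `|v ij.1 ij.2|) (0, i)).
have suppA t x : 0 <= t <= 1 -> f (x + t *: v) != 0 -> A x.
  move=> /andP[t0 t1] /eqP fx.
  have Kx : K (x + t *: v) by apply: contrapT => /f0.
  move=> i; have := Kr _ Kx i; rewrite !mxE in_itv/= sub0r add0r -ler_norml => h.
  rewrite -(addrK (t * v 0 i) (x 0 i)) (le_trans (ler_normB _ _))// lerD//.
  by rewrite normrM (ger0_norm t0) -[leRHS]mul1r ler_pM.
have intA (g : 'rV[R]_n -> R) c : measurable_fun setT (g : _ -> measurableTypeR R) ->
    (forall x, `|g x| <= c) -> (forall x, ~ A x -> g x = 0) ->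
    (mu n).-integrable setT (EFin \o g).
  move=> mg gc gA; have := (@bounded_fun_integrable _ _ R (mu n) A mA g c Afin).
  move=> /(_ (measurable_funTS mg) (fun x _ => gc x)).
  move=> /(integrable_mkcond _ mA).1; congr integrable; apply/funext => x.
  by rewrite patchE; case: ifPn => //; rewrite notin_setE => /gA /= ->.
pose q k (x : 'rV[R]_n) := k.+1%:R * (f (x + k.+1%:R^-1 *: v) - f x).
have hk k : 0 < (k.+1%:R : R)^-1 <= 1.
  by rewrite invr_gt0 ltr0n/= invf_le1 ?ler1n// ltr0n.
have mf : measurable_fun setT (f : _ -> measurableTypeR R).
  exact: continuous_measurable_rV.
have mfv (w : 'rV[R]_n) : measurable_fun setT ((fun x => f (x + w)) : _ -> measurableTypeR R).
  by apply: (measurableT_comp (f := (f : _ -> measurableTypeR R))) => //; exact: measurable_translate.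
have intf t : 0 <= t <= 1 -> (mu n).-integrable setT (EFin \o (fun x => f (x + t *: v))).
  move=> t01; apply: (intA _ Cf) => // x nAx; apply/eqP; apply: contra_notT nAx.
  exact: suppA.
have fE : f = (fun x => f (x + 0 *: v)) by apply/funext => x; rewrite scale0r addr0.
have int0 k : \int[mu n]_x q k x = 0.
  have hk' : 0 <= (k.+1%:R : R)^-1 <= 1 by have /andP[h0 h1] := hk k; rewrite (ltW h0).
  rewrite RintegralZl//; last first.
    apply: eq_integrable (integrableB measurableT (intf _ hk') (intf 0 _)) => //=.
      by move=> x _; rewrite /= scale0r addr0.
    by rewrite lexx ler01.
  rewrite RintegralB//.
  - by rewrite Rintegral_translate ?subrr ?mulr0//; exact: intf.
  - exact: intf.
  - by rewrite fE; apply: intf; rewrite lexx ler01.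
have : \int[mu n]_x q k x @[k --> \oo] --> \int[mu n]_x 'D_v f x.
  apply: (@cvg_Rintegral _ _ _ (mu n) setT measurableT q _ (fun x => C * \1_A x)) => //.
  - move=> k; apply: measurable_funM => //.
    by apply: measurable_funB => //; exact: mfv.
  - move=> x _.
    have dx : (fun h => h^-1 * (f (h *: v + x) - f x)) h @[h --> (0 : R)^'] -->
      'D_v f x by exact: df.
    have uv : (forall k, (k.+1%:R : R)^-1 != 0) /\ (k.+1%:R : R)^-1 @[k --> \oo] --> (0 : R).
      by split => [k|]; [rewrite invr_neq0|exact: cvg_harmonic].
    have := (cvgr_dnbhsP _ _ _).1 dx _ uv.
    suff -> : q ^~ x = fun k => (k.+1%:R^-1)^-1 * (f (k.+1%:R^-1 *: v + x) - f x) by [].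
    by apply/funext => k; rewrite /q invrK [x + _]addrC.
  - move=> k x _; rewrite /q.
    have [xA|xA] := pselect (A x).
      rewrite indicE mem_set// mulr1 [x + _]addrC.
      have /andP[hk0 _] := hk k.
      have [s ->] := mean_value_line x hk0 df.
      by rewrite mulrCA mulfV ?mulr1.
    rewrite indicE memNset// mulr0.
    have fx t : 0 <= t <= 1 -> f (x + t *: v) = 0.
      by move=> t01; apply/eqP; apply: contra_notT xA; exact: suppA.
    rewrite fx; last by have /andP[h0 h1] := hk k; rewrite (ltW h0).
    by rewrite fE fx ?lexx ?ler01// subrr mulr0 normr0.
  - apply: (intA _ C) => [|x|x xA]; last by rewrite indicE memNset// mulr0.
      by apply: measurable_funM => //; exact: measurable_indic.
    by rewrite indicE; case: (_ \in _); rewrite ?mulr1 ?mulr0 ?normr0 ?gtr0_norm// ltW.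
under eq_cvg do rewrite int0.
by move=> /cvg_lim <-//; rewrite lim_cst.
Qed.

End ibp.

(** * Smooth functions and product functions *)

Section smooth_functions.
Context {R : realType}.
Implicit Types (f g : R -> R) (x : R).

(** Level [k] asks for [k + 1] derivatives, so that the k-th one is continuous and [is_Ck k] follows
    for products of such functions. *)
Fixpoint smooth_upto (k : nat) g : Prop :=
  (forall x, derivable g x 1) /\
  (if k is k'.+1 then smooth_upto k' (derive1 g) else True).

Definition smooth g := forall k, smooth_upto k g.

Lemma smooth_upto_derivable k g x : smooth_upto k g -> derivable g x 1.
Proof. by case: k => [|k] []. Qed.

Lemma smooth_upto_is_derive k g x : smooth_upto k g -> is_derive x 1 g (derive1 g x).
Proof. by move=> /smooth_upto_derivable dg; rewrite derive1E; exact: derivableP. Qed.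

Lemma smooth_is_derive g x : smooth g -> is_derive x 1 g (derive1 g x).
Proof. by move=> /(_ 0%N); exact: smooth_upto_is_derive. Qed.

Lemma is_derive_derive1 g g' : (forall x, is_derive x 1 g (g' x)) -> derive1 g = g'.
Proof. by move=> dg; apply/funext => x; rewrite derive1E; exact: derive_val. Qed.

Lemma smooth_uptoS k g g' : (forall x, is_derive x 1 g (g' x)) ->
  smooth_upto k g' -> smooth_upto k.+1 g.
Proof.
by move=> dg sg'; split; [move=> x; have [] := dg x|rewrite (is_derive_derive1 dg)].
Qed.

Lemma smooth_uptoW k g : smooth_upto k.+1 g -> smooth_upto k g.
Proof.
elim: k g => [|k ih] g [dg sg]; first by split.
by split => //; exact: ih.
Qed.

Lemma smooth_derive1 g : smooth g -> smooth (derive1 g).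
Proof. by move=> sg k; have [] := sg k.+1. Qed.

Lemma smooth_upto_cst k c : smooth_upto k (cst c).
Proof.
elim: k c => [|k ih] c; first by split=> // x; exact: derivable_cst.
by apply: smooth_uptoS (ih 0) => x; exact: is_derive_cst.
Qed.

Lemma smooth_upto_id k : smooth_upto k id.
Proof.
case: k => [|k]; first by split=> // x; exact: derivable_id.
by apply: smooth_uptoS (smooth_upto_cst k 1) => x; exact: is_derive_id.
Qed.

Lemma smooth_uptoD k f g : smooth_upto k f -> smooth_upto k g ->
  smooth_upto k (fun x => f x + g x).
Proof.
elim: k f g => [|k ih] f g sf sg.
  by split=> // x; apply: derivableD; exact: (smooth_upto_derivable (k := 0)).
apply: (@smooth_uptoS _ _ (fun x => derive1 f x + derive1 g x)).
  by move=> x; apply: is_deriveD; apply: (@smooth_upto_is_derive k.+1).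
by case: sf sg => _ sf [_ sg]; exact: ih.
Qed.

Lemma smooth_uptoM k f g : smooth_upto k f -> smooth_upto k g ->
  smooth_upto k (fun x => f x * g x).
Proof.
elim: k f g => [|k ih] f g sf sg.
  by split=> // x; apply: derivableM; exact: (smooth_upto_derivable (k := 0)).
apply: (@smooth_uptoS _ _ (fun x => f x * derive1 g x + g x * derive1 f x)).
  by move=> x; apply: is_deriveM; apply: (@smooth_upto_is_derive k.+1).
by apply: smooth_uptoD; apply: ih;
  [exact: smooth_uptoW|case: sg|exact: smooth_uptoW|case: sf].
Qed.

Lemma smooth_upto_comp k f g : smooth_upto k f -> smooth_upto k g ->
  smooth_upto k (f \o g).
Proof.
elim: k f g => [|k ih] f g sf sg.
  split=> // x; have df := smooth_upto_is_derive (g x) sf.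
  by have dg := smooth_upto_is_derive x sg; have [] := is_derive1_comp df dg.
apply: (@smooth_uptoS _ _ (fun x => (derive1 f \o g) x * derive1 g x)).
  by move=> x; apply: is_derive1_comp; apply: (@smooth_upto_is_derive k.+1).
apply: smooth_uptoM; last by case: sg.
by apply: ih; [case: sf|exact: smooth_uptoW].
Qed.

Lemma smooth_cst c : smooth (cst c).
Proof. by move=> k; exact: smooth_upto_cst. Qed.

Lemma smooth_id : smooth id.
Proof. by move=> k; exact: smooth_upto_id. Qed.

Lemma smoothD f g : smooth f -> smooth g -> smooth (fun x => f x + g x).
Proof. by move=> sf sg k; exact: smooth_uptoD. Qed.

Lemma smoothM f g : smooth f -> smooth g -> smooth (fun x => f x * g x).
Proof. by move=> sf sg k; exact: smooth_uptoM. Qed.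

Lemma smooth_comp f g : smooth f -> smooth g -> smooth (f \o g).
Proof. by move=> sf sg k; exact: smooth_upto_comp. Qed.

(** Both functions are treated at once and with a free factor, because this family is closed under
    differentiation and the induction on the order closes. *)
Lemma smooth_cos_sin c : smooth (fun x => c * cos x) /\ smooth (fun x => c * sin x).
Proof.
suff H k : forall d, smooth_upto k (fun x => d * cos x) /\ smooth_upto k (fun x => d * sin x).
  by split=> k; have [] := H k c.
have dc d x : is_derive x 1 (fun x => d * cos x) (- d * sin x).
  rewrite mulNr -mulrN; exact: (@is_deriveZ _ _ _ cos d x 1 (- sin x)).
have ds d x : is_derive x 1 (fun x => d * sin x) (d * cos x).
  exact: (@is_deriveZ _ _ _ sin d x 1 (cos x)).
elim: k => [|k ih] d.
  by split; split.
by split; [apply: (smooth_uptoS (dc d)); have [] := ih (- d)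
          |apply: (smooth_uptoS (ds d)); have [] := ih d].
Qed.

Lemma smooth_cos : smooth cos.
Proof.
have [+ _] := smooth_cos_sin 1; congr smooth; apply/funext => x; exact: mul1r.
Qed.

Lemma smooth_sin : smooth sin.
Proof.
have [_] := smooth_cos_sin 1; congr smooth; apply/funext => x; exact: mul1r.
Qed.

(* The family is closed under differentiation, which makes [flat_exp 0],
   that is [exp (- 1 / s)] extended by 0, smooth across 0. *)
Definition flat_exp (j : nat) (s : R) : R :=
  if 0 < s then s^-1 ^+ j * expR (- s^-1) else 0.

(** For positive [N] this is the N-th power of [u / N <= expR (u / N)]. *)
Lemma expr_expRN_le (N : nat) (u : R) : 0 <= u ->
  u ^+ N * expR (- u) <= N%:R ^+ N.
Proof.
move=> u0; case: N => [|N].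
  by rewrite !expr0 mul1r expR_le1 oppr_le0.
have N0 : 0 < N.+1%:R :> R by rewrite ltr0n.
rewrite expRN ler_pdivrMr ?expR_gt0//.
have -> : u = N.+1%:R * (u / N.+1%:R) by rewrite mulrCA mulfV ?mulr1// gt_eqF.
rewrite expRM_natl exprMn ler_pM2l ?exprn_gt0//.
rewrite lerXn2r ?nnegrE ?divr_ge0 ?expR_ge0// ?(ltW N0)//.
by apply: le_trans (expR_ge1Dx _); rewrite lerDr.
Qed.

Lemma flat_exp_ge0 j s : 0 <= flat_exp j s.
Proof.
rewrite /flat_exp; case: ifPn => // s0.
by rewrite mulr_ge0 ?expR_ge0// exprn_ge0// invr_ge0 ltW.
Qed.

Lemma flat_exp_le j s : flat_exp j s <= j.+1%:R ^+ j.+1 * `|s|.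
Proof.
rewrite /flat_exp; case: ifPn => s0; last by rewrite mulr_ge0// exprn_ge0.
have i0 : 0 <= s^-1 by rewrite invr_ge0 ltW.
rewrite gtr0_norm// -ler_pdivrMr//.
by apply: le_trans (expr_expRN_le j.+1 i0); rewrite mulrAC -exprSr.
Qed.

Lemma flat_exp_derive j x :
  is_derive x 1 (flat_exp j) (flat_exp j.+2 x - j%:R * flat_exp j.+1 x).
Proof.
have [x0|x0|->] := ltgtP x 0.
- rewrite /flat_exp ltNge (ltW x0)/= mulr0 subr0.
  apply: (@near_eq_is_derive _ _ _ (cst 0)).
  near=> y; rewrite ltNge ifF// ; apply/negbF/ltW; near: y.
  exact: lt_nbhsl.
- rewrite {2 3}/flat_exp x0.
  apply: (@near_eq_is_derive _ _ _ ((fun u => u ^+ j * expR (- u)) \o (fun y => y^-1))).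
    near=> y; rewrite /flat_exp ifT//; near: y.
    exact: lt_nbhsr.
  have di : is_derive x 1 (fun y : R => y^-1) (- x ^- 2).
    have := @is_deriveV R id x 1 1; rewrite gt_eqF// => /(_ erefl (is_derive_id _ _)).
    by rewrite /= [_ *: 1]mulr1.
  have de : is_derive x^-1 1 (fun u => u ^+ j * expR (- u))
      (x^-1 ^+ j * (expR (- x^-1) * -1) + expR (- x^-1) * (j%:R * x^-1 ^+ j.-1)).
    apply: is_deriveM.
    have := @is_deriveX _ _ (id : R -> R) j x^-1 1 1 (is_derive_id _ _).
    rewrite /= [_ *: 1]mulr1; congr is_derive.
    by apply/funext => u; rewrite exprfctE.
  have := is_derive1_comp de di; congr is_derive.
  move: (expR _) => E; have xn0 : x != 0 by rewrite gt_eqF.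
  rewrite -[x ^- 2]exprVn; move: (x^-1) => u; case: j {de} => [|j] /=.
    by rewrite !mul0r mulr0 addr0 subr0 !expr0; ring.
  by rewrite !exprS; ring.
(* At 0 the slope [flat_exp j z / z] is [flat_exp j.+1 z], which tends to 0 by the linear bound
   [flat_exp_le]. *)
- rewrite {2 3}/flat_exp ltxx mulr0 subr0; apply/is_derive1_caratheodory.
  exists (flat_exp j.+1); split; last by rewrite /flat_exp ltxx.
    move=> z; rewrite /flat_exp ltxx !subr0; case: ifPn => [z0|]; last by rewrite mul0r.
    by rewrite exprS; field; rewrite gt_eqF.
  have f0 : flat_exp j.+1 0 = 0 by rewrite /flat_exp ltxx.
  apply/cvgrPdist_le => e e0.
  pose c : R := j.+2%:R ^+ j.+2; have c0 : 0 < c by rewrite exprn_gt0 ?ltr0n.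
  near=> z; rewrite f0 sub0r normrN ger0_norm ?flat_exp_ge0//.
  apply: le_trans (flat_exp_le _ _) _.
  rewrite -/c mulrC -ler_pdivlMr// -[ `|z|]normrN -sub0r; near: z.
  by apply: cvgr_dist_le; [exact: cvg_id|exact: divr_gt0].
Unshelve. all: by end_near. Qed.

Lemma smooth_flat_exp j : smooth (flat_exp j).
Proof.
move=> k; elim: k j => [|k ih] j.
  by split=> // x; have [] := flat_exp_derive j x.
apply: (smooth_uptoS (flat_exp_derive j)); apply: smooth_uptoD => //.
suff -> : (fun x => - (j%:R * flat_exp j.+1 x)) = fun x => cst (- j%:R) x * flat_exp j.+1 x.
  by apply: smooth_uptoM => //; exact: smooth_upto_cst.
by apply/funext => x; rewrite mulNr.
Qed.

Lemma flat_exp0_le1 s : flat_exp 0 s <= 1.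
Proof.
rewrite /flat_exp; case: ifPn => // s0; rewrite mul1r expR_le1 oppr_le0.
by rewrite invr_ge0 ltW.
Qed.

Lemma flat_exp0_ge s : 0 < s -> 1 - s^-1 <= flat_exp 0 s.
Proof. by move=> s0; rewrite /flat_exp s0 mul1r; exact: expR_ge1Dx. Qed.

(** Meant for [t = (m + 1) * s * (L - s)], where it controls the derivative of the cutoffs uniformly
    in m. With [u = 1 / (t - 1)] the left side is [(1 + u) ^+ 2 * expR (- u)], and
    [expR (u / 2) >= 1 + u / 2] gives the constant 4. *)
Lemma flat_exp2_le t : t ^+ 2 * flat_exp 2 (t - 1) <= 4.
Proof.
rewrite /flat_exp subr_gt0; case: ifPn => t1; last by rewrite mulr0.
pose u := (t - 1)^-1.
have u0 : 0 < u by rewrite invr_gt0 subr_gt0.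
have -> : t = 1 + u^-1 by rewrite invrK; ring.
have -> : (1 + u^-1 - 1)^-1 = u by rewrite addrC addKr invrK.
have -> : (1 + u^-1) ^+ 2 * (u ^+ 2 * expR (- u)) = (1 + u) ^+ 2 * expR (- u).
  by field; rewrite gt_eqF.
rewrite expRN ler_pdivrMr ?expR_gt0//.
have -> : expR u = expR (u / 2) ^+ 2 by rewrite -expRM_natl; congr expR; field.
have := expR_ge1Dx (u / 2); set E := expR _ => h.
by nra.
Qed.

End smooth_functions.

Section directional_derivatives.
Context {R : realType} {V : normedModType R}.
Implicit Types (f : V -> R) (x v : V).

Lemma is_derive_slice f x v (df : R) :
  is_derive (0 : R) 1 (fun h : R => f (h *: v + x)) df -> is_derive x v f df.
Proof.
have e : (fun h : R => h^-1 *: (f ((h *: 1 + 0 : R) *: v + x) - f ((0 : R) *: v + x))) =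
  (fun h : R => h^-1 *: (f (h *: v + x) - f x)).
  by apply/funext => h; rewrite [h *: 1]mulr1 addr0 scale0r add0r.
by move=> [df1 df2]; apply: DeriveDef; [move: df1|move: df2];
  rewrite /derivable /derive e.
Qed.

(** Leibniz rule in which the differentiated factor is recognised by its index, hence the condition
    [uniq]. *)
Lemma is_derive_prod (I : eqType) (r : seq I) (f : I -> V -> R) (df : I -> R) x v :
  uniq r -> (forall i, is_derive x v (f i) (df i)) ->
  is_derive x v (fun y => \prod_(i <- r) f i y)
    (\sum_(i <- r) \prod_(j <- r) (if j == i then df i else f j x)).
Proof.
move=> + dfi; elim: r => [_|i r ih /= /andP[ir ur]].
  rewrite big_nil; under eq_fun do rewrite big_nil.
  exact: is_derive_cst.
under eq_fun do rewrite big_cons.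
have := @is_deriveM _ _ (f i) (fun y => \prod_(j <- r) f j y) x v _ _ (dfi i) (ih ur).
congr is_derive; rewrite big_cons big_cons eqxx addrC; congr (_ + _).
  rewrite [LHS]mulrC; congr (_ * _); rewrite !big_seq; apply: eq_bigr => j jr.
  by rewrite ifN//; apply: contraNneq ir => <-.
rewrite /GRing.scale/= big_distrr/= !big_seq; apply: eq_bigr => j jr.
by rewrite big_cons ifN//; apply: contraNneq ir => ->.
Qed.

Lemma is_derive_lincomb (I : Type) (r : seq I) (c : I -> R) (f : I -> V -> R)
    (df : I -> R) x v :
  (forall i, is_derive x v (f i) (df i)) ->
  is_derive x v (fun y => \sum_(i <- r) c i * f i y) (\sum_(i <- r) c i * df i).
Proof.
move=> dfi; elim: r => [|i r ih].
  rewrite big_nil; under eq_fun do rewrite big_nil.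
  exact: is_derive_cst.
rewrite big_cons; under eq_fun do rewrite big_cons.
by apply: is_deriveD; apply: is_deriveZ.
Qed.

Lemma continuous_lincomb (I : Type) (r : seq I) (c : I -> R) (f : I -> V -> R) :
  (forall i, continuous (f i)) -> continuous (fun y => \sum_(i <- r) c i * f i y).
Proof.
move=> cf; elim: r => [|i r ih] x.
  under eq_fun do rewrite big_nil; exact: cvg_cst.
under eq_fun do rewrite big_cons; apply: cvgD; last exact: ih.
by apply: cvgM; [exact: cvg_cst|exact: cf].
Qed.

Lemma continuous_prod (I : Type) (r : seq I) (f : I -> V -> R) :
  (forall i, continuous (f i)) -> continuous (fun y => \prod_(i <- r) f i y).
Proof.
move=> cf; elim: r => [|i r ih] x.
  under eq_fun do rewrite big_nil; exact: cvg_cst.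
by under eq_fun do rewrite big_cons; apply: cvgM; [exact: cf|exact: ih].
Qed.

End directional_derivatives.

Section Ck.
Context {R : realType} {n : nat}.
Implicit Types f : 'rV[R]_n -> R.

Lemma is_Ck_continuous k f : is_Ck k f -> continuous f.
Proof. by case: k => [|k] []. Qed.

Lemma partialE f (df : 'rV[R]_n -> R) i :
  (forall x, is_derive x (delta_mx 0 i) f (df x)) -> partial i f = df.
Proof. by move=> dfi; apply/funext => x; exact: derive_val. Qed.

Lemma is_Ck_lincomb k (I : Type) (r : seq I) (c : I -> R) (f : I -> 'rV[R]_n -> R) :
  (forall i, is_Ck k (f i)) -> is_Ck k (fun y => \sum_(i <- r) c i * f i y).
Proof.
elim: k f => [|k ih] f cf.
  by split=> //; apply: continuous_lincomb => i; exact: is_Ck_continuous (cf i).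
split; first by apply: continuous_lincomb => i; exact: is_Ck_continuous (cf i).
move=> j.
have d x : is_derive x (delta_mx 0 j) (fun y => \sum_(i <- r) c i * f i y)
    (\sum_(i <- r) c i * partial j (f i) x).
  apply: is_derive_lincomb => i; apply: derivableP.
  by case: (cf i) => _ /(_ j)[].
split; first by move=> x; have [] := d x.
by rewrite (partialE d); apply: ih => i; case: (cf i) => _ /(_ j)[].
Qed.

End Ck.

Section tensor.
Context {R : realType} {n : nat}.
Variables (a : 'rV[R]_n) (Q : 'M[R]_n).
Implicit Types (g : 'I_n -> R -> R) (x v : 'rV[R]_n).

(** For orthogonal [Q] these are the coordinates inverting [y => a + y *m Q], in which the rectangle
    becomes a product of intervals. *)
Definition bcoord i x : R := ((x - a) *m Q^T) 0 i.

Definition tensor g x : R := \prod_i g i (bcoord i x).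

Definition upd (T : Type) (g : 'I_n -> T) (i : 'I_n) (h : T) : 'I_n -> T :=
  fun j => if j == i then h else g j.

Lemma bcoord_line i (h : R) v x :
  bcoord i (h *: v + x) = h * (v *m Q^T) 0 i + bcoord i x.
Proof. by rewrite /bcoord -addrA mulmxDl -scalemxAl !mxE. Qed.

Lemma bcoordE i x : bcoord i x = \sum_j Q i j * (x 0 j - a 0 j).
Proof.
by rewrite /bcoord mxE; apply: eq_bigr => j _; rewrite !mxE mulrC.
Qed.

Lemma continuous_bcoord i : continuous (bcoord i).
Proof.
rewrite (_ : bcoord i = fun x => \sum_j Q i j * (x 0 j - a 0 j)).
  apply: (@continuous_lincomb R _ _ _ (Q i) (fun j (x : 'rV[R]_n) => x 0 j - a 0 j)) => j x.
  apply: (@continuousB R R^o _ (fun x : 'rV[R]_n => x 0 j) (cst (a 0 j)) x); [exact: coord_continuous|exact: cst_continuous].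
by apply/funext => x; exact: bcoordE.
Qed.

Lemma is_derive_bcoord (g : R -> R) (dg : R) i x v :
  is_derive (bcoord i x) 1 g dg ->
  is_derive x v (fun y => g (bcoord i y)) ((v *m Q^T) 0 i * dg).
Proof.
move=> dgi; apply: is_derive_slice; under eq_fun do rewrite bcoord_line.
set s := (v *m Q^T) 0 i; set c := bcoord i x.
have da : is_derive (0 : R) 1 (fun h => h * s + c) s.
  have -> : (fun h : R => h * s + c) = (fun h => s * id h + cst c h).
    by apply/funext => h; rewrite mulrC.
  have := is_deriveD (@is_deriveZ _ _ _ id s (0 : R) 1 1 (is_derive_id _ _)) (is_derive_cst c (0 : R) 1).
  by congr is_derive; rewrite addr0 [_ *: _]mulr1.
have dgi' : is_derive ((fun h : R => h * s + c) 0) 1 g dg by rewrite mul0r add0r.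
have := @is_derive1_comp R g (fun h => h * s + c) 0 dg s dgi' da; congr is_derive; exact: mulrC.
Qed.

Lemma is_derive_tensor g (dg : 'I_n -> R -> R) x v :
  (forall i (y : R), is_derive y 1 (g i) (dg i y)) ->
  is_derive x v (tensor g) (\sum_i (v *m Q^T) 0 i * tensor (upd g i (dg i)) x).
Proof.
move=> dgi; have di i := @is_derive_bcoord (g i) (dg i (bcoord i x)) i x v (dgi _ _).
have := is_derive_prod (index_enum_uniq _) di.
congr is_derive; apply: eq_bigr => i _.
rewrite /tensor (bigD1 i)//= [X in _ = _ * X](bigD1 i)//= /upd !eqxx mulrA.
by congr (_ * _); apply: eq_bigr => j /negPf ->.
Qed.

Lemma tensor_continuous g : (forall i, continuous (g i)) -> continuous (tensor g).
Proof.
move=> cg; apply: continuous_prod => i x.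
apply: (@continuous_comp _ _ _ (bcoord i) (g i)); first exact: continuous_bcoord.
exact: cg.
Qed.

Lemma smooth_upto_continuous k (h : R -> R) : smooth_upto k h -> continuous h.
Proof.
move=> sh x; apply/differentiable_continuous/derivable1_diffP.
exact: smooth_upto_derivable sh.
Qed.

Lemma delta_mx_bcoord i j : ((delta_mx 0 j : 'rV[R]_n) *m Q^T) 0 i = Q i j.
Proof. by rewrite -rowE !mxE. Qed.

Lemma is_Ck_tensor k g : (forall i, smooth_upto k (g i)) -> is_Ck k (tensor g).
Proof.
elim: k g => [|k ih] g sg.
  by split=> //; apply: tensor_continuous => i; exact: smooth_upto_continuous (sg i).
split; first by apply: tensor_continuous => i; exact: smooth_upto_continuous (sg i).
move=> j.
have d x := @is_derive_tensor g (fun i => derive1 (g i)) x (delta_mx 0 j)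
  (fun i y => smooth_upto_is_derive y (sg i)).
split; first by move=> x; have [] := d x.
rewrite (partialE d); apply: is_Ck_lincomb => i; apply: ih => l.
rewrite /upd; case: eqP => [_|_]; last exact: smooth_uptoW.
by case: (sg i).
Qed.

End tensor.

(** * The L^2 inner product and weak gradients *)

Section inner_product.
Context {R : realType} {n : nat}.
Variable Omega : set 'rV[R]_n.
Hypotheses (mO : measurable Omega) (finO : (lebesgue_rV R n Omega < +oo)%E).
Local Notation mu := (lebesgue_rV R n).
Implicit Types (u v f : 'rV[R]_n -> R).

Definition bounded_mfun f := measurable_fun Omega (f : _ -> measurableTypeR R) /\
  exists C, forall x, Omega x -> `|f x| <= C.

Lemma bounded_mfun_integrable f : bounded_mfun f -> mu.-integrable Omega (EFin \o f).
Proof. by move=> [mf [C fC]]; exact: (bounded_fun_integrable mO finO mf fC). Qed.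

Lemma bounded_mfun_cst c : bounded_mfun (cst c).
Proof. by split; [exact: measurable_cst|exists `|c|]. Qed.

Lemma bounded_mfunM f g : bounded_mfun f -> bounded_mfun g ->
  bounded_mfun (fun x => f x * g x).
Proof.
move=> [mf [C fC]] [mg [D gD]]; split; first exact: measurable_funM.
by exists (C * D) => x Ox; rewrite normrM ler_pM ?fC ?gD.
Qed.

Lemma bounded_mfunD f g : bounded_mfun f -> bounded_mfun g ->
  bounded_mfun (fun x => f x + g x).
Proof.
move=> [mf [C fC]] [mg [D gD]]; split; first exact: measurable_funD.
by exists (C + D) => x Ox; rewrite (le_trans (ler_normD _ _))// lerD ?fC ?gD.
Qed.

Lemma bounded_mfun_sum (I : Type) (r : seq I) (f : I -> 'rV[R]_n -> R) :
  (forall i, bounded_mfun (f i)) -> bounded_mfun (fun x => \sum_(i <- r) f i x).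
Proof.
move=> bf; elim: r => [|i r ih].
  by under eq_fun do rewrite big_nil; exact: bounded_mfun_cst.
by under eq_fun do rewrite big_cons; exact: bounded_mfunD.
Qed.

Lemma bounded_mfun_sqint f : bounded_mfun f -> sq_integrable Omega f.
Proof.
move=> bf; split; first by case: bf.
have /bounded_mfun_integrable /integrable_lty : bounded_mfun (fun x => f x * f x).
  exact: bounded_mfunM.
move=> /(_ mO) => h; apply: le_lt_trans h; rewrite le_eqVlt; apply/orP; left.
by apply/eqP; apply: eq_integral => x _.
Qed.

Lemma sqint_integrable_sqr u : sq_integrable Omega u ->
  mu.-integrable Omega (EFin \o (fun x => u x ^+ 2)).
Proof.
move=> [mu_ ui]; apply/integrableP; split.
  by apply/measurable_EFinP; exact: measurable_funX.
apply: le_lt_trans ui; rewrite le_eqVlt; apply/orP; left; apply/eqP.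
by apply: eq_integral => x _ /=; rewrite ger0_norm// sqr_ge0.
Qed.

Lemma sqint_mul u v : sq_integrable Omega u -> sq_integrable Omega v ->
  mu.-integrable Omega (EFin \o (fun x => u x * v x)).
Proof.
move=> su sv.
have := integrableD mO (sqint_integrable_sqr su) (sqint_integrable_sqr sv).
apply: le_integrable => //.
  by apply/measurable_EFinP; apply: measurable_funM; [case: su|case: sv].
move=> x _; rewrite /= lee_fin [leRHS]ger0_norm ?addr_ge0 ?sqr_ge0// ler_norml.
apply/andP; split; have := sqr_ge0 (u x + v x); have := sqr_ge0 (u x - v x);
  have := sqr_ge0 (u x); have := sqr_ge0 (v x); rewrite !expr2; nra.
Qed.

Lemma sqint_integrable u : sq_integrable Omega u -> mu.-integrable Omega (EFin \o u).
Proof.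
move=> su; have := sqint_mul su (bounded_mfun_sqint (bounded_mfun_cst 1)).
by congr integrable; apply/funext => x /=; rewrite mulr1.
Qed.

Lemma sqintD u v : sq_integrable Omega u -> sq_integrable Omega v ->
  sq_integrable Omega (fun x => u x + v x).
Proof.
move=> su sv; split; first by apply: measurable_funD; [case: su|case: sv].
have := integrableD mO (integrableD mO (sqint_integrable_sqr su) (sqint_integrable_sqr sv))
  (integrableZl mO 2 (sqint_mul su sv)).
move=> /integrable_lty => /(_ mO); apply: le_lt_trans.
rewrite le_eqVlt; apply/orP; left; apply/eqP; apply: eq_integral => x _ /=.
by rewrite -EFinM -!EFinD; congr EFin; ring.
Qed.

Lemma sqintZ c u : sq_integrable Omega u -> sq_integrable Omega (fun x => c * u x).
Proof.
move=> su; split; first by apply: measurable_funM => //; case: su.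
have := integrableZl mO (c ^+ 2) (sqint_integrable_sqr su).
move=> /integrable_lty => /(_ mO); apply: le_lt_trans.
rewrite le_eqVlt; apply/orP; left; apply/eqP; apply: eq_integral => x _ /=.
by rewrite -EFinM; congr EFin; ring.
Qed.

Lemma sqintB u v : sq_integrable Omega u -> sq_integrable Omega v ->
  sq_integrable Omega (u \- v).
Proof.
move=> su sv; have := sqintD su (sqintZ (-1) sv); congr sq_integrable.
by apply/funext => x /=; rewrite mulN1r.
Qed.

Lemma sqint_lincomb (I : Type) (r : seq I) (c : I -> R) (f : I -> 'rV[R]_n -> R) :
  (forall i, sq_integrable Omega (f i)) ->
  sq_integrable Omega (fun x => \sum_(i <- r) c i * f i x).
Proof.
move=> sf; elim: r => [|i r ih].
  under eq_fun do rewrite big_nil.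
  exact: bounded_mfun_sqint (bounded_mfun_cst 0).
by under eq_fun do rewrite big_cons; apply: sqintD => //; exact: sqintZ.
Qed.

Lemma innerC u v : inner Omega u v = inner Omega v u.
Proof. by apply: eq_Rintegral => x _; rewrite mulrC. Qed.

Lemma eq_inner u v u' v' : (forall x, Omega x -> u x = u' x) ->
  (forall x, Omega x -> v x = v' x) -> inner Omega u v = inner Omega u' v'.
Proof. by move=> uu vv; apply: eq_Rintegral => x; rewrite inE => Ox; rewrite uu ?vv. Qed.

Lemma inner_lincombl (I : Type) (r : seq I) (c : I -> R) (f : I -> 'rV[R]_n -> R) v :
  (forall i, sq_integrable Omega (f i)) -> sq_integrable Omega v ->
  inner Omega (fun x => \sum_(i <- r) c i * f i x) v =
  \sum_(i <- r) c i * inner Omega (f i) v.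
Proof.
move=> sf sv; rewrite /inner.
under eq_Rintegral do rewrite big_distrl/=.
rewrite (Rintegral_sum mO)//.
  apply: eq_bigr => i _; rewrite -RintegralZl//; last exact: sqint_mul.
  by apply: eq_Rintegral => x _; rewrite mulrA.
move=> i; have := integrableZl mO (c i) (sqint_mul (sf i) sv).
by congr integrable; apply/funext => x /=; rewrite -EFinM mulrA.
Qed.

Lemma inner_lincombr (I : Type) (r : seq I) (c : I -> R) (f : I -> 'rV[R]_n -> R) v :
  (forall i, sq_integrable Omega (f i)) -> sq_integrable Omega v ->
  inner Omega v (fun x => \sum_(i <- r) c i * f i x) =
  \sum_(i <- r) c i * inner Omega v (f i).
Proof.
move=> sf sv; rewrite innerC inner_lincombl//.
by apply: eq_bigr => i _; rewrite innerC.
Qed.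

Lemma innerDl u v f : sq_integrable Omega u -> sq_integrable Omega v ->
  sq_integrable Omega f ->
  inner Omega (fun x => u x + v x) f = inner Omega u f + inner Omega v f.
Proof.
move=> su sv sf; rewrite /inner -RintegralD//; try exact: sqint_mul.
by apply: eq_Rintegral => x _; rewrite mulrDl.
Qed.

Lemma innerZl c u f : sq_integrable Omega u -> sq_integrable Omega f ->
  inner Omega (fun x => c * u x) f = c * inner Omega u f.
Proof.
move=> su sf; rewrite /inner -RintegralZl//; last exact: sqint_mul.
by apply: eq_Rintegral => x _; rewrite mulrA.
Qed.

Lemma innerBl u v f : sq_integrable Omega u -> sq_integrable Omega v ->
  sq_integrable Omega f ->
  inner Omega (u \- v) f = inner Omega u f - inner Omega v f.
Proof.
move=> su sv sf; rewrite /inner -RintegralB//; try exact: sqint_mul.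
by apply: eq_Rintegral => x _; rewrite mulrBl.
Qed.

Lemma inner_ge0 u : 0 <= inner Omega u u.
Proof. by apply: Rintegral_ge0 => x _; rewrite -expr2 sqr_ge0. Qed.

(** Young's inequality, from [e * (p - e^-1 * q) ^+ 2 >= 0], with the factor 1/2 given away. The
    free [e] allows the first term to be made small or to be absorbed. *)
Lemma inner_le_sqr u v (e : R) : 0 < e -> sq_integrable Omega u ->
  sq_integrable Omega v ->
  `|inner Omega u v| <= e * inner Omega u u + e^-1 * inner Omega v v.
Proof.
move=> e0 su sv.
have le1 (w : 'rV[R]_n -> R) : sq_integrable Omega w ->
    inner Omega u w <= e * inner Omega u u + e^-1 * inner Omega w w.
  move=> sw; rewrite -!innerZl// /inner -RintegralD//; last 2 first.
  - by apply: sqint_mul => //; exact: sqintZ.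
  - by apply: sqint_mul => //; exact: sqintZ.
  apply: le_Rintegral => //; first exact: sqint_mul.
    exact: (integrableD mO (sqint_mul (sqintZ e su) su) (sqint_mul (sqintZ e^-1 sw) sw)).
  move=> x _; set p := u x; set q := w x.
  have i0 : 0 < e^-1 by rewrite invr_gt0.
  have ei : e * e^-1 = 1 by rewrite mulfV// gt_eqF.
  have : 0 <= e * (p - e^-1 * q) ^+ 2 by rewrite mulr_ge0 ?sqr_ge0// ltW.
  have -> : e * (p - e^-1 * q) ^+ 2 = e * p * p - (e * e^-1) * (2 * p * q)
    + (e * e^-1) * (e^-1 * q * q) by ring.
  rewrite ei !mul1r.
  have : 0 <= e * p * p by rewrite -mulrA mulr_ge0 ?(ltW e0)// -expr2 sqr_ge0.
  have : 0 <= e^-1 * q * q by rewrite -mulrA mulr_ge0 ?(ltW i0)// -expr2 sqr_ge0.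
  by lra.
rewrite ler_norml le1// andbT.
have := le1 _ (sqintZ (-1) sv).
rewrite [inner _ u _]innerC !innerZl// ?[inner _ v u]innerC; try exact: sqintZ.
rewrite [inner _ v (fun x => -1 * v x)]innerC innerZl//.
by lra.
Qed.

Lemma cvg_inner_l2 (f_ : nat -> 'rV[R]_n -> R) f u :
  (forall k, sq_integrable Omega (f_ k)) -> sq_integrable Omega f ->
  sq_integrable Omega u ->
  inner Omega (f \- f_ k) (f \- f_ k) @[k --> \oo] --> (0 : R) ->
  inner Omega u (f_ k) @[k --> \oo] --> inner Omega u f.
Proof.
move=> sf_ sf su cf; apply/cvgrPdist_le => e e0.
(* The summand 1 makes [M] positive; [d] is chosen so that each of the two terms of [inner_le_sqr]
   is at most [e / 2]. *)
pose M := inner Omega u u + 1.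
have M0 : 0 < M by rewrite ltr_wpDl ?inner_ge0.
pose d := e / (2 * M).
have d0 : 0 < d by rewrite divr_gt0// mulr_gt0.
have de0 : 0 < e * d / 2 by rewrite divr_gt0// mulr_gt0.
near=> k.
rewrite ![inner _ u _]innerC -innerBl// innerC.
apply: le_trans (inner_le_sqr d0 su (sqintB sf (sf_ k))) _.
have h : inner Omega (f \- f_ k) (f \- f_ k) <= e * d / 2.
  near: k; move/cvgrPdist_le : cf => /(_ _ de0); apply: filterS => k.
  by rewrite sub0r normrN ger0_norm ?inner_ge0.
have h1 : d^-1 * inner Omega (f \- f_ k) (f \- f_ k) <= e / 2.
  by rewrite mulrC ler_pdivrMr//; apply: le_trans h _; rewrite mulrAC.
have h2 : d * inner Omega u u <= e / 2.
  apply: (@le_trans _ _ (d * M)); first by rewrite ler_pM2l// lerDl.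
  by rewrite /d le_eqVlt; apply/orP; left; apply/eqP; field; rewrite gt_eqF.
by lra.
Unshelve. all: by end_near. Qed.

Lemma cvg_inner_bounded (f_ : nat -> 'rV[R]_n -> R) f u (C : R) :
  (forall k, measurable_fun Omega (f_ k : _ -> measurableTypeR R)) ->
  (forall k x, Omega x -> `|f_ k x| <= C) ->
  (forall x, Omega x -> f_ ^~ x @ \oo --> f x) -> sq_integrable Omega u ->
  inner Omega u (f_ k) @[k --> \oo] --> inner Omega u f.
Proof.
move=> mf fC ff su; apply: (cvg_Rintegral mO (g := fun x => C * `|u x|)).
- by move=> k; apply: measurable_funM; [case: su|exact: mf].
- by move=> x Ox; apply: cvgM; [exact: cvg_cst|exact: ff].
- by move=> k x Ox; rewrite normrM mulrC ler_wpM2r// fC.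
- exact: (integrableZl mO C (integrable_abse (sqint_integrable su))).
Qed.

Lemma cvg_inner_bounded0 (f_ : nat -> 'rV[R]_n -> R) (C : R) :
  (forall k, measurable_fun Omega (f_ k : _ -> measurableTypeR R)) ->
  (forall k x, Omega x -> `|f_ k x| <= C) ->
  (forall x, Omega x -> f_ ^~ x @ \oo --> (0 : R)) ->
  inner Omega (f_ k) (f_ k) @[k --> \oo] --> (0 : R).
Proof.
move=> mf fC ff.
have -> : (0 : R) = \int[mu]_(x in Omega) 0 by rewrite Rintegral_cst// mul0r.
apply: (@cvg_Rintegral _ _ _ mu _ mO (fun k x => f_ k x * f_ k x) (cst 0) (cst (C * C))).
- by move=> k; apply: measurable_funM; exact: mf.
- by move=> x Ox; rewrite -(mulr0 (0 : R)); apply: cvgM; exact: ff.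
- by move=> k x Ox; rewrite normrM ler_pM// fC.
- exact: bounded_mfun_integrable (bounded_mfun_cst _).
Qed.

Lemma sqint_eq0_ae u : sq_integrable Omega u -> inner Omega u u = 0 ->
  {ae mu, forall x, Omega x -> u x = 0}.
Proof.
move=> su u0.
have mf : measurable_fun Omega (EFin \o (fun x => u x * u x)).
  by apply/measurable_EFinP; apply: measurable_funM; case: su.
have : (\int[mu]_(x in Omega) `|(EFin \o (fun x => u x * u x)%R) x| = 0)%E.
  transitivity (\int[mu]_(x in Omega) (u x * u x)%:E)%E.
    by apply: eq_integral => x _ /=; rewrite ger0_norm// -expr2 sqr_ge0.
  rewrite -[LHS]fineK; last exact: integrable_fin_num (sqint_mul su su).
  by congr EFin; exact: u0.
move/(ae_eq_integral_abs _ mO mf).1; apply: filterS => x /[apply] /= -[].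
by move/eqP; rewrite mulf_eq0 orbb => /eqP.
Qed.

End inner_product.

Section test_functions.
Context {R : realType} {n : nat}.
Variable Omega : set 'rV[R]_n.
Hypotheses (mO : measurable Omega) (finO : (lebesgue_rV R n Omega < +oo)%E).
Local Notation mu := (lebesgue_rV R n).
Implicit Types (u v f phi : 'rV[R]_n -> R).

Lemma Rintegral_support f : (forall x, ~ Omega x -> f x = 0) ->
  \int[mu]_(x in Omega) f x = \int[mu]_x f x.
Proof.
move=> f0; rewrite Rintegral_mkcond; apply: eq_Rintegral => x _.
by rewrite patchE; case: ifPn => //; rewrite notin_setE => /f0 ->.
Qed.

Lemma continuous_support_bounded_mfun f (K : set 'rV[R]_n) : continuous f ->
  compact K -> (forall x, ~ K x -> f x = 0) -> bounded_mfun Omega f.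
Proof.
move=> cf cK f0; split; first exact: continuous_measurable_rV.
have [C C0 KC] := compact_fun_bounded cK cf; exists C => x _.
by have [/KC//|/f0 ->] := pselect (K x); rewrite normr0 ltW.
Qed.

Lemma test_functionP phi : test_function Omega phi ->
  [/\ continuous phi, forall x i, derivable phi x (delta_mx 0 i),
      forall i, continuous (partial i phi)
    & exists2 K : set 'rV[R]_n, compact K /\ K `<=` Omega &
      forall x, ~ K x -> phi x = 0 /\ forall i, partial i phi x = 0].
Proof.
move=> [/(_ 1%N) [cphi dphi] [K [cK KO K0]]]; split=> //.
- by move=> x i; have [] := dphi i.
- by move=> i; have [_ []] := dphi i.
- exists K => // x Kx; split; first exact: K0.
  by move=> i; exact: (derive_outside (delta_mx 0 i) cK K0 Kx).
Qed.

Lemma test_function_bounded phi : test_function Omega phi -> bounded_mfun Omega phi.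
Proof.
move=> /test_functionP [cphi _ _ [K [cK _] K0]].
by apply: (continuous_support_bounded_mfun cphi cK) => x /K0[].
Qed.

Lemma partial_test_function_bounded phi i : test_function Omega phi ->
  bounded_mfun Omega (partial i phi).
Proof.
move=> /test_functionP [_ _ cphi [K [cK _] K0]].
by apply: (continuous_support_bounded_mfun (cphi i) cK) => x /K0[].
Qed.

(** The product [u * phi] inherits the compact support of [phi], so the integral of its derivative
    vanishes. *)
Lemma inner_partial u phi i : continuous u ->
  (forall x, derivable u x (delta_mx 0 i)) -> continuous (partial i u) ->
  test_function Omega phi ->
  inner Omega u (partial i phi) = - inner Omega (partial i u) phi.
Proof.
move=> cu du cdu /test_functionP [cphi dphi cdphi [K [cK KO] K0]].
have cM f g : continuous f -> continuous g -> continuous (fun x : 'rV[R]_n => f x * g x : R).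
  by move=> cf cg x; exact: (@continuousM _ _ f g x (cf x) (cg x)).
have bM f g : continuous f -> continuous g -> (forall x, ~ K x -> g x = 0) ->
    mu.-integrable Omega (EFin \o (fun x => f x * g x)).
  move=> cf cg g0; apply: (bounded_mfun_integrable mO finO).
  apply: (continuous_support_bounded_mfun (cM _ _ cf cg) cK) => x /g0 ->.
  by rewrite mulr0.
apply/eqP; rewrite -addr_eq0; apply/eqP.
rewrite /inner -RintegralD//; last 2 first.
- by apply: bM => // x /K0[].
- by apply: bM => // x /K0[].
rewrite Rintegral_support; last first.
  move=> x nOx; have /K0[-> ->] : ~ K x by move/KO.
  by rewrite !mulr0 addr0.
have dE x : is_derive x (delta_mx 0 i) (fun y => u y * phi y)
    (u x * partial i phi x + partial i u x * phi x).
  have := @is_deriveM _ _ u phi x (delta_mx 0 i) _ _ (derivableP (du x)) (derivableP (dphi x i)).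
  by congr is_derive; congr (_ + _); exact: mulrC.
under eq_Rintegral do rewrite -(@derive_val _ _ _ _ _ _ _ (dE _)).
apply: (Rintegral_derive0 cK).
- by move=> x /K0[-> _]; rewrite mulr0.
- exact: (cM u phi cu cphi).
- by move=> x; have [] := dE x.
- rewrite (_ : 'D__ _ = fun x => u x * partial i phi x + partial i u x * phi x).
    move=> x; exact: (@continuousD _ R^o _ (fun x => u x * partial i phi x)
      (fun x => partial i u x * phi x) x (cM u _ cu (cdphi i) x) (cM _ phi cdu cphi x)).
  by apply/funext => x; exact: derive_val.
Qed.

Lemma weak_gradient_Ck u : is_Ck 1 u -> weak_gradient Omega u (fun i => partial i u).
Proof.
move=> [cu du] i phi tphi; apply: inner_partial => //; first by have [] := du i.
by have [_ []] := du i.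
Qed.

Lemma cvg_inner_self (f_ : nat -> 'rV[R]_n -> R) f :
  (forall k, sq_integrable Omega (f_ k)) -> sq_integrable Omega f ->
  inner Omega (f \- f_ k) (f \- f_ k) @[k --> \oo] --> (0 : R) ->
  inner Omega (f_ k) (f_ k) @[k --> \oo] --> inner Omega f f.
Proof.
move=> sf_ sf cf.
have e k : inner Omega (f_ k) (f_ k) = inner Omega (f \- f_ k) (f \- f_ k) +
    (2 * inner Omega f (f_ k) - inner Omega f f).
  rewrite (innerBl mO)//; last exact: (sqintB mO).
  rewrite [inner _ f (_ \- _)]innerC [inner _ (f_ k) (_ \- _)]innerC !(innerBl mO)//.
  by rewrite [inner _ (f_ k) f]innerC; ring.
have -> : (fun k => inner Omega (f_ k) (f_ k)) = fun k =>
    inner Omega (f \- f_ k) (f \- f_ k) + (2 * inner Omega f (f_ k) - inner Omega f f).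
  by apply/funext => k; exact: e.
have {2}-> : inner Omega f f = 0 + (2 * inner Omega f f - inner Omega f f) by ring.
apply: cvgD => //; apply: cvgB; last exact: cvg_cst.
by apply: cvgM; [exact: cvg_cst|exact: (cvg_inner_l2 mO)].
Qed.

End test_functions.

(** * Rectangles and their Laplace eigenfunctions *)

Section rectangle.
Context {R : realType} {n : nat}.
Variables (a : 'rV[R]_n) (Q : 'M[R]_n) (l : 'I_n -> R).
Hypothesis QQ : Q *m Q^T = 1%:M.
Local Notation mu := (lebesgue_rV R n).
Local Notation B := (rectangle a Q l).
Local Notation y := (bcoord a Q).
Local Notation T := (tensor a Q).
Implicit Types (g : 'I_n -> R -> R) (x : 'rV[R]_n).

Lemma trmx_orthonormal : Q^T *m Q = 1%:M.
Proof. exact: mulmx1C. Qed.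

Lemma orthonormal_sum i k : \sum_j Q i j * Q k j = (i == k)%:R.
Proof.
have /matrixP/(_ i k) := QQ; rewrite !mxE => <-.
by apply: eq_bigr => j _; rewrite !mxE.
Qed.

Lemma rectangleP x : B x <-> forall i, 0 < y i x < l i.
Proof.
split=> [[z zl <-] i|xl].
  by rewrite /bcoord addrAC subrr add0r -mulmxA QQ mulmx1; exact: zl.
exists ((x - a) *m Q^T); first by move=> i; exact: xl.
by rewrite -mulmxA trmx_orthonormal mulmx1 addrC subrK.
Qed.

Lemma lebesgue_rV_bcoord (S : 'I_n -> set R) (r : 'I_n -> R) :
  (forall i, measurable (S i : set (measurableTypeR R))) ->
  (forall i, lebesgue_measure (S i) = (r i)%:E) ->
  mu [set x | forall i, S i (y i x)] = (\prod_i r i)%:E.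
Proof.
move=> mS Sr; rewrite -(lebesgue_rV_box mS Sr).
have mC : measurable [set x : 'rV[R]_n | forall i, S i (x 0 i)].
  rewrite (_ : [set x | _] = \bigcap_(i in [set: 'I_n])
      ((fun y : 'rV[R]_n => y 0 i : measurableTypeR R) @^-1` S i)).
    apply: fin_bigcap_measurable => // i _.
    by rewrite -[X in measurable X]setTI; exact: measurable_coord.
  by apply/seteqP; split => [z H i _|z H i]; exact: H.
have QT : Q^T *m Q^T^T = 1%:M by rewrite trmxK trmx_orthonormal.
rewrite -(lebesgue_rV_rotate QT mC) -[RHS](lebesgue_rV_translate (- a))//.
by rewrite -[X in measurable X]setTI; exact: measurable_mulmx.
Qed.

Lemma measurable_bcoord i : measurable_fun setT (y i : _ -> measurableTypeR R).
Proof. by apply: continuous_measurable_rV => //; exact: continuous_bcoord. Qed.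

Lemma measurable_rectangle : measurable B.
Proof.
rewrite (_ : B = \bigcap_(i in [set: 'I_n])
    ((y i : _ -> measurableTypeR R) @^-1` `]0, l i[)).
  apply: fin_bigcap_measurable => // i _.
  by rewrite -[X in measurable X]setTI; exact: measurable_bcoord.
apply/seteqP; split => [x /rectangleP H i _|x H]; first by rewrite /= in_itv/= H.
by apply/rectangleP => i; have := H i I; rewrite /= in_itv.
Qed.

Lemma open_rectangle : open B.
Proof.
rewrite openE => x /rectangleP H.
have : nbhs x (fun z => forall i, 0 < y i z < l i).
  apply: (@filter_forall _ _ (fun i => [set z | 0 < y i z < l i]) (nbhs x)) => i.
  have o : open (y i @^-1` `]0, l i[).
    by apply: open_comp; [move=> ? _; exact: continuous_bcoord|exact: interval_open].
  have : nbhs x (y i @^-1` `]0, l i[).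
    by apply: open_nbhs_nbhs; split => //; rewrite /= in_itv/= H.
  by apply: filterS => z; rewrite /= in_itv.
by apply: filterS => z zi; apply/rectangleP.
Qed.

Hypothesis l0 : forall i, 0 < l i.

Lemma lebesgue_rectangle : mu B = (\prod_i l i)%:E.
Proof.
have -> : B = [set x | forall i, `]0, l i[%classic (y i x)].
  apply/seteqP; split => [x /rectangleP H i|x H]; first by rewrite /= in_itv/= H.
  by apply/rectangleP => i; have := H i; rewrite /= in_itv.
apply: (lebesgue_rV_bcoord (S := fun i => `]0, l i[%classic)) => // i.
by rewrite lebesgue_measure_itv/= lte_fin l0 oppr0 adde0.
Qed.

Lemma lebesgue_rectangle_lty : (mu B < +oo)%E.
Proof. by rewrite lebesgue_rectangle ltry. Qed.

End rectangle.

Lemma cvg_harmonic_rate (R : realType) (u : nat -> R) (c x : R) :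
  (forall m, `|u m - x| <= c / m.+1%:R) -> u m @[m --> \oo] --> x.
Proof.
move=> ux; apply/cvgrPdist_le => e e0.
have : c / m.+1%:R @[m --> \oo] --> (0 : R).
  by rewrite -(mulr0 c); apply: cvgM; [exact: cvg_cst|exact: cvg_harmonic].
move=> /cvgr0_norm_le /(_ _ e0); apply: filterS => m me.
by rewrite distrC (le_trans (ux m))// (le_trans (ler_norm _)).
Qed.

(** * Smooth cutoffs on an interval *)

Section cutoff.
Context {R : realType}.
Variable L : R.
Implicit Types (s c : R) (h : R -> R).

(** It vanishes wherever [s * (L - s) <= 1 / (m + 1)], hence near both ends and outside the
    interval, and tends to 1 inside. Writing the distance to the ends as the polynomial
    [s * (L - s)] makes one formula serve both ends. *)
Definition cutoff (m : nat) s : R := flat_exp 0 (m.+1%:R * (s * (L - s)) - 1).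

Let arg (m : nat) s : R := m.+1%:R * (s * (L - s)) - 1.

Let dcutoff (m : nat) s : R := flat_exp 2 (arg m s) * (m.+1%:R * (L - 2 * s)).

Let argE m : arg m = fun s => cst (m.+1%:R * L) s * id s + (cst (- m.+1%:R) s * (id s * id s) + cst (-1) s).
Proof. by apply/funext => s; rewrite /arg /cst /=; ring. Qed.

Let smooth_arg m : smooth (arg m).
Proof.
rewrite argE; apply: smoothD; first by apply: smoothM; [exact: smooth_cst|exact: smooth_id].
apply: smoothD; last exact: smooth_cst.
apply: smoothM; first exact: smooth_cst.
by apply: smoothM; exact: smooth_id.
Qed.

Lemma smooth_cutoff m : smooth (cutoff m).
Proof. exact: (smooth_comp (smooth_flat_exp 0) (smooth_arg m)). Qed.

Let is_derive_cutoff m s : is_derive s 1 (cutoff m) (dcutoff m s).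
Proof.
have da : is_derive s 1 (arg m) (m.+1%:R * (L - 2 * s)).
  have e : is_derive s 1 (fun s => (s * (L - s)) : R) (s * (0 - 1) + (L - s) * 1).
    have := @is_deriveM _ _ id (fun s => L - s) s (1 : R) 1 (0 - 1) (is_derive_id _ _).
    apply; apply: is_deriveB.
  have e2 := @is_deriveB _ _ _ _ _ s 1 _ _ (@is_deriveZ _ _ _ _ m.+1%:R _ _ _ e) (is_derive_cst (1:R) s (1:R)).
  have := e2; congr is_derive; rewrite subr0 /GRing.scale/=; ring.
have := is_derive1_comp (flat_exp_derive 0 (arg m s)) da.
by congr is_derive; rewrite mul0r subr0.
Qed.

Lemma cutoff_ge0 m s : 0 <= cutoff m s.
Proof. exact: flat_exp_ge0. Qed.

Lemma cutoff_le1 m s : cutoff m s <= 1.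
Proof. exact: flat_exp0_le1. Qed.

Lemma cutoff_neq0 m s : cutoff m s != 0 -> 1 < m.+1%:R * (s * (L - s)).
Proof. by rewrite /cutoff /flat_exp subr_gt0; case: ifPn; rewrite ?eqxx. Qed.

Lemma cvg_cutoff s : 0 < s < L -> cutoff m s @[m --> \oo] --> (1 : R).
Proof.
move=> /andP[s0 sL]; set p := s * (L - s); have p0 : 0 < p by rewrite mulr_gt0 ?subr_gt0.
(* With [t = (m + 1) * p] the gap to 1 is at most [1 / (t - 1) <= 2 / t] once [t > 2]; for smaller t
   the bound [2 / t] is at least 1 and the gap is at most 1. *)
apply: (@cvg_harmonic_rate _ _ (2 / p)) => m.
have m0 : 0 < m.+1%:R :> R by rewrite ltr0n.
rewrite distrC ger0_norm ?subr_ge0 ?cutoff_le1//.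
rewrite -mulrA -invfM mulrC; set t := m.+1%:R * p.
have t0 : 0 < t by rewrite mulr_gt0.
rewrite [p * _]mulrC -/t [t^-1 * 2]mulrC.
have [t2|t2] := leP t 2.
  apply: (@le_trans _ _ 1); first by rewrite lerBlDr lerDl cutoff_ge0.
  by rewrite ler_pdivlMr// mul1r.
have t1 : 0 < t - 1 by move: t2; lra.
have := @flat_exp0_ge R _ t1; rewrite -/(cutoff m s) => h.
apply: (@le_trans _ _ (t - 1)^-1); first by move: h; rewrite /cutoff -/p -/t; lra.
by rewrite ler_pdivlMr// mulrC ler_pdivrMr//; move: t2; lra.
Qed.

Lemma derive1_cutoffM m h s : smooth h ->
  derive1 (fun t => cutoff m t * h t) s =
  cutoff m s * derive1 h s + h s * dcutoff m s.
Proof.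
move=> sh; rewrite derive1E.
have := @is_deriveM _ _ (cutoff m) h s 1 _ _ (is_derive_cutoff m s) (smooth_is_derive s sh).
by move=> [_ ->].
Qed.

(** The decay of [h] at the ends pays for the factor [m + 1] in the derivative of the cutoff:
    together they form [t = (m + 1) * s * (L - s)], multiplied by a rapidly decreasing function of
    t. *)
Let cutoff_slope c h m s : 0 < s < L -> 0 <= c -> `|h s| <= c * (s * (L - s)) ->
  `|h s * dcutoff m s| <= c * L * (m.+1%:R * (s * (L - s)) * flat_exp 2 (arg m s)).
Proof.
move=> /andP[s0 sL] c0 hc; have p0 : 0 < s * (L - s) by rewrite mulr_gt0 ?subr_gt0.
rewrite /dcutoff; set F := flat_exp _ _; have F0 : 0 <= F by exact: flat_exp_ge0.
rewrite !normrM (ger0_norm F0) (ger0_norm (ler0n _ _)).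
apply: (@le_trans _ _ (c * (s * (L - s)) * (F * (m.+1%:R * L)))).
  rewrite ler_pM ?mulr_ge0// ler_wpM2l// ler_wpM2l//.
  by rewrite ler_norml; apply/andP; split; lra.
by rewrite le_eqVlt; apply/orP; left; apply/eqP; ring.
Qed.

(** The uniform bound serves to dominate the derivatives of cut functions, the bound [4 / t] shows
    that the contribution of the differentiated cutoff disappears in the limit. *)
Let flat2_le (t : R) : 0 < t -> t * flat_exp 2 (t - 1) <= 4 /\ t * flat_exp 2 (t - 1) <= 4 / t.
Proof.
move=> t0; have h := flat_exp2_le t; have F0 := flat_exp_ge0 2 (t - 1).
split; last by rewrite ler_pdivlMr// mulrAC -expr2.
have [t1|t1] := leP t 1; first by rewrite /flat_exp subr_gt0 ltNge t1/= mulr0.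
by apply: le_trans h; rewrite expr2 ler_wpM2r// ler_peMl// ltW.
Qed.

Lemma derive1_cutoffM_le c h d m s : 0 < s < L -> 0 <= c -> smooth h ->
  `|h s| <= c * (s * (L - s)) -> `|derive1 h s| <= d ->
  `|derive1 (fun t => cutoff m t * h t) s| <= d + c * L * 4.
Proof.
move=> sL c0 sh hc hd; rewrite derive1_cutoffM//.
have /andP[s0 s1] := sL; have p0 : 0 < s * (L - s) by rewrite mulr_gt0 ?subr_gt0.
apply: le_trans (ler_normD _ _) _; apply: lerD.
  by rewrite normrM ger0_norm ?cutoff_ge0// -[leRHS]mul1r ler_pM// ?cutoff_ge0// cutoff_le1.
apply: le_trans (cutoff_slope m sL c0 hc) _.
rewrite ler_wpM2l ?mulr_ge0// ?(ltW (lt_trans s0 s1))//.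
by have [|] := @flat2_le (m.+1%:R * (s * (L - s))); first by rewrite mulr_gt0// ltr0n.
Qed.

Lemma cvg_derive1_cutoffM c h s : 0 < s < L -> 0 <= c -> smooth h ->
  `|h s| <= c * (s * (L - s)) ->
  derive1 (fun t => cutoff m t * h t) s @[m --> \oo] --> derive1 h s.
Proof.
move=> sL c0 sh hc.
have /andP[s0 s1] := sL; have p0 : 0 < s * (L - s) by rewrite mulr_gt0 ?subr_gt0.
have -> : (fun m => derive1 (fun t => cutoff m t * h t) s) =
    (fun m => cutoff m s * derive1 h s + h s * dcutoff m s).
  by apply/funext => m; rewrite derive1_cutoffM.
rewrite -[X in _ --> X]addr0 -[X in _ --> X + _]mul1r; apply: cvgD.
  by apply: cvgM; [exact: cvg_cutoff|exact: cvg_cst].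
apply: (@cvg_harmonic_rate _ _ (c * L * 4 / (s * (L - s)))) => m; rewrite subr0.
apply: le_trans (cutoff_slope m sL c0 hc) _.
have m0 : 0 < m.+1%:R :> R by rewrite ltr0n.
have [|_ h2] := @flat2_le (m.+1%:R * (s * (L - s))); first by rewrite mulr_gt0.
have cL : 0 <= c * L by rewrite mulr_ge0// ltW// (lt_trans s0).
apply: le_trans (ler_wpM2l cL h2) _.
rewrite le_eqVlt; apply/orP; left; apply/eqP.
by rewrite [m.+1%:R * _]mulrC invfM !mulrA.
Qed.

End cutoff.

(** * Tensor products on a rectangle and their compactly supported approximations *)

Section tensor_rectangle.
Context {R : realType} {n : nat}.
Variables (a : 'rV[R]_n) (Q : 'M[R]_n) (l : 'I_n -> R).
Hypothesis QQ : Q *m Q^T = 1%:M.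
Hypothesis l0 : forall i, 0 < l i.
Local Notation mu := (lebesgue_rV R n).
Local Notation B := (rectangle a Q l).
Local Notation y := (bcoord a Q).
Local Notation T := (tensor a Q).
Implicit Types (g : 'I_n -> R -> R) (x : 'rV[R]_n).

Let mB : measurable B := measurable_rectangle a l QQ.
Let finB : (mu B < +oo)%E := lebesgue_rectangle_lty a QQ l0.

(** The derivative of [T g] along the i-th edge, that is, along row i of [Q]. *)
Definition dtensor g i : 'rV[R]_n -> R := T (upd g i (derive1 (g i))).

Lemma smooth_continuous (h : R -> R) : smooth h -> continuous h.
Proof. by move=> /(_ 0%N); exact: smooth_upto_continuous. Qed.

Lemma partial_tensor g j : (forall i, smooth (g i)) ->
  partial j (T g) = fun x => \sum_k Q k j * dtensor g k x.
Proof.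
move=> sg; apply: partialE => x.
have := @is_derive_tensor _ _ a Q g (fun i => derive1 (g i)) x (delta_mx 0 j)
  (fun i s => smooth_is_derive s (sg i)).
by congr is_derive; apply: eq_bigr => k _; rewrite delta_mx_bcoord.
Qed.

Lemma upd_smooth g i h : (forall k, smooth (g k)) -> smooth h ->
  forall k, smooth (upd g i h k).
Proof. by move=> sg sh k; rewrite /upd; case: eqP. Qed.

Lemma sum_partial_tensor g i x : (forall k, smooth (g k)) ->
  \sum_j Q i j * partial j (T g) x = dtensor g i x.
Proof.
move=> sg; under eq_bigr do rewrite partial_tensor// big_distrr/=.
rewrite exchange_big/= (bigD1 i)//= [X in _ + X]big1 ?addr0.
  under eq_bigr do rewrite mulrA.
  by rewrite -big_distrl/= (orthonormal_sum QQ) eqxx mul1r.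
move=> k ki; under eq_bigr do rewrite mulrA.
by rewrite -big_distrl/= (orthonormal_sum QQ) eq_sym (negPf ki) mul0r.
Qed.

Lemma tensor_le g (C : 'I_n -> R) x : B x ->
  (forall i s, 0 < s < l i -> `|g i s| <= C i) -> `|T g x| <= \prod_i C i.
Proof.
move=> /(rectangleP a l QQ) xB gC; rewrite /tensor normr_prod.
by apply: ler_prod => i _; rewrite normr_ge0 gC.
Qed.

Lemma cvg_tensor (G : nat -> 'I_n -> R -> R) g x : B x ->
  (forall i s, 0 < s < l i -> G m i s @[m --> \oo] --> g i s) ->
  T (G m) x @[m --> \oo] --> T g x.
Proof.
move=> /(rectangleP a l QQ) xB Gg; rewrite /tensor.
elim: (index_enum _) => [|i r ih].
  by rewrite big_nil; under eq_cvg do rewrite big_nil; exact: cvg_cst.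
rewrite big_cons; under eq_cvg do rewrite big_cons.
by apply: cvgM => //; exact: Gg.
Qed.

Lemma continuous_bounded_itv (h : R -> R) (L : R) : continuous h ->
  exists2 C, 0 < C & forall s, 0 < s < L -> `|h s| <= C.
Proof.
move=> ch; have /compact_bounded [M [_ MK]] : compact (h @` `[0, L]).
  apply: continuous_compact; last exact: segment_compact.
  exact: continuous_subspaceT.
exists (`|M| + 1); first by rewrite ltr_wpDl.
move=> s /andP[s0 sL]; apply: MK; first by rewrite ltr_pwDr// ler_norm.
by exists s => //; rewrite /= in_itv/= !ltW.
Qed.

Lemma tensor_bounded_mfun g : (forall i, continuous (g i)) -> bounded_mfun B (T g).
Proof.
move=> cg; split.
  by apply: continuous_measurable_rV => //; exact: tensor_continuous.
have /choice[C CP] : forall i, exists C, forall s, 0 < s < l i -> `|g i s| <= C.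
  by move=> i; have [C _ ?] := @continuous_bounded_itv _ (l i) (cg i); exists C.
by exists (\prod_i C i) => x Bx; apply: tensor_le.
Qed.

Lemma tensor_sqint g : (forall i, continuous (g i)) -> sq_integrable B (T g).
Proof. by move=> cg; exact: (bounded_mfun_sqint mB finB (tensor_bounded_mfun cg)). Qed.

Lemma dtensor_sqint g i : (forall k, smooth (g k)) -> sq_integrable B (dtensor g i).
Proof.
move=> sg; apply: tensor_sqint => k; apply: smooth_continuous.
by apply: upd_smooth => //; exact: smooth_derive1.
Qed.

Lemma partial_tensor_sqint g j : (forall k, smooth (g k)) ->
  sq_integrable B (partial j (T g)).
Proof.
move=> sg; rewrite partial_tensor//.
by apply: (sqint_lincomb mB finB) => i; exact: dtensor_sqint.
Qed.

Lemma tensor_H1 g : (forall k, smooth (g k)) -> H1 B (T g) (fun j => partial j (T g)).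
Proof.
move=> sg; split; first by apply: tensor_sqint => i; exact: smooth_continuous.
- by move=> j; exact: partial_tensor_sqint.
- by apply: (weak_gradient_Ck mB finB); apply: is_Ck_tensor => i; exact: sg.
Qed.

(** Passing to the orthonormal frame of the edges turns the gradient pairing into one term per edge,
    each with a single differentiated factor. *)
Lemma grad_inner_tensor g (h : 'I_n -> 'rV[R]_n -> R) : (forall k, smooth (g k)) ->
  (forall j, sq_integrable B (h j)) ->
  grad_inner B (fun j => partial j (T g)) h =
  \sum_i inner B (dtensor g i) (fun x => \sum_j Q i j * h j x).
Proof.
move=> sg sh; rewrite /grad_inner.
transitivity (\sum_j \sum_i Q i j * inner B (dtensor g i) (h j)).
  apply: eq_bigr => j _; rewrite partial_tensor// (inner_lincombl mB)// => i.
  exact: dtensor_sqint.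
rewrite exchange_big/=; apply: eq_bigr => i _.
by rewrite (inner_lincombr mB)//; exact: dtensor_sqint.
Qed.

Definition cut m g i (s : R) : R := cutoff (l i) m s * g i s.

Lemma smooth_cut m g i : smooth (g i) -> smooth (cut m g i).
Proof. by move=> sg; apply: smoothM => //; exact: smooth_cutoff. Qed.

Lemma test_function_cut m g : (forall k, smooth (g k)) -> test_function B (T (cut m g)).
Proof.
move=> sg; split; first by move=> k; apply: is_Ck_tensor => i; exact: smooth_cut.
(* Off [K] some factor [cutoff] is 0; on [K] every [y i x * (l i - y i x)] stays positive, which
   keeps [K] inside the open box. *)
pose K := \bigcap_(i in [set: 'I_n]) [set x | 1 <= m.+1%:R * (y i x * (l i - y i x))].
have cq i : continuous (fun x => m.+1%:R * (y i x * (l i - y i x)) : R).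
  have ca : continuous (fun s : R => m.+1%:R * (s * (l i - s))).
    move=> s; apply: cvgM; first exact: cvg_cst.
    by apply: cvgM; [exact: cvg_id|apply: cvgB; [exact: cvg_cst|exact: cvg_id]].
  move=> x; apply: (@continuous_comp _ _ _ (y i) (fun s : R => m.+1%:R * (s * (l i - s)))).
    exact: continuous_bcoord.
  exact: ca.
have KB : K `<=` B.
  move=> x Kx; apply/(rectangleP a l QQ) => i; have := Kx i I => /= h.
  have m0 : 0 < m.+1%:R :> R by rewrite ltr0n.
  have : 0 < y i x * (l i - y i x) by rewrite -(pmulr_rgt0 _ m0) (lt_le_trans ltr01).
  move: (y i x) => s sl; have li := l0 i.
  have s0 : 0 < s.
    rewrite ltNge; apply/negP => s0; move: sl; apply/negP; rewrite -leNgt.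
    by rewrite mulr_le0_ge0// subr_ge0 (le_trans s0)// ltW.
  by rewrite s0/= -subr_gt0 -(pmulr_rgt0 _ s0).
exists K; split => //; last first.
  move=> x nKx; rewrite /tensor; have [i iK] : exists i, ~ 1 <= m.+1%:R * (y i x * (l i - y i x)).
    by apply: contrapT => h; apply: nKx => i _ /=; apply: contrapT => h'; apply: h; exists i.
  apply/eqP; rewrite prodf_seq_eq0; apply/hasP; exists i; rewrite ?mem_index_enum//=.
  rewrite /cut mulf_eq0; apply/orP; left; apply/negPn/negP => /cutoff_neq0 /ltW.
  exact: iK.
apply: bounded_closed_compact; last first.
  apply: closed_bigI => i _; rewrite (_ : [set x | _] =
    (fun x => m.+1%:R * (y i x * (l i - y i x)) : R) @^-1` [set s | 1 <= s])//.
  by apply: closed_comp; [move=> x _; exact: cq|exact: closed_ge].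
(* Writing [x = a + y *m Q] with [0 < y i < l i] bounds each coordinate of [x]; the sum over j
   bounds all of them at once. *)
pose M := \sum_j `|a 0 j| + \sum_j \sum_i l i * `|Q i j|.
exists M; split; first by rewrite num_real.
move=> M' MM' x /KB /(rectangleP a l QQ) xB; apply: le_trans (ltW MM').
have xE j : x 0 j = a 0 j + \sum_i y i x * Q i j.
  have -> : \sum_i y i x * Q i j = ((x - a) *m Q^T *m Q) 0 j.
    by rewrite mxE.
  by rewrite -mulmxA (trmx_orthonormal QQ) mulmx1 !mxE; ring.
have M0 : 0 <= M.
  by rewrite addr_ge0// !sumr_ge0// => j _; rewrite sumr_ge0// => i _; rewrite mulr_ge0// ltW.
rewrite [leLHS]mx_normrE; apply: bigmax_le => // -[k j] _ /=; rewrite [k]ord1 xE.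
apply: le_trans (ler_normD _ _) _; apply: lerD.
  by rewrite (bigD1 j)//= lerDl sumr_ge0.
rewrite [leRHS](bigD1 j)//= -[leLHS]addr0; apply: lerD; last first.
  by rewrite sumr_ge0// => j' _; rewrite sumr_ge0// => i _; rewrite mulr_ge0// ltW.
apply: le_trans (ler_norm_sum _ _ _) _; apply: ler_sum => i _.
rewrite normrM ler_wpM2r//; have /andP[y0 yl] := xB i.
by rewrite ger0_norm ltW.
Qed.

Lemma cvg_cut g i (s : R) : 0 < s < l i -> cut m g i s @[m --> \oo] --> g i s.
Proof.
move=> sl; rewrite -[X in _ --> X]mul1r; apply: cvgM; last exact: cvg_cst.
exact: cvg_cutoff.
Qed.

Lemma cut_le m g i (s : R) : `|cut m g i s| <= `|g i s|.
Proof.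
by rewrite normrM ger0_norm ?cutoff_ge0// -[leRHS]mul1r ler_wpM2r// cutoff_le1.
Qed.

Lemma tensor_cut_le g x m : `|T (cut m g) x| <= `|T g x|.
Proof.
by rewrite /tensor !normr_prod; apply: ler_prod => i _; rewrite normr_ge0 cut_le.
Qed.

Lemma cvg_tensor_cut g x : B x -> T (cut m g) x @[m --> \oo] --> T g x.
Proof. by move=> Bx; apply: cvg_tensor => // i s sl; exact: cvg_cut. Qed.

(** Linear decay at both ends of the i-th interval, the rate that compensates the steepness of the
    cutoffs. *)
Definition vanishing i (h : R -> R) := exists2 c : R, 0 <= c &
  forall s, 0 < s < l i -> `|h s| <= c * (s * (l i - s)).

Lemma cvg_dtensor_cut g i x : (forall k, smooth (g k)) -> vanishing i (g i) ->
  B x -> dtensor (cut m g) i x @[m --> \oo] --> dtensor g i x.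
Proof.
move=> sg [c c0 gc] Bx; apply: cvg_tensor => // k s sl; rewrite /upd.
have [ki|ki] := eqVneq k i; last exact: cvg_cut.
rewrite ki in sl; exact: (cvg_derive1_cutoffM sl c0 (sg i) (gc _ sl)).
Qed.

Lemma dtensor_cut_bounded g i : (forall k, smooth (g k)) -> vanishing i (g i) ->
  exists C, forall m x, B x -> `|dtensor (cut m g) i x| <= C.
Proof.
move=> sg [c c0 gc].
have [d d0 dP] := @continuous_bounded_itv _ (l i) (smooth_continuous (smooth_derive1 (sg i))).
have /choice[C CP] : forall k, exists C, forall s, 0 < s < l k -> `|g k s| <= C.
  move=> k; have [C _ ?] := @continuous_bounded_itv _ (l k) (smooth_continuous (sg k)).
  by exists C.
exists (\prod_k (upd C i (d + c * l i * 4) k)) => m x Bx; apply: tensor_le => // k s sl.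
rewrite /upd; have [ki|ki] := eqVneq k i; last exact: le_trans (cut_le _ _ _ _) (CP _ _ sl).
rewrite ki in sl; apply: derive1_cutoffM_le => //; [exact: gc|exact: dP].
Qed.

End tensor_rectangle.

Section trigonometric_functions.
Context {R : realType}.
Implicit Types (c s x : R).

Lemma is_derive_cosM c s : is_derive s 1 (fun t => cos (c * t)) (- c * sin (c * s)).
Proof.
have := is_derive1_comp (is_derive_cos (c * s)) (@is_deriveZ _ _ _ id c s 1 1 (is_derive_id _ _)).
by congr is_derive; rewrite /GRing.scale/=; ring.
Qed.

Lemma is_derive_sinM c s : is_derive s 1 (fun t => sin (c * t)) (c * cos (c * s)).
Proof.
have := is_derive1_comp (is_derive_sin (c * s)) (@is_deriveZ _ _ _ id c s 1 1 (is_derive_id _ _)).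
by congr is_derive; rewrite /GRing.scale/=; ring.
Qed.

Lemma derive1_cosM c : derive1 (fun s => cos (c * s)) = (fun s => - c * sin (c * s)).
Proof. by apply: is_derive_derive1 => s; exact: is_derive_cosM. Qed.

Lemma derive1_sinM c : derive1 (fun s => sin (c * s)) = (fun s => c * cos (c * s)).
Proof. by apply: is_derive_derive1 => s; exact: is_derive_sinM. Qed.

Lemma derive1Z c (f : R -> R) : smooth f ->
  derive1 (fun s => c * f s) = (fun s => c * derive1 f s).
Proof.
move=> sf; apply: is_derive_derive1 => s.
exact: (@is_deriveZ _ _ _ f c s 1 _ (smooth_is_derive s sf)).
Qed.

Let smoothZ c : smooth (fun s => c * s).
Proof. exact: (smoothM (smooth_cst c) (@smooth_id R)). Qed.

Lemma smooth_cosM c : smooth (fun s => cos (c * s)).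
Proof. exact: (smooth_comp (@smooth_cos R) (smoothZ c)). Qed.

Lemma smooth_sinM c : smooth (fun s => sin (c * s)).
Proof. exact: (smooth_comp (@smooth_sin R) (smoothZ c)). Qed.

Lemma abs_sin_le x : 0 <= x -> `|sin x| <= x.
Proof.
rewrite le_eqVlt => /predU1P[<-|x0]; first by rewrite sin0 normr0.
have [|c _] := @MVT R sin cos 0 x x0 (fun t _ => is_derive_sin t).
- exact/continuous_subspaceT/continuous_sin.
- rewrite sin0 !subr0 => ->; rewrite normrM (gtr0_norm x0).
  by rewrite ler_piMl ?cos_max// ltW.
Qed.

Lemma sin_natpi (k : nat) : sin (k%:R * pi) = 0 :> R.
Proof.
elim: k => [|k ih]; first by rewrite mul0r sin0.
by rewrite -addn1 natrD mulrDl mul1r sinDpi ih oppr0.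
Qed.

(** The sine vanishes at 0 and at L, so it is bounded by [c * s] and by [c * (L - s)]; the smaller
    of [s] and [L - s] is at most [(2 / L) * (s * (L - s))], since the other one is at least
    [L / 2]. *)
Lemma abs_sin_itv_le (k : nat) (L s : R) : 0 < s < L ->
  `|sin (k%:R * pi / L * s)| <= k%:R * pi / L * (2 / L) * (s * (L - s)).
Proof.
move=> /andP[s0 sL]; have L0 : 0 < L := lt_trans s0 sL.
set c := k%:R * pi / L; have c0 : 0 <= c by rewrite divr_ge0 ?mulr_ge0 ?pi_ge0// ltW.
have h1 : `|sin (c * s)| <= c * s by apply: abs_sin_le; rewrite mulr_ge0// ltW.
have h2 : `|sin (c * s)| <= c * (L - s).
  have -> : `|sin (c * s)| = `|sin (c * (L - s))|.
    have -> : c * (L - s) = k%:R * pi - c * s.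
      by rewrite mulrBr /c divfK// gt_eqF.
    rewrite sinB sin_natpi mul0r sub0r normrN normrM.
    have /eqP -> : `|cos (k%:R * pi)| == 1 :> R by rewrite norm_cos_eq1 sin_natpi.
    by rewrite mul1r.
  by apply: abs_sin_le; rewrite mulr_ge0// subr_ge0 ltW.
have [sh|sh] := leP s (L / 2).
  apply: le_trans h1 _; rewrite -[leRHS]mulrA ler_wpM2l// mulrAC ler_pdivlMr//.
  rewrite -subr_ge0 (_ : _ - _ = s * (L - 2 * s)); last by ring.
  by rewrite mulr_ge0 ?(ltW s0)//; move: sh; lra.
apply: le_trans h2 _; rewrite -[leRHS]mulrA ler_wpM2l// mulrAC ler_pdivlMr//.
rewrite -subr_ge0 (_ : _ - _ = (L - s) * (2 * s - L)); last by ring.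
by rewrite mulr_ge0 ?subr_ge0 ?(ltW sL)//; move: sh; lra.
Qed.

End trigonometric_functions.

(** * Testing weak gradients with cosine and sine products *)

Section weak_rectangle.
Context {R : realType} {n : nat}.
Variables (a : 'rV[R]_n) (Q : 'M[R]_n) (l : 'I_n -> R).
Hypothesis QQ : Q *m Q^T = 1%:M.
Hypothesis l0 : forall i, 0 < l i.
Local Notation mu := (lebesgue_rV R n).
Local Notation B := (rectangle a Q l).
Local Notation T := (tensor a Q).
Implicit Types (g : 'I_n -> R -> R) (v : 'rV[R]_n -> R) (h : 'I_n -> 'rV[R]_n -> R).

Let mB : measurable B := measurable_rectangle a l QQ.
Let finB : (mu B < +oo)%E := lebesgue_rectangle_lty a QQ l0.

Definition rot_grad h i : 'rV[R]_n -> R := fun x => \sum_j Q i j * h j x.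

Lemma rot_grad_sqint h i : (forall j, sq_integrable B (h j)) -> sq_integrable B (rot_grad h i).
Proof. by move=> sh; exact: (sqint_lincomb mB finB). Qed.

Lemma weak_tensor v h g i : H1 B v h -> (forall k, smooth (g k)) ->
  test_function B (T g) ->
  inner B v (dtensor a Q g i) = - inner B (rot_grad h i) (T g).
Proof.
move=> [sv sh wv] sg tg.
have sTg : sq_integrable B (T g).
  by apply: (tensor_sqint _ QQ l0) => k; exact: smooth_continuous.
rewrite (inner_lincombl mB)// -sumrN.
transitivity (\sum_j Q i j * inner B v (partial j (T g))).
  rewrite -(inner_lincombr mB)//; last by move=> j; exact: partial_tensor_sqint.
  by apply: eq_inner => // x _; rewrite sum_partial_tensor.
by apply: eq_bigr => j _; rewrite wv// mulrN.
Qed.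

(** [T g] itself need not be a test function, but its cut versions are. Along edge i only the i-th
    cutoff is differentiated, so decay of [g i] alone keeps these derivatives bounded; the other
    cutoffs merely converge to 1. Dominated convergence then passes to the limit on both sides. *)
Lemma weak_tensor_vanishing v h g i : H1 B v h -> (forall k, smooth (g k)) ->
  vanishing l i (g i) ->
  inner B v (dtensor a Q g i) = - inner B (rot_grad h i) (T g).
Proof.
move=> H1v sg vg; have [sv sh _] := H1v.
have [C CP] := dtensor_cut_bounded a QQ sg vg.
have scut m k : smooth (cut l m g k) by exact: smooth_cut.
have L1 : inner B v (dtensor a Q (cut l m g) i) @[m --> \oo] --> inner B v (dtensor a Q g i).
  apply: (cvg_inner_bounded mB finB (C := C)) => //.
  - by move=> m; have [] := dtensor_sqint a QQ l0 i (scut m).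
  - by move=> x Bx; exact: cvg_dtensor_cut.
have cg k : continuous (g k) by exact: smooth_continuous.
have [_ [D DP]] := tensor_bounded_mfun a l QQ cg.
have L2 : inner B (rot_grad h i) (T (cut l m g)) @[m --> \oo] --> inner B (rot_grad h i) (T g).
  apply: (cvg_inner_bounded mB finB (C := D)) => //.
  - move=> m; have [] := tensor_sqint a QQ l0 (fun k => smooth_continuous (scut m k)).
    by [].
  - by move=> m x Bx; apply: le_trans (DP _ Bx); exact: tensor_cut_le.
  - by move=> x Bx; exact: cvg_tensor_cut.
  - exact: rot_grad_sqint.
have e m : inner B v (dtensor a Q (cut l m g) i) = - inner B (rot_grad h i) (T (cut l m g)).
  by apply: weak_tensor => //; exact: test_function_cut.
move: L1; under eq_cvg do rewrite e.
by move/cvg_unique => /(_ _); apply; [exact: norm_hausdorff|exact: cvgN].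
Qed.

Definition freq (k : nat) i : R := k%:R * pi / l i.

Definition cos_mode (k : 'I_n -> nat) i (s : R) : R := cos (freq (k i) i * s).

Definition cos_fun k := T (cos_mode k).

Lemma smooth_cos_mode k i : smooth (cos_mode k i).
Proof. exact: smooth_cosM. Qed.

Lemma dtensor_eigen g i (c : R) : derive1 (derive1 (g i)) = (fun s => c * g i s) ->
  dtensor a Q (upd g i (derive1 (g i))) i = (fun x => c * T g x).
Proof.
move=> e; apply/funext => x; rewrite /dtensor /tensor.
rewrite (bigD1 i)//= [in RHS](bigD1 i)//= /upd eqxx e mulrA; congr (_ * _).
by apply: eq_bigr => j /negPf ->.
Qed.

(** The function tested is the derivative of the cosine mode along edge i. Its i-th factor is a
    multiple of a sine vanishing at both ends, and a second differentiation along the same edge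
    returns the cosine times minus the squared frequency. *)
Lemma neumann_identity k v h i : H1 B v h ->
  inner B (dtensor a Q (cos_mode k) i) (rot_grad h i) =
  freq (k i) i ^+ 2 * inner B (cos_fun k) v.
Proof.
move=> H1v; set c := freq (k i) i; have [sv sh _] := H1v.
pose g := upd (cos_mode k) i (derive1 (cos_mode k i)).
have sg j : smooth (g j).
  apply: upd_smooth => [j'|]; first exact: smooth_cos_mode.
  by apply: smooth_derive1; exact: smooth_cos_mode.
have gi : g i = (fun s => - c * sin (c * s)).
  by rewrite /g /upd eqxx /cos_mode derive1_cosM.
have vg : vanishing l i (g i).
  have c0 : 0 <= c by rewrite /c /freq divr_ge0 ?mulr_ge0 ?pi_ge0// ltW.
  exists (c * (c * (2 / l i))); first by rewrite mulr_ge0// mulr_ge0// divr_ge0// ltW.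
  move=> s sl; rewrite gi normrM normrN (ger0_norm c0) -[leRHS]mulrA ler_wpM2l//.
  exact: abs_sin_itv_le.
have := weak_tensor_vanishing H1v sg vg.
rewrite (dtensor_eigen (c := - c ^+ 2)).
  rewrite [LHS]innerC (innerZl mB)//; last first.
    by apply: (tensor_sqint _ QQ l0) => j; apply: smooth_continuous; exact: smooth_cos_mode.
  by rewrite mulNr => /oppr_inj ->; rewrite innerC.
rewrite /cos_mode derive1_cosM derive1Z ?derive1_sinM; last exact: smooth_sinM.
by apply/funext => s; rewrite -/c; ring.
Qed.

Definition sin_mode i (s : R) : R := sin (freq 1 i * s).

Definition sin_fun := T sin_mode.

Lemma smooth_sin_mode i : smooth (sin_mode i).
Proof. exact: smooth_sinM. Qed.

Lemma vanishing_sin_mode i : vanishing l i (sin_mode i).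
Proof.
exists (freq 1 i * (2 / l i)); first by rewrite /freq mulr_ge0// divr_ge0 ?(ltW (l0 i))// mulr_ge0// pi_ge0.
by move=> s sl; exact: abs_sin_itv_le.
Qed.

(** Every factor of the sine product decays linearly at its ends, so the cut products converge
    together with their derivatives along all edges, boundedly and pointwise, hence in mean
    square. *)
Lemma sin_fun_H10 : H10 B sin_fun (fun j => partial j sin_fun).
Proof.
have ss k := smooth_sin_mode k.
have cs k : continuous (sin_mode k) by exact: smooth_continuous.
have scut m k : smooth (cut l m sin_mode k) by exact: smooth_cut.
have [_ [D DP]] := tensor_bounded_mfun a l QQ cs.
split; first exact: tensor_H1.
exists (fun m => T (cut l m sin_mode)); split.
- by move=> m; exact: test_function_cut.
- apply: (cvg_inner_bounded0 mB finB (C := D + D)).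
  + move=> m; have [+ _] := sqintB mB (tensor_sqint a QQ l0 cs)
     (tensor_sqint a QQ l0 (fun k => smooth_continuous (scut m k))).
    by [].
  + move=> m x Bx; apply: le_trans (ler_normB _ _) _; apply: lerD; first exact: DP.
    by apply: le_trans (DP _ Bx); exact: tensor_cut_le.
  + move=> x Bx; rewrite -(subrr (sin_fun x)); apply: cvgB; first exact: cvg_cst.
    exact: cvg_tensor_cut.
- move=> j.
  have /choice[C CP] : forall i, exists C, forall m x, B x ->
      `|dtensor a Q (cut l m sin_mode) i x| <= C.
    by move=> i; exact: (dtensor_cut_bounded a QQ ss (vanishing_sin_mode i)).
  have /choice[E EP] : forall i, exists C, forall x, B x ->
      `|dtensor a Q sin_mode i x| <= C.
    move=> i; have cu k : continuous (upd sin_mode i (derive1 (sin_mode i)) k).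
      by apply: smooth_continuous; apply: upd_smooth => //; exact: smooth_derive1.
    by have [_ [C' CP']] := tensor_bounded_mfun a l QQ cu; exists C'.
  apply: (cvg_inner_bounded0 mB finB (C := \sum_k `|Q k j| * (E k + C k))).
  + move=> m; have [+ _] := sqintB mB (partial_tensor_sqint a QQ l0 j ss)
     (partial_tensor_sqint a QQ l0 j (scut m)).
    by [].
  + move=> m x Bx /=; rewrite !partial_tensor// -sumrB.
    apply: le_trans (ler_norm_sum _ _ _) _; apply: ler_sum => k _.
    rewrite -mulrBr normrM ler_wpM2l//; apply: le_trans (ler_normB _ _) _.
    by apply: lerD; [exact: EP|exact: CP].
  + move=> x Bx /=; rewrite partial_tensor//.
    have -> : (fun m => \sum_k Q k j * dtensor a Q sin_mode k x - partial j (T (cut l m sin_mode)) x)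
      = (fun m => \sum_k Q k j * dtensor a Q sin_mode k x - \sum_k Q k j * dtensor a Q (cut l m sin_mode) k x).
      by apply/funext => m; rewrite partial_tensor.
    rewrite -[X in _ --> X](subrr (\sum_k Q k j * dtensor a Q sin_mode k x)).
    apply: cvgB; first exact: cvg_cst.
    elim: (index_enum _) => [|k r ih].
      by rewrite big_nil; under eq_cvg do rewrite big_nil; exact: cvg_cst.
    rewrite big_cons; under eq_cvg do rewrite big_cons.
    apply: cvgD => //; apply: cvgM; first exact: cvg_cst.
    exact: (cvg_dtensor_cut QQ ss (vanishing_sin_mode k) Bx).
Qed.

End weak_rectangle.

(** * Eigenfunctions, their orthogonality and a Poincare inequality *)

Section eigenfunctions.
Context {R : realType} {n : nat}.
Variables (a : 'rV[R]_n) (Q : 'M[R]_n) (l : 'I_n -> R).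
Hypothesis QQ : Q *m Q^T = 1%:M.
Hypothesis l0 : forall i, 0 < l i.
Local Notation mu := (lebesgue_rV R n).
Local Notation B := (rectangle a Q l).
Local Notation y := (bcoord a Q).
Local Notation T := (tensor a Q).
Implicit Types (g : 'I_n -> R -> R) (u v : 'rV[R]_n -> R) (h : 'I_n -> 'rV[R]_n -> R).

Let mB : measurable B := measurable_rectangle a l QQ.
Let finB : (mu B < +oo)%E := lebesgue_rectangle_lty a QQ l0.

Definition laplace_eigenvalue (k : 'I_n -> nat) : R := \sum_i freq l (k i) i ^+ 2.

Lemma cos_fun_H1 k : H1 B (cos_fun a Q l k) (fun j => partial j (cos_fun a Q l k)).
Proof. by apply: tensor_H1 => // i; exact: smooth_cos_mode. Qed.

Lemma cos_fun_eigen k v h : H1 B v h ->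
  grad_inner B (fun j => partial j (cos_fun a Q l k)) h =
  laplace_eigenvalue k * inner B (cos_fun a Q l k) v.
Proof.
move=> H1v; have [_ sh _] := H1v; rewrite grad_inner_tensor//; last first.
  by move=> i; exact: smooth_cos_mode.
rewrite mulr_suml; apply: eq_bigr => i _.
exact: (neumann_identity QQ l0 k i H1v).
Qed.

Lemma cos_fun_eigenspace k : Defs.eigenspace B (H1 B) (laplace_eigenvalue k) (cos_fun a Q l k).
Proof.
exists (fun j => partial j (cos_fun a Q l k)); first exact: cos_fun_H1.
by move=> v h; exact: cos_fun_eigen.
Qed.

(** Distinct indices may share the same eigenvalue, so the argument uses a single edge i with
    [k i <> k' i]. [neumann_identity] applied both ways gives the same pairing with two different
    squared frequencies as factors, which forces it to be 0. *)
Lemma cos_fun_orthogonal k k' : k <> k' -> inner B (cos_fun a Q l k) (cos_fun a Q l k') = 0.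
Proof.
move=> kk; have [i ki] : exists i, k i <> k' i.
  by apply: contrapT => H; apply: kk; apply/funext => i; apply: contrapT => ?; apply: H; exists i.
have dual m m' : inner B (dtensor a Q (cos_mode l m) i)
    (rot_grad Q (fun j => partial j (cos_fun a Q l m')) i) =
    inner B (dtensor a Q (cos_mode l m) i) (dtensor a Q (cos_mode l m') i).
  apply: eq_inner => // x _; apply: sum_partial_tensor => // j.
  exact: smooth_cos_mode.
have e1 := neumann_identity QQ l0 k i (cos_fun_H1 k').
have e2 := neumann_identity QQ l0 k' i (cos_fun_H1 k).
move: e1 e2; rewrite !dual [in X in _ -> X = _ -> _]innerC => -> .
rewrite [inner B (cos_fun _ _ _ k') _]innerC => /eqP; rewrite -subr_eq0 -mulrBl mulf_eq0.
case/orP => [|/eqP//]; rewrite subr_sqr mulf_eq0 => /orP[|].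
  rewrite subr_eq0 /freq => /eqP /(mulIf _); rewrite invr_eq0 gt_eqF// => /(_ erefl).
  move/(mulIf _); rewrite gt_eqF ?pi_gt0// => /(_ erefl) /eqP; rewrite eqr_nat => /eqP.
  by move/ki.
have f0 j m : 0 <= freq l m j by rewrite /freq divr_ge0 ?(ltW (l0 j))// mulr_ge0// pi_ge0.
rewrite paddr_eq0// => /andP[/eqP fk /eqP fk']; exfalso; apply: ki.
have fz m : freq l m i = 0 -> m = 0%N.
  move=> /eqP; rewrite /freq !mulf_eq0 invr_eq0 (gt_eqF (l0 i)) (gt_eqF (pi_gt0 R)) !orbF.
  by rewrite pnatr_eq0 => /eqP.
by rewrite (fz _ fk) (fz _ fk').
Qed.

(** Differentiating the sine product along edge i gives a function [T g] that does not vanish at the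
    facets. Here the boundary condition comes from the other side: [v] is approximated by test
    functions, each of which may be integrated by parts against the smooth [T g]. *)
Lemma sin_fun_eigenspace :
  Defs.eigenspace B (H10 B) (laplace_eigenvalue (fun=> 1%N)) (sin_fun a Q l).
Proof.
have ss k : smooth (sin_mode l k) by exact: smooth_sin_mode.
have ssin : sq_integrable B (sin_fun a Q l).
  by apply: (tensor_sqint a QQ l0) => k; exact: smooth_continuous.
exists (fun j => partial j (sin_fun a Q l)); first exact: sin_fun_H10.
move=> v h [[sv sh _] [phi [tphi cv ch]]].
rewrite grad_inner_tensor// mulr_suml; apply: eq_bigr => i _.
set c := freq l 1 i; pose g := upd (sin_mode l) i (derive1 (sin_mode l i)).
have sg k : smooth (g k) by apply: upd_smooth => //; exact: smooth_derive1.
have cTg : continuous (T g) by apply: tensor_continuous => k; exact: smooth_continuous.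
have sTg : sq_integrable B (T g) by exact: (dtensor_sqint a QQ l0).
have gi : dtensor a Q g i = (fun x => - c ^+ 2 * sin_fun a Q l x).
  apply: dtensor_eigen; rewrite /sin_mode derive1_sinM derive1Z ?derive1_cosM.
    by apply/funext => s; rewrite -/c; ring.
  exact: smooth_cosM.
have sphi m : sq_integrable B (phi m).
  exact: (bounded_mfun_sqint mB finB (test_function_bounded mB (tphi m))).
have sdphi m j : sq_integrable B (partial j (phi m)).
  exact: (bounded_mfun_sqint mB finB (partial_test_function_bounded mB j (tphi m))).
have eq m : \sum_j Q i j * inner B (T g) (partial j (phi m)) =
    c ^+ 2 * inner B (sin_fun a Q l) (phi m).
  transitivity (- inner B (dtensor a Q g i) (phi m)).
    have CkT : is_Ck 1 (T g) by apply: is_Ck_tensor => k; exact: sg.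
    have wT := weak_gradient_Ck mB finB CkT.
    rewrite -[RHS]mul1r mulrN -mulNr mulN1r.
    under eq_bigr do rewrite wT// mulrN.
    rewrite sumrN -(inner_lincombl mB)//; last by move=> j; exact: partial_tensor_sqint.
    by congr (- _); apply: eq_inner => // x _; exact: sum_partial_tensor.
  by rewrite gi (innerZl mB)// mulNr opprK.
have L1 : \sum_j Q i j * inner B (T g) (partial j (phi m)) @[m --> \oo] -->
    \sum_j Q i j * inner B (T g) (h j).
  elim: (index_enum _) => [|j r ih].
    by rewrite big_nil; under eq_cvg do rewrite big_nil; exact: cvg_cst.
  rewrite big_cons; under eq_cvg do rewrite big_cons.
  apply: cvgD => //; apply: cvgM; first exact: cvg_cst.
  exact: (cvg_inner_l2 mB).
have L2 : c ^+ 2 * inner B (sin_fun a Q l) (phi m) @[m --> \oo] -->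
    c ^+ 2 * inner B (sin_fun a Q l) v.
  by apply: cvgM; [exact: cvg_cst|exact: (cvg_inner_l2 mB)].
rewrite (inner_lincombr mB)//.
move: L1; under eq_cvg do rewrite eq.
by move/cvg_unique => /(_ (@norm_hausdorff _ _) _ L2).
Qed.

Lemma poincare_test (phi : 'rV[R]_n -> R) i : test_function B phi ->
  inner B phi phi <= 16 * l i ^+ 2 *
    grad_inner B (fun j => partial j phi) (fun j => partial j phi).
Proof.
move=> tphi; have [cphi dphi cdphi [K [cK KB] K0]] := test_functionP tphi.
have sphi : sq_integrable B phi.
  exact: (bounded_mfun_sqint mB finB (test_function_bounded mB tphi)).
have sdphi j : sq_integrable B (partial j phi).
  exact: (bounded_mfun_sqint mB finB (partial_test_function_bounded mB j tphi)).
pose D x := \sum_j Q i j * partial j phi x.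
pose yD x := y i x * D x.
have sD : sq_integrable B D by exact: (sqint_lincomb mB finB).
have by_ : bounded_mfun B (y i).
  split; first by apply: measurable_funTS; exact: measurable_bcoord.
  by exists (l i) => x /(rectangleP a l QQ)/(_ i)/andP[y0 yl]; rewrite gtr0_norm// ltW.
have bD : bounded_mfun B D.
  rewrite /D; apply: bounded_mfun_sum => j.
  apply: bounded_mfunM; first exact: (bounded_mfun_cst B (Q i j)).
  exact: (partial_test_function_bounded mB j tphi).
have syD : sq_integrable B yD.
  by apply: (bounded_mfun_sqint mB finB); exact: bounded_mfunM.
have e1 : inner B phi phi = - 2 * inner B phi yD.
  have dy j x : is_derive x (delta_mx 0 j) (fun x => y i x * phi x)
      (Q i j * phi x + y i x * partial j phi x).
    have d1 : is_derive x (delta_mx 0 j) (y i) (Q i j).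
      have := @is_derive_bcoord _ _ a Q id 1 i x (delta_mx 0 j) (is_derive_id _ _).
      by rewrite mulr1 delta_mx_bcoord.
    have := @is_deriveM _ _ (y i) phi x (delta_mx 0 j) _ _ d1 (derivableP (dphi x j)).
    by congr is_derive; rewrite /GRing.scale/= addrC [phi x * _]mulrC.
  have cM (f1 f2 : 'rV[R]_n -> R) : continuous f1 -> continuous f2 ->
      continuous (fun x => f1 x * f2 x).
    by move=> c1 c2 x; exact: (@continuousM _ _ f1 f2 x (c1 x) (c2 x)).
  have cy : continuous (y i) by exact: continuous_bcoord.
  have syphi : sq_integrable B (fun x => y i x * phi x).
    apply: (bounded_mfun_sqint mB finB); apply: bounded_mfunM => //.
    exact: (test_function_bounded mB tphi).
  have sydphi j : sq_integrable B (fun x => y i x * partial j phi x).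
    apply: (bounded_mfun_sqint mB finB); apply: bounded_mfunM => //.
    exact: (partial_test_function_bounded mB j tphi).
  have ibp j : inner B (fun x => y i x * phi x) (partial j phi) =
      - (Q i j * inner B phi phi) - inner B (fun x => y i x * phi x) (partial j phi).
    rewrite [LHS](inner_partial mB finB (cM _ _ cy cphi)) //.
    - rewrite (partialE (dy j)) -opprD; congr (- _).
      rewrite (innerDl mB (sqintZ mB _ sphi) (sydphi j) sphi) (innerZl mB)//.
      congr (_ + _); apply: eq_Rintegral => x _; ring.
    - rewrite (partialE (dy j)) => x.
      have c1 : continuous (fun x => Q i j * phi x : R).
        have cc : continuous (fun _ : 'rV[R]_n => Q i j : R) by exact: cst_continuous.
        exact: (cM _ _ cc cphi).
      exact: (@continuousD _ R^o _ (fun x => Q i j * phi x) (fun x => y i x * partial j phi x)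
        x (c1 x) (cM _ _ cy (cdphi j) x)).
  (* Each axis j contributes the derivative [Q i j] of [y i]. Weighting by [Q i j] and summing gives
     total weight 1, because row i of [Q] is a unit vector. *)
  have ibp2 j : Q i j * (2 * inner B (fun x => y i x * phi x) (partial j phi)) =
     - (Q i j * Q i j) * inner B phi phi.
    by have := ibp j; set X := inner _ _ _; set P := inner _ _ _ => h; have -> : 2 * X = - (Q i j * P); [lra|ring].
  have : \sum_j Q i j * (2 * inner B (fun x => y i x * phi x) (partial j phi)) =
      - inner B phi phi.
    under eq_bigr do rewrite ibp2.
    by rewrite -mulr_suml sumrN (orthonormal_sum QQ) eqxx mulNr mul1r.
  have -> : \sum_j Q i j * (2 * inner B (fun x => y i x * phi x) (partial j phi)) =
      2 * inner B phi yD.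
    under eq_bigr do rewrite mulrCA.
    rewrite -big_distrr/= -(inner_lincombr mB)//; congr (_ * _).
    by apply: eq_Rintegral => x _; rewrite /yD /D; ring.
  lra.
have e2 : inner B yD yD <= l i ^+ 2 * grad_inner B (fun j => partial j phi) (fun j => partial j phi).
  rewrite /grad_inner /inner -(Rintegral_sum mB)//; last by move=> j; exact: (sqint_mul mB).
  have isum : mu.-integrable B (EFin \o (fun x => \sum_j partial j phi x * partial j phi x)).
    apply: (bounded_mfun_integrable mB finB); apply: bounded_mfun_sum => j.
    by apply: bounded_mfunM; exact: (partial_test_function_bounded mB j tphi).
  rewrite -RintegralZl//; apply: le_Rintegral => //.
  - exact: (sqint_mul mB).
  - exact: (integrableZl mB (l i ^+ 2) isum).
  move=> x /(rectangleP a l QQ)/(_ i)/andP[y0 yl].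
  rewrite /yD mulrACA -!expr2; apply: ler_pM; rewrite ?sqr_ge0//.
    by rewrite lerXn2r ?nnegrE ?ltW.
  (* [D x] is one component of the gradient in the edge frame, where its length is the same as in
     the axis frame. *)
  pose p := \row_j partial j phi x.
  have -> : \sum_j partial j phi x * partial j phi x = \sum_k (p *m Q^T) 0 k ^+ 2.
    rewrite sum_sqr_mulmx trmx_mul trmxK mulmxA -(mulmxA p) (trmx_orthonormal QQ) mulmx1.
    by rewrite mxE; apply: eq_bigr => j _; rewrite !mxE.
  have -> : D x = (p *m Q^T) 0 i.
    by rewrite mxE; apply: eq_bigr => j _; rewrite !mxE mulrC.
  by rewrite [leRHS](bigD1 i)//= lerDl sumr_ge0// => j _; exact: sqr_ge0.
(* Weight 1/4 bounds the squared norm of [phi] by half of itself plus 8 times that of [yD];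
   absorbing the half produces the constant 16. *)
have h := inner_le_sqr mB (e := 1 / 4) (divr_gt0 ltr01 (ltr0n _ 4)) sphi syD.
move: h; rewrite invf_div divr1 ler_norml => /andP[h _].
have := inner_ge0 B phi; rewrite -mulrA; move: e1 e2 h; lra.
Qed.

End eigenfunctions.

(** * Completeness of the cosines *)

Section completeness.
Context {R : realType} {n : nat}.
Variables (a : 'rV[R]_n) (Q : 'M[R]_n) (l : 'I_n -> R).
Hypothesis QQ : Q *m Q^T = 1%:M.
Hypothesis l0 : forall i, 0 < l i.
Local Notation mu := (lebesgue_rV R n).
Local Notation B := (rectangle a Q l).
Local Notation y := (bcoord a Q).
Local Notation C := (cos_fun a Q l).
Implicit Types (f g M : 'rV[R]_n -> R).

Let mB : measurable B := measurable_rectangle a l QQ.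
Let finB : (mu B < +oo)%E := lebesgue_rectangle_lty a QQ l0.

Variable u : 'rV[R]_n -> R.
Hypothesis su : sq_integrable B u.
Hypothesis uC : forall k, inner B u (C k) = 0.

Definition annihilated M := bounded_mfun B M /\
  forall k, inner B u (fun x => M x * C k x) = 0.

(* The bounded functions by which the annihilated ones may be multiplied form an
   algebra closed under bounded pointwise limits, so that it suffices to put the
   functions [cos (pi * y i / l i)] in it. *)
Definition multiplier f := bounded_mfun B f /\
  forall M, annihilated M -> annihilated (fun x => f x * M x).

Let bC k : bounded_mfun B (C k).
Proof. by apply: (tensor_bounded_mfun a l QQ) => i; apply: smooth_continuous; exact: smooth_cos_mode. Qed.

Lemma annihilated1 : annihilated (cst 1).
Proof.
split=> [|k]; first exact: bounded_mfun_cst.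
by rewrite -(uC k); apply: eq_inner => // x _; rewrite mul1r.
Qed.

Let bsq f g : bounded_mfun B f -> bounded_mfun B g -> sq_integrable B (fun x => f x * g x).
Proof. by move=> bf bg; apply: (bounded_mfun_sqint mB finB); exact: bounded_mfunM. Qed.

Lemma multiplier_cst (c : R) : multiplier (cst c).
Proof.
split=> [|M [bM oM]]; first exact: bounded_mfun_cst.
split=> [|k]; first by apply: bounded_mfunM => //; exact: bounded_mfun_cst.
rewrite innerC (eq_inner (u' := fun x => c * (M x * C k x)) (v' := u))//.
  by rewrite (innerZl mB _ (bsq bM (bC k)) su) innerC oM mulr0.
by move=> x _; rewrite mulrA.
Qed.

Lemma multiplierD f g : multiplier f -> multiplier g -> multiplier (fun x => f x + g x).
Proof.
move=> [bf mf] [bg mg]; split=> [|M aM]; first exact: bounded_mfunD.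
have [bM _] := aM; have [bfM ofM] := mf _ aM; have [bgM ogM] := mg _ aM.
split=> [|k]; first by apply: bounded_mfunM => //; exact: bounded_mfunD.
rewrite innerC (eq_inner (u' := fun x => f x * M x * C k x + g x * M x * C k x) (v' := u))//.
  by rewrite (innerDl mB (bsq bfM (bC k)) (bsq bgM (bC k)) su) innerC ofM innerC ogM addr0.
by move=> x _; ring.
Qed.

Lemma multiplierM f g : multiplier f -> multiplier g -> multiplier (fun x => f x * g x).
Proof.
move=> [bf mf] [bg mg]; split=> [|M aM]; first exact: bounded_mfunM.
have := mf _ (mg _ aM); congr annihilated; apply/funext => x; exact: mulrA.
Qed.

Lemma multiplier_lim (f_ : nat -> 'rV[R]_n -> R) f (D : R) :
  (forall m, multiplier (f_ m)) -> (forall m x, B x -> `|f_ m x| <= D) ->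
  (forall x, B x -> f_ ^~ x @ \oo --> f x) -> multiplier f.
Proof.
move=> mf_ fD ff.
have bf : bounded_mfun B f.
  split; first by apply: (measurable_fun_cvg (h := f_)) => // m; have [[]] := mf_ m.
  exists D => x Bx; apply: (@closed_cvg _ _ \oo eventually_filter (fun m => `|f_ m x|)
    [set s | s <= D] (@closed_le _ D)).
    by apply: nearW => m; exact: fD.
  by apply: cvg_norm; exact: ff.
split=> // M aM; have [bM oM] := aM; split=> [|k]; first exact: bounded_mfunM.
have [mMC [E EP]] := bounded_mfunM bM (bC k).
have L : inner B u (fun x => f_ m x * M x * C k x) @[m --> \oo] -->
    inner B u (fun x => f x * M x * C k x).
  apply: (cvg_inner_bounded mB finB (C := D * E)) => //.
  - move=> m; have [[mfm _] _] := mf_ m.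
    have -> : (fun x => f_ m x * M x * C k x) = (fun x => f_ m x * (M x * C k x)).
      by apply/funext => x; rewrite mulrA.
    exact: measurable_funM.
  - by move=> m x Bx; rewrite -mulrA normrM ler_pM ?fD ?EP.
  - move=> x Bx; apply: cvgM; last exact: cvg_cst.
    by apply: cvgM; [exact: ff|exact: cvg_cst].
have e m : inner B u (fun x => f_ m x * M x * C k x) = 0.
  by have [_ /(_ _ aM) [_]] := mf_ m; apply.
move: L; under eq_cvg do rewrite e.
by move/cvg_unique => /(_ (@norm_hausdorff _ _) _ (cvg_cst _)).
Qed.

(** Functions that agree on [B] may differ elsewhere; the constant sequence [f] converges to [g] on
    [B], so closure under limits applies. *)
Lemma eq_multiplier f g : (forall x, B x -> f x = g x) -> multiplier f -> multiplier g.
Proof.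
move=> fg mf; have [[_ [D DP]] _] := mf.
apply: (multiplier_lim (f_ := fun=> f) (D := D)) => // x Bx.
by rewrite -fg//; exact: cvg_cst.
Qed.

Lemma multiplier_sum (f_ : nat -> 'rV[R]_n -> R) N : (forall m, multiplier (f_ m)) ->
  multiplier (fun x => \sum_(0 <= m < N) f_ m x).
Proof.
move=> mf; elim: N => [|N ih].
  by apply: eq_multiplier (multiplier_cst 0) => x _; rewrite big_geq.
by apply: eq_multiplier (multiplierD ih (mf N)) => x _; rewrite big_nat_recr.
Qed.

Lemma multiplier_prod (f_ : nat -> 'rV[R]_n -> R) N : (forall m, multiplier (f_ m)) ->
  multiplier (fun x => \prod_(0 <= m < N) f_ m x).
Proof.
move=> mf; elim: N => [|N ih].
  by apply: eq_multiplier (multiplier_cst 1) => x _; rewrite big_geq.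
by apply: eq_multiplier (multiplierM ih (mf N)) => x _; rewrite big_nat_recr.
Qed.

Lemma multiplierX f m : multiplier f -> multiplier (fun x => f x ^+ m).
Proof.
move=> mf; elim: m => [|m ih]; first exact: (multiplier_cst 1).
by apply: eq_multiplier (multiplierM mf ih) => x _; rewrite exprS.
Qed.

Lemma exp_series_le (s : R) N : 0 <= s -> series (exp_coeff s) N <= expR s.
Proof.
move=> s0; apply: nondecreasing_cvgn_le; last exact: is_cvg_series_exp_coeff.
apply: nondecreasing_series => m _ _; rewrite /exp_coeff /=.
by rewrite divr_ge0// exprn_ge0.
Qed.

Lemma multiplier_expR f : multiplier f -> multiplier (fun x => expR (f x)).
Proof.
move=> mf; have [[_ [D DP]] _] := mf.
(* A negative bound for an absolute value on [B] means that [B] has no points. *)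
have [D0|D0] := leP 0 D; last first.
  apply: (multiplier_lim (f_ := fun=> f) (D := 0)) => // [m x Bx|x Bx].
    by have := le_trans (normr_ge0 _) (DP x Bx); rewrite leNgt D0.
  by have := le_trans (normr_ge0 _) (DP x Bx); rewrite leNgt D0.
apply: (multiplier_lim (f_ := fun N x => series (exp_coeff (f x)) N) (D := expR D)).
- move=> N; apply: multiplier_sum => m; rewrite /exp_coeff /=.
  exact: (multiplierM (multiplierX m mf) (multiplier_cst _)).
- move=> N x Bx; apply: le_trans (exp_series_le N D0).
  rewrite /series/=; apply: le_trans (ler_norm_sum _ _ _) _; apply: ler_sum => m _.
  rewrite /exp_coeff/= normrM normrX (ger0_norm (x := _^-1)) ?invr_ge0//.
  by rewrite ler_wpM2r ?invr_ge0// lerXn2r ?nnegrE// DP.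
- by move=> x Bx; exact: is_cvg_series_exp_coeff.
Qed.

(** The indicator is the limit of [expR (- expR (m * (1 - m * f)))]. Where [f > 0] the inner
    argument tends to minus infinity and the value to 1; where [f <= 0] it is at least [m] and the
    value tends to 0. The summand 1 decides the case [f = 0]. *)
Lemma multiplier_gt0 f : multiplier f -> multiplier (\1_[set x | 0 < f x]).
Proof.
move=> mf.
apply: (multiplier_lim (D := 1)
  (f_ := fun m x => expR (- expR (m%:R * (1 - m%:R * f x))))).
- move=> m; apply: multiplier_expR.
  have mN h : multiplier h -> multiplier (fun x => - h x).
    move=> mh; apply: eq_multiplier (multiplierM (multiplier_cst (-1)) mh) => x _.
    by rewrite mulN1r.
  apply: (mN); apply: multiplier_expR; apply: (multiplierM (multiplier_cst m%:R)).
  apply: (multiplierD (multiplier_cst 1)); apply: (mN).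
  exact: (multiplierM (multiplier_cst m%:R)).
- move=> m x _; rewrite ger0_norm ?expR_ge0// expR_le1 oppr_le0; exact: expR_ge0.
move=> x _; apply/cvgrPdist_le => e e0.
have [N _ NP] : \forall m \near \oo, expR (- m%:R) <= e.
  have /cvgr0Pnorm_le/(_ e e0) := @cvgn_expR R.
  by apply: filterS => m; rewrite ger0_norm ?expR_ge0.
have key (m : nat) z : m%:R <= z -> expR (- expR z) <= expR (- m%:R).
  by move=> mz; rewrite ler_expR lerN2 (le_trans mz)// (le_trans _ (expR_ge1Dx z))// lerDr.
rewrite indicE; have [fx|fx] := boolP (x \in [set x | 0 < f x]); rewrite ?inE ?notin_setE/= in fx.
  have [N' _ N'P] : \forall m \near \oo, 2 / f x <= m%:R.
    by apply: nbhs_infty_ger.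
  exists (maxn N N') => // m /=; rewrite geq_max => /andP[Nm N'm].
  have h1 := NP _ Nm; have h2 := N'P _ N'm; rewrite /= ler_pdivrMr// in h2.
  have h3 : m%:R * (1 - m%:R * f x) <= - m%:R.
    rewrite -subr_ge0 (_ : _ - _ = m%:R * (m%:R * f x - 2)); last by ring.
    by rewrite mulr_ge0// subr_ge0.
  rewrite ger0_norm; last by rewrite subr_ge0 expR_le1 oppr_le0 expR_ge0.
  have h4 := expR_ge1Dx (- expR (m%:R * (1 - m%:R * f x))).
  have h5 : expR (m%:R * (1 - m%:R * f x)) <= expR (- m%:R) by rewrite ler_expR.
  by move: h1 h4 h5; rewrite /=; lra.
exists N => // m Nm; have h1 := NP _ Nm.
rewrite sub0r normrN ger0_norm ?expR_ge0//; apply: le_trans h1; apply: key.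
rewrite -[leLHS]mulr1 ler_wpM2l// lerBrDr gerDl.
by rewrite mulr_ge0_le0// leNgt; apply/negP.
Qed.

Definition multiplier_set (A : set 'rV[R]_n) := multiplier (\1_A : 'rV[R]_n -> R).

Lemma multiplier_set0 : multiplier_set set0.
Proof. by apply: eq_multiplier (multiplier_cst 0) => x _; rewrite indic0. Qed.

Lemma multiplier_setC A : multiplier_set A -> multiplier_set (~` A).
Proof.
move=> mA; apply: eq_multiplier (multiplierD (multiplier_cst 1)
  (multiplierM (multiplier_cst (-1)) mA)) => x _.
by rewrite !indicE in_setC; case: (x \in A); rewrite /cst/= ?mulr1 ?mulr0 ?addr0 ?subrr.
Qed.

Lemma multiplier_bigcup (F : nat -> set 'rV[R]_n) :
  (forall m, multiplier_set (F m)) -> multiplier_set (\bigcup_m F m).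
Proof.
move=> mF; rewrite -[\bigcup_m _]setCK; apply: multiplier_setC.
apply: (multiplier_lim (D := 1)
  (f_ := fun N x => \prod_(0 <= m < N) (\1_(~` F m) x : R))).
- by move=> N; apply: multiplier_prod => m; exact: multiplier_setC.
- move=> N x _; rewrite normr_prod; apply: prodr_ile1 => m _.
  by rewrite normr_ge0/= indicE; case: (_ \in _); rewrite ?normr1 ?normr0.
- move=> x _; rewrite indicE; have [xF|xF] := boolP (x \in ~` \bigcup_m F m);
    rewrite ?inE ?notin_setE in xF.
    have -> : (fun N => \prod_(0 <= m < N) \1_(~` F m) x) = (fun=> 1 : R).
      apply/funext => N; rewrite big1// => m _; rewrite indicE mem_set//= => Fm.
      by apply: xF; exists m.
    exact: cvg_cst.
  have [m _ Fm] : (\bigcup_m F m) x by apply: contrapT.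
  apply/cvgrPdist_le => e e0; exists m.+1 => // N /= mN.
  rewrite (_ : \prod_(_ <= _ < _) _ = 0) ?subrr ?normr0 ?ltW//.
  apply/eqP; rewrite prodf_seq_eq0; apply/hasP; exists m; first by rewrite mem_index_iota.
  by rewrite /= indicE memNset ?eqxx//= => /(_ Fm).
Qed.

Lemma multiplier_borel f : multiplier f ->
  forall S : set R, measurable (S : set (measurableTypeR R)) -> multiplier_set (f @^-1` S).
Proof.
move=> mf S mS; suff : (measurable : set (set (measurableTypeR R))) `<=`
    [set S | multiplier_set (f @^-1` S)] by apply.
have -> : (measurable : set (set (measurableTypeR R))) =
  <<s @RGenOInfty.G R >> by exact: RGenOInfty.measurableE.
apply: smallest_sub => /=.
  split=> /= [|A mA|F mF].
  - by rewrite preimage_set0; exact: multiplier_set0.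
  - by rewrite setTD preimage_setC; exact: multiplier_setC.
  - by rewrite preimage_bigcup; exact: multiplier_bigcup.
move=> A [r ->] /=.
have := multiplier_gt0 (multiplierD mf (multiplier_cst (- r))).
congr multiplier; congr (\1__); apply/seteqP; split => x /=;
  by rewrite in_itv/= andbT subr_gt0.
Qed.

(** The product formula for cosines: multiplying [C k] by the first cosine in direction i gives the
    mean of the modes with [k i] lowered and raised by one. If [k i] is 0, it gives the mode with
    [k i] replaced by 1. *)
Lemma multiplier_cos i : multiplier (fun x => cos (freq l 1 i * y i x)).
Proof.
have bc : bounded_mfun B (fun x => cos (freq l 1 i * y i x)).
  split.
    apply: measurable_funTS; apply: continuous_measurable_rV => //.
    move=> x; apply: (@continuous_comp _ _ _ (y i) (fun s => cos (freq l 1 i * s))).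
      exact: continuous_bcoord.
    exact: (smooth_continuous (smooth_cosM _)).
  by exists 1 => x _; exact: cos_max.
split=> // M [bM oM]; split=> [|k]; first exact: bounded_mfunM.
have CE k' (x : 'rV[R]_n) : C k' x = cos (freq l (k' i) i * y i x) *
    \prod_(j | j != i) cos_mode l k' j (y j x).
  by rewrite /cos_fun /tensor (bigD1 i).
have CU m x : C (upd k i m) x = cos (freq l m i * y i x) *
    \prod_(j | j != i) cos_mode l k j (y j x).
  rewrite CE /upd eqxx; congr (_ * _); apply: eq_bigr => j /negPf ji.
  by rewrite /cos_mode ji.
have [k0|k0] := eqVneq (k i) 0%N.
  rewrite -(oM (upd k i 1%N)); apply: eq_inner => // x _.
  by rewrite CU CE k0 /freq !mul0r cos0; ring.
have [m km] : exists m, k i = m.+1 by case: (k i) k0 => // m _; exists m.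
rewrite innerC (eq_inner (u' := fun x => 2^-1 * (M x * C (upd k i m) x) +
    2^-1 * (M x * C (upd k i m.+2) x)) (v' := u))//.
  have s1 k' : sq_integrable B (fun x => M x * C k' x) by exact: bsq.
  rewrite (innerDl mB (sqintZ mB _ (s1 _)) (sqintZ mB _ (s1 _)) su).
  by rewrite !(innerZl mB _ (s1 _) su) ![inner _ _ u]innerC !oM !mulr0 addr0.
move=> x _; rewrite !CU CE km.
have e1 : freq l m.+2 i * y i x = freq l m.+1 i * y i x + freq l 1 i * y i x.
  by rewrite /freq -[m.+2]addn1 natrD; ring.
have e2 : freq l m i * y i x = freq l m.+1 i * y i x - freq l 1 i * y i x.
  by rewrite /freq -[m.+1]addn1 natrD; ring.
by rewrite e1 e2 cosB cosD; field; rewrite ?pnatr_eq0.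
Qed.

(** The cosine is strictly decreasing on [[0, pi]], so inside the box and for b between 0 and [l i]
    the condition [b < y i] is an upper bound on the cosine, to which [multiplier_borel] applies. *)
Lemma multiplier_ray i (b : R) : multiplier_set (y i @^-1` `]b, +oo[).
Proof.
have [b0|b0] := ltP b 0.
  apply: eq_multiplier (multiplier_cst 1) => x /(rectangleP a l QQ)/(_ i)/andP[x0 _].
  by rewrite indicE mem_set//= in_itv/= andbT (lt_trans b0).
have [lb|lb] := leP (l i) b.
  apply: eq_multiplier (multiplier_cst 0) => x /(rectangleP a l QQ)/(_ i)/andP[_ xl].
  by rewrite indicE memNset//= in_itv/= andbT ltNge (le_trans (ltW xl)).
have := multiplier_borel (multiplier_cos i) (measurable_itv `]-oo, cos (freq l 1 i * b)[).
apply: eq_multiplier => x /(rectangleP a l QQ)/(_ i)/andP[x0 xl].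
have li := l0 i.
have ang (s : R) : 0 <= s <= l i -> freq l 1 i * s \in `[0, pi].
  move=> /andP[s0 sl]; rewrite in_itv/= /freq mul1r mulrAC; apply/andP; split.
    by rewrite divr_ge0 ?(ltW li)// mulr_ge0// pi_ge0.
  by rewrite ler_pdivrMr// ler_wpM2l// pi_ge0.
have e : (cos (freq l 1 i * y i x) < cos (freq l 1 i * b)) = (b < y i x).
  rewrite ltr_cos; [|by apply: ang; rewrite ?b0 ?(ltW lb) ?(ltW x0) ?(ltW xl)..].
  by rewrite ltr_pM2l// /freq mul1r divr_gt0// pi_gt0.
by rewrite !indicE; congr (_%:R); congr nat_of_bool; apply/idP/idP; rewrite !inE/= !in_itv/= ?andbT e.
Qed.

(** Rays are available along the edges only, while the sigma-algebra is generated by the axis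
    coordinates. Writing [A] as the preimage under the edge coordinates [Y] of another measurable
    set reduces the claim to generators in the edge frame. *)
Lemma multiplier_measurable A : measurable A -> multiplier_set A.
Proof.
move=> mA; pose Y x : 'rV[R]_n := (x - a) *m Q^T.
have ray i (S : set R) : measurable (S : set (measurableTypeR R)) -> multiplier_set (y i @^-1` S).
  suff : (measurable : set (set (measurableTypeR R))) `<=`
    [set S | multiplier_set (y i @^-1` S)] by apply.
  have -> : (measurable : set (set (measurableTypeR R))) =
    <<s @RGenOInfty.G R >> by exact: RGenOInfty.measurableE.
  apply: smallest_sub => /=; last by move=> _ [r ->] /=; exact: multiplier_ray.
  split=> /= [|S' mS'|F mF].
  - by rewrite preimage_set0; exact: multiplier_set0.
  - by rewrite setTD preimage_setC; exact: multiplier_setC.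
  - by rewrite preimage_bigcup; exact: multiplier_bigcup.
have AE : A = Y @^-1` ((fun z => a + z *m Q) @^-1` A).
  apply/seteqP; split => x /=; rewrite /Y -mulmxA (trmx_orthonormal QQ) mulmx1 addrC subrK//.
have mA' : measurable ((fun z : 'rV[R]_n => a + z *m Q) @^-1` A).
  rewrite -[X in measurable X]setTI.
  have m1 : measurable_fun setT (fun z : 'rV[R]_n => a + z *m Q).
    rewrite (_ : (fun _ => _) = (fun x => x + a) \o (fun z => z *m Q)).
      by apply: measurableT_comp; [exact: measurable_translate|exact: measurable_mulmx].
    by apply/funext => z; rewrite /= addrC.
  exact: m1.
rewrite AE; move: (_ @^-1` A) mA' => A' mA'.
suff : (measurable : set (set 'rV[R]_n)) `<=` [set A' | multiplier_set (Y @^-1` A')] by apply.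
apply: smallest_sub => /=.
  split=> /= [|S' mS'|F mF].
  - by rewrite preimage_set0; exact: multiplier_set0.
  - by rewrite setTD preimage_setC; exact: multiplier_setC.
  - by rewrite preimage_bigcup; exact: multiplier_bigcup.
move=> S; rewrite -bigcup_seq => -[i _ [S' mS' <-]] /=; rewrite setTI.
exact: ray.
Qed.

Lemma cos_fun0 k x : (forall i, k i = 0%N) -> C k x = 1.
Proof.
by move=> k0; rewrite /cos_fun /tensor big1// => i _; rewrite /cos_mode k0 /freq !mul0r cos0.
Qed.

(** The sign of [u] on [B] is a combination of two indicators of measurable sets, hence a
    multiplier. Applying it to the constant 1 and pairing with the constant mode shows that the
    integral of the absolute value of [u] is 0. *)
Lemma cos_fun_complete : {ae mu, forall x, B x -> u x = 0}.
Proof.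
have [mu_ _] := su.
have mpos (S : set R) : measurable (S : set (measurableTypeR R)) -> measurable (B `&` u @^-1` S).
  by move=> mS; exact: mu_.
have mP := multiplier_measurable (mpos _ (measurable_itv `]0, +oo[)).
have mN := multiplier_measurable (mpos _ (measurable_itv `]-oo, 0[)).
pose s x : R := \1_(B `&` u @^-1` `]0, +oo[) x + -1 * \1_(B `&` u @^-1` `]-oo, 0[) x.
have ms : multiplier s by exact: (multiplierD mP (multiplierM (multiplier_cst (-1)) mN)).
have [_ /(_ (fun=> 0%N))] := (ms.2 _ annihilated1).
have us x : B x -> u x * (s x * 1 * C (fun=> 0%N) x) = `|u x|.
  move=> Bx; rewrite cos_fun0// !mulr1 /s !indicE.
  have [u0|u0|u0] := ltgtP (u x) 0.
  - rewrite memNset/=; last by rewrite in_itv/= andbT => -[_]; rewrite ltNge (ltW u0).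
    rewrite mem_set/=; last by rewrite in_itv.
    by rewrite add0r mulr1 mulrN1 ltr0_norm.
  - rewrite mem_set/=; last by rewrite in_itv/= andbT.
    rewrite memNset/=; last by rewrite in_itv/= => -[_]; rewrite ltNge (ltW u0).
    by rewrite mulr0 addr0 mulr1 gtr0_norm.
  - by rewrite u0 normr0 mul0r.
have -> : inner B u (fun x => s x * 1 * C (fun=> 0%N) x) = \int[mu]_(x in B) `|u x|.
  by apply: eq_Rintegral => x; rewrite inE => Bx; exact: us.
move=> h; have iu := sqint_integrable mB finB su.
have mf : measurable_fun B (EFin \o u) by apply/measurable_EFinP.
have : (\int[mu]_(x in B) `|(EFin \o u) x| = 0)%E.
  by rewrite -[LHS]fineK; [congr EFin; exact: h|exact: integrable_fin_num (integrable_abse iu)].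
by move/(ae_eq_integral_abs _ mB mf).1; apply: filterS => x /[apply] /= -[].
Qed.

End completeness.

(** * Counting eigenvalues *)

Section counting_lemmas.
Context {R : realType}.

Lemma counting_ge (A : set nat) (N : nat) :
  (forall k, (0 < k <= N)%N -> A k) -> (N%:R%:E <= @counting nat R A)%E.
Proof.
move=> NA; rewrite /counting; case: asboolP => fA; last exact: leey.
rewrite lee_fin ler_nat -[leqLHS](size_iota 1 N).
have -> : size (iota 1 N) = #|` [fset k in iota 1 N]%fset |.
  by rewrite card_fseq undup_id// iota_uniq.
apply: fsubset_leq_card; apply/fsubsetP => k; rewrite !inE mem_iota add1n ltnS => kN.
by rewrite in_fset_set//; apply/mem_set; exact: NA.
Qed.

Lemma counting_le (A : set nat) (N : nat) :
  (forall k, A k -> (0 < k <= N)%N) -> (@counting nat R A <= N%:R%:E)%E.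
Proof.
move=> NA; have fA : finite_set A.
  apply: (sub_finite_set (B := `I_N.+1)); last exact: finite_II.
  by move=> k /NA /andP[_]; rewrite /= ltnS.
rewrite /counting asboolT// lee_fin ler_nat -[leqRHS](size_iota 1 N).
have -> : size (iota 1 N) = #|` [fset k in iota 1 N]%fset |.
  by rewrite card_fseq undup_id// iota_uniq.
apply: fsubset_leq_card; apply/fsubsetP => k; rewrite in_fset_set// => /set_mem /NA.
by rewrite !inE mem_iota add1n ltnS.
Qed.

(** Exchanging the sums counts each [d] once, at the level [lam d]. This turns bounds for single
    multiplicities into a count of lattice points. *)
Lemma esum_card_fibers (D : finType) (lam : D -> R) (S : set R) :
  (\esum_(s in S) #|[pred d | lam d == s]|%:R%:E =
  #|[pred d | lam d \in S]|%:R%:E :> \bar R)%E.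
Proof.
transitivity (\esum_(s in S) \sum_(d : D) (lam d == s)%:R%:E : \bar R)%E.
  apply: eq_esum => s _; rewrite sumEFin -sum1_card natr_sum big_mkcond/=.
  by congr EFin; apply: eq_bigr => d _; rewrite inE; case: eqP.
rewrite esum_sum; last by move=> s d _ _; rewrite lee_fin.
rewrite -sum1_card natr_sum -sumEFin [RHS]big_mkcond/=; apply: eq_bigr => d _.
rewrite inE/=; transitivity (\esum_(s in S `&` [set lam d]) (1 : \bar R))%E.
  rewrite esum_mkcondr; apply: eq_esum => s _.
  by rewrite (_ : (s \in [set lam d]) = (lam d == s)); [case: eqP|
    apply/idP/eqP; rewrite inE].
case: ifPn => lS; rewrite ?inE ?notin_setE in lS.
  by rewrite setI1 mem_set// esum_set1.
by rewrite setI1 memNset// esum_set0.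
Qed.

End counting_lemmas.

Section spectral_counting.
Context {R : realType} {n : nat}.
Variables (Omega : set 'rV[R]_n) (V : ('rV[R]_n -> R) -> ('I_n -> 'rV[R]_n -> R) -> Prop).
Local Notation mu := (lebesgue_rV R n).

Lemma multiplicity_ge0 t : (0 <= multiplicity Omega V t)%E.
Proof.
apply: le_ereal_sup_tmp; exists 0%E => //; exists 0%N => //=.
by exists (fun=> (fun=> 0)) => [[]//|c _ []//].
Qed.

Lemma eigenvalue_count_homo s t : s <= t ->
  (eigenvalue_count Omega V s <= eigenvalue_count Omega V t)%E.
Proof.
move=> st; rewrite /eigenvalue_count; apply: ereal_sup_le => x [X [fX Xs] <-].
by exists X => //; split=> // r /Xs /= rs; exact: le_trans st.
Qed.

Lemma multiplicity_le_count t : (multiplicity Omega V t <= eigenvalue_count Omega V t)%E.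
Proof.
apply: esum_ge; exists [set t]; last by rewrite fsbig_set1.
by split=> // s -> /=.
Qed.

Lemma nth_eigenvalue_le k t : (k%:R%:E <= eigenvalue_count Omega V t)%E ->
  (nth_eigenvalue Omega V k <= t%:E)%E.
Proof. by move=> kt; apply: ereal_inf_lbound; exists t. Qed.

(** The infimum defining the eigenvalue is not known to be attained, so the count is only controlled
    at a level strictly above [s]. *)
Lemma nth_eigenvalue_le_count k s t : s < t -> (nth_eigenvalue Omega V k <= s%:E)%E ->
  (k%:R%:E <= eigenvalue_count Omega V t)%E.
Proof.
move=> st ks; have [_ [r kr <-]] : exists2 y, [set r%:E | r in
   [set r : R | (k%:R%:E <= eigenvalue_count Omega V r)%E]] y & (y < t%:E)%E.
  by apply: ereal_inf_lt; rewrite (le_lt_trans ks)// lte_fin.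
by rewrite lte_fin => rt; apply: le_trans kr _; apply: eigenvalue_count_homo; exact: ltW.
Qed.

Lemma first_eigenvalue_ge t0 : (forall s, s < t0 -> multiplicity Omega V s = 0%E) ->
  (t0%:E <= nth_eigenvalue Omega V 1)%E.
Proof.
move=> m0; apply: le_ereal_inf_tmp => _ [t t1 <-]; rewrite lee_fin leNgt; apply/negP => tt0.
move: t1; rewrite /= /eigenvalue_count esum1 ?lee_fin ?ler10// => s /= st.
by apply: m0; exact: le_lt_trans tt0.
Qed.

Lemma lin_indep_ae_neq0 m (f : 'I_m -> 'rV[R]_n -> R) j : lin_indep_ae Omega f ->
  ~ {ae mu, forall x, Omega x -> f j x = 0}.
Proof.
move=> fi fj0; suff /(_ j)/eqP : forall i, (i == j)%:R = 0 :> R by rewrite eqxx oner_eq0.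
apply: fi; apply: filterS fj0 => x + Ox => /(_ Ox) fx.
rewrite (bigD1 j)//= eqxx mul1r fx add0r big1// => i /negPf ->; exact: mul0r.
Qed.

End spectral_counting.

Section rectangle_spectrum.
Context {R : realType} {n : nat}.
Variables (a : 'rV[R]_n) (Q : 'M[R]_n) (l : 'I_n -> R).
Hypothesis QQ : Q *m Q^T = 1%:M.
Hypothesis l0 : forall i, 0 < l i.
Local Notation mu := (lebesgue_rV R n).
Local Notation B := (rectangle a Q l).
Local Notation C := (cos_fun a Q l).

Lemma not_ae_zero (A : set 'rV[R]_n) (f : 'rV[R]_n -> R) : measurable A ->
  (0 < mu A)%E -> (forall x, A x -> f x <> 0) ->
  ~ {ae mu, forall x, A x -> f x = 0}.
Proof.
move=> mA A0 fA [N [mN N0 sN]].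
suff : (mu A <= 0)%E by rewrite leNgt A0.
rewrite -N0; apply: le_measure; rewrite ?inE// => x Ax; apply: sN => /= /(_ Ax).
exact: fA.
Qed.

(** Near the corner [a] no factor vanishes, and the sub-box with sides [r i] has positive
    measure. *)
Lemma mode_neq0_ae (g : 'I_n -> R -> R) (r : 'I_n -> R) :
  (forall i, 0 < r i <= l i) -> (forall i s, 0 < s < r i -> g i s <> 0) ->
  ~ {ae mu, forall x, B x -> tensor a Q g x = 0}.
Proof.
move=> rl gr H; have r0 i : 0 < r i by case/andP: (rl i).
have rB : rectangle a Q r `<=` B.
  move=> x /(rectangleP a r QQ) xr; apply/(rectangleP a l QQ) => i.
  by have /andP[-> /lt_le_trans ->//] := xr i; have /andP[] := rl i.
apply: (@not_ae_zero (rectangle a Q r) (tensor a Q g)).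
- exact: measurable_rectangle.
- by rewrite lebesgue_rectangle// lte_fin prodr_gt0.
- move=> x /(rectangleP a r QQ) xr /eqP; apply/negP.
  by apply/prodf_neq0 => i _; apply/eqP; exact: gr.
- by apply: filterS H => x Bx /rB.
Qed.

Lemma cos_fun_neq0_ae k : ~ {ae mu, forall x, B x -> C k x = 0}.
Proof.
(* On this sub-box the argument of each cosine stays below [pi / 2]; the successor also covers
   [k i = 0]. *)
apply: (@mode_neq0_ae _ (fun i => l i / (2 * (k i).+1%:R))).
  move=> i; rewrite divr_gt0 ?mulr_gt0 ?ltr0n//= ler_pdivrMr ?mulr_gt0 ?ltr0n//.
  by rewrite ler_peMr ?(ltW (l0 i))// -natrM ler1n.
move=> i s /andP[s0]; rewrite ltr_pdivlMr ?mulr_gt0 ?ltr0n// => sl /eqP.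
apply/negP; rewrite gt_eqF//; apply: cos_gt0_pihalf.
have fs0 : 0 <= freq l (k i) i * s.
  by rewrite mulr_ge0 ?(ltW s0)// divr_ge0 ?(ltW (l0 i))// mulr_ge0// pi_ge0.
rewrite (lt_le_trans _ fs0) ?oppr_lt0 ?divr_gt0 ?pi_gt0//=.
rewrite /freq mulrAC ltr_pdivrMr//.
move: sl; rewrite -[(k i).+1%:R]natr1; move: ((k i)%:R : R) => K; rewrite -subr_gt0 => sl.
have := mulr_gt0 (pi_gt0 R) sl; have := mulr_gt0 (pi_gt0 R) s0.
by move: (@pi R) => p; lra.
Qed.

Lemma sin_fun_neq0_ae : ~ {ae mu, forall x, B x -> sin_fun a Q l x = 0}.
Proof.
apply: (@mode_neq0_ae _ l) => [i|i s /andP[s0 sl] /eqP]; first by rewrite l0 lexx.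
apply/negP; rewrite gt_eqF// /sin_mode; apply: sin_gt0_pi.
rewrite /freq mul1r mulr_gt0 ?divr_gt0 ?pi_gt0//=.
by rewrite mulrAC ltr_pdivrMr// ltr_pM2l// pi_gt0.
Qed.

End rectangle_spectrum.

Section rectangle_counting.
Context {R : realType} {n : nat}.
Variables (a : 'rV[R]_n) (Q : 'M[R]_n) (l : 'I_n -> R).
Hypothesis QQ : Q *m Q^T = 1%:M.
Hypothesis l0 : forall i, 0 < l i.
Local Notation mu := (lebesgue_rV R n).
Local Notation B := (rectangle a Q l).
Local Notation C := (cos_fun a Q l).
Local Notation lam := (laplace_eigenvalue l).

Let mB : measurable B := measurable_rectangle a l QQ.
Let finB : (mu B < +oo)%E := lebesgue_rectangle_lty a QQ l0.

Let sC k : sq_integrable B (C k).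
Proof. by apply: (tensor_sqint a QQ l0) => i; apply: smooth_continuous; exact: smooth_cos_mode. Qed.

Lemma grad_innerC (g h : 'I_n -> 'rV[R]_n -> R) : grad_inner B g h = grad_inner B h g.
Proof. by apply: eq_bigr => i _; exact: innerC. Qed.

Lemma eigenspace_cos_fun t (f : 'rV[R]_n -> R) k : Defs.eigenspace B (H1 B) t f ->
  lam k <> t -> inner B f (C k) = 0.
Proof.
move=> [g H1f fg] kt; have := fg _ _ (cos_fun_H1 a QQ l0 k).
rewrite grad_innerC (cos_fun_eigen QQ l0 k H1f) innerC => /eqP.
by rewrite -subr_eq0 -mulrBl mulf_eq0 subr_eq0 => /orP[/eqP//|/eqP].
Qed.

(** With more eigenfunctions than modes of eigenvalue [t], the matrix of their pairings has a
    nonzero row in its left kernel. The corresponding combination is orthogonal to the modes of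
    eigenvalue [t] by this choice and to all others by [eigenspace_cos_fun], so completeness makes
    it vanish, against independence. *)
Lemma neumann_multiplicity_le (D : finType) (kap : D -> 'I_n -> nat) t :
  (forall k, lam k = t -> exists d, kap d = k) ->
  (multiplicity B (H1 B) t <= #|[pred d | lam (kap d) == t]|%:R%:E)%E.
Proof.
move=> kapt; apply: ge_ereal_sup => _ [m [f fE fi] <-].
rewrite lee_fin ler_nat leqNgt; apply/negP => mP.
set P := [pred d | _] in mP.
pose A : 'M[R]_(m, #|P|) := \matrix_(j, d) inner B (f j) (C (kap (enum_val d))).
have : kermx A != 0.
  by rewrite -mxrank_eq0 mxrank_ker subn_eq0 -ltnNge (leq_ltn_trans (rank_leq_col _)).
case/rowV0Pn => c /sub_kermxP cA; case/negP.
have sf j : sq_integrable B (f j) by have [g [sf _ _] _] := fE j.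
pose u x := \sum_j c 0 j * f j x.
have su : sq_integrable B u by exact: (sqint_lincomb mB finB).
suff u0 : {ae mu, forall x, B x -> u x = 0}.
  by apply/eqP/rowP => j; rewrite mxE; exact: fi u0 j.
apply: (cos_fun_complete QQ l0 su) => k; rewrite (inner_lincombl mB)//.
have [kt|kt] := pselect (lam k = t); last first.
  by rewrite big1// => j _; rewrite (eigenspace_cos_fun (fE j) kt) mulr0.
have [d dk] := kapt _ kt; have dP : d \in P by rewrite inE dk kt.
have /rowP/(_ (enum_rank_in dP d)) := cA; rewrite !mxE => e; rewrite -[RHS]e.
by apply: eq_bigr => j _; rewrite mxE enum_rankK_in// dk.
Qed.

Lemma neumann_multiplicity_ge (D : finType) (kap : D -> 'I_n -> nat) t :
  injective kap ->
  (#|[pred d | lam (kap d) == t]|%:R%:E <= multiplicity B (H1 B) t)%E.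
Proof.
move=> inj; set P := [pred d | _]; apply: le_ereal_sup_tmp; exists #|P|%:R%:E => //.
exists #|P| => //; exists (fun j => C (kap (enum_val j))).
  move=> j; have := enum_valP j; rewrite inE => /eqP <-.
  exact: (cos_fun_eigenspace a QQ l0).
move=> c c0 j.
pose u x := \sum_i c i * C (kap (enum_val i)) x.
have su : sq_integrable B u by exact: (sqint_lincomb mB finB).
have : inner B u (C (kap (enum_val j))) = 0.
  have sj := sC (kap (enum_val j)).
  rewrite /inner /Rintegral (ae_eq_integral (cst 0%E))//.
  - by rewrite integral0.
  - by apply/measurable_EFinP; apply: measurable_funM; [case: su|case: sj].
  - by apply: filterS c0 => x + Bx => /(_ Bx); rewrite -/(u x) => ->; rewrite mul0r.
rewrite (inner_lincombl mB)// (bigD1 j)//= big1 ?addr0; last first.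
  move=> i ij; rewrite cos_fun_orthogonal ?mulr0//.
  by move=> /inj /enum_val_inj /eqP; rewrite (negPf ij).
move=> /eqP; rewrite mulf_eq0 => /orP[/eqP//|/eqP C0]; exfalso.
exact: (cos_fun_neq0_ae QQ l0 (sqint_eq0_ae mB (sC _) C0)).
Qed.

Lemma neumann_count_le (D : finType) (kap : D -> 'I_n -> nat) t :
  (forall k, lam k <= t -> exists d, kap d = k) ->
  (eigenvalue_count B (H1 B) t <= #|D|%:R%:E)%E.
Proof.
move=> kapt; apply: (@le_trans _ _
    (\esum_(s in [set s | (s <= t)%R]) #|[pred d | lam (kap d) == s]|%:R%:E)%E).
  apply: le_esum => s /= st; apply: neumann_multiplicity_le => k ks.
  by apply: kapt; rewrite ks.
by rewrite (esum_card_fibers (fun d => lam (kap d))) lee_fin ler_nat max_card.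
Qed.

Lemma neumann_count_ge (D : finType) (kap : D -> 'I_n -> nat) t :
  injective kap -> (forall d, lam (kap d) <= t) ->
  (#|D|%:R%:E <= eigenvalue_count B (H1 B) t)%E.
Proof.
move=> inj kapt; apply: (@le_trans _ _
    (\esum_(s in [set s | (s <= t)%R]) #|[pred d | lam (kap d) == s]|%:R%:E)%E).
  rewrite (esum_card_fibers (fun d => lam (kap d))) lee_fin ler_nat.
  apply: subset_leq_card; apply/fintype.subsetP => d _; rewrite !inE/=; exact: kapt.
by apply: le_esum => s _; exact: neumann_multiplicity_ge.
Qed.

Lemma dirichlet_eigenvalue_le :
  (dirichlet_eigenvalue B 1 <= (lam (fun=> 1%N))%:E)%E.
Proof.
apply: nth_eigenvalue_le; apply: le_trans (multiplicity_le_count _ _ _).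
apply: le_ereal_sup_tmp; exists 1%:R%:E => //; exists 1%N => //.
exists (fun=> sin_fun a Q l) => [_|c c0 j]; first exact: sin_fun_eigenspace.
rewrite [j]ord1; apply/eqP/negPn/negP => cj.
apply: (sin_fun_neq0_ae (a := a) QQ l0); apply: filterS c0 => x + Bx => /(_ Bx).
by rewrite big_ord1 => /eqP; rewrite mulf_eq0 (negPf cj) => /eqP.
Qed.

Lemma poincare_H10 (u : 'rV[R]_n -> R) g i : H10 B u g ->
  inner B u u <= 16 * l i ^+ 2 * grad_inner B g g.
Proof.
move=> [[su sg _] [phi [tphi cu cg]]].
have sphi m : sq_integrable B (phi m).
  exact: (bounded_mfun_sqint mB finB (test_function_bounded mB (tphi m))).
have sdphi m j : sq_integrable B (partial j (phi m)).
  exact: (bounded_mfun_sqint mB finB (partial_test_function_bounded mB j (tphi m))).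
have L1 := cvg_inner_self mB sphi su cu.
have L2 : 16 * l i ^+ 2 * grad_inner B (fun j => partial j (phi m)) (fun j => partial j (phi m))
    @[m --> \oo] --> 16 * l i ^+ 2 * grad_inner B g g.
  apply: cvgM; first exact: cvg_cst.
  rewrite /grad_inner; elim: (index_enum _) => [|j r ih].
    by rewrite big_nil; under eq_cvg do rewrite big_nil; exact: cvg_cst.
  rewrite big_cons; under eq_cvg do rewrite big_cons.
  by apply: cvgD => //; exact: (cvg_inner_self mB (sdphi ^~ j) (sg j) (cg j)).
rewrite -(cvg_lim (@norm_hausdorff _ _) L1) -(cvg_lim (@norm_hausdorff _ _) L2).
apply: ler_lim; [by apply/cvg_ex; eexists; exact: L1|by apply/cvg_ex; eexists; exact: L2|].
by apply: nearW => m; exact: (poincare_test QQ l0).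
Qed.

Lemma dirichlet_eigenvalue_ge i :
  ((16 * l i ^+ 2)^-1%:E <= dirichlet_eigenvalue B 1)%E.
Proof.
apply: first_eigenvalue_ge => s sl; apply/eqP; rewrite eq_le multiplicity_ge0 andbT.
apply: ge_ereal_sup => _ [m [f fE fi] <-]; case: m f fE fi => [//|m] f fE fi.
exfalso; have [g Hg fg] := fE ord0; have [[sf _ _] _] := Hg.
have e := fg _ _ Hg; have := poincare_H10 i Hg; rewrite e mulrA.
have f0 : 0 < inner B (f ord0) (f ord0).
  rewrite lt_neqAle inner_ge0 andbT; apply/eqP => /esym h.
  exact: (lin_indep_ae_neq0 (j := ord0) fi (sqint_eq0_ae mB sf h)).
rewrite -subr_ge0 -[X in _ - X]mul1r -mulrBl pmulr_lge0// subr_ge0.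
have c0 : 0 < 16 * l i ^+ 2 by rewrite mulr_gt0 ?exprn_gt0.
by rewrite leNgt mulrC -ltr_pdivlMr// mul1r sl.
Qed.

(** [D] stands for lattice points below a lower bound for the first Dirichlet eigenvalue, [D'] for a
    family containing all those up to twice an upper bound. *)
Lemma neumann_count_bounds (D D' : finType) (kap : D -> 'I_n -> nat)
    (kap' : D' -> 'I_n -> nat) i :
  injective kap -> (forall d, lam (kap d) <= (16 * l i ^+ 2)^-1) ->
  (forall k, lam k <= 2 * lam (fun=> 1%N) -> exists d, kap' d = k) ->
  0 < lam (fun=> 1%N) ->
  (#|D|%:R%:E <= neumann_count B)%E /\ (neumann_count B <= #|D'|%:R%:E)%E.
Proof.
move=> inj kapl kap'P L0; split.
  apply: counting_ge => k /andP[k0 kD]; split=> //.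
  apply: le_trans (dirichlet_eigenvalue_ge i); apply: nth_eigenvalue_le.
  apply: le_trans (neumann_count_ge inj kapl); by rewrite lee_fin ler_nat.
apply: counting_le => k [k0 kl]; rewrite k0/= -(ler_nat R) -lee_fin.
apply: le_trans (neumann_count_le kap'P).
(* The factor 2 supplies the strict inequality between levels. *)
apply: (nth_eigenvalue_le_count (s := lam (fun=> 1%N))).
  by rewrite ltr_pMl// ltr1n.
exact: le_trans kl dirichlet_eigenvalue_le.
Qed.

End rectangle_counting.

(** * Hausdorff measure of the boundary *)

Section hausdorff.
Context {R : realType} {n : nat}.
Implicit Types (A U : set 'rV[R]_n).

Lemma diam_le A (d : R) :
  (forall x y, A x -> A y -> eucl_norm (x - y) <= d) -> (Defs.diam A <= d%:E)%E.
Proof.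
by move=> Ad; apply: ge_ereal_sup => _ [[x y] [/= Ax Ay] <-]; rewrite lee_fin Ad.
Qed.

Lemma eucl_norm_le_diam A x y : A x -> A y -> ((eucl_norm (x - y))%:E <= Defs.diam A)%E.
Proof. by move=> Ax Ay; apply: ereal_sup_ubound; exists (x, y). Qed.

Lemma hausdorff_gaugeE m (w : R) U (d : R) : unit_ball_volume R m = w%:E ->
  U !=set0 -> (Defs.diam U <= d%:E)%E ->
  exists d', [/\ 0 <= d' <= d, Defs.diam U = d'%:E &
    hausdorff_gauge m U = (w * (d' / 2) ^+ m)%:E].
Proof.
move=> wE [x Ux] Ud; have d0 : (0 <= Defs.diam U)%E.
  by apply: le_trans (eucl_norm_le_diam Ux Ux); rewrite lee_fin sqrtr_ge0.
have fd : Defs.diam U \is a fin_num by rewrite ge0_fin_numE// (le_lt_trans Ud) ?ltry.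
exists (fine (Defs.diam U)); split; last 2 first.
- by rewrite fineK.
- rewrite /hausdorff_gauge ifF; last by apply/negP => /eqP U0; rewrite U0 in Ux.
  by rewrite wE -(fineK fd) -EFinM -EFin_expe -EFinM/= [_^-1 * _]mulrC.
by rewrite fine_ge0//= -lee_fin fineK.
Qed.

Lemma hausdorff_gauge_ge0 m U : (0 <= hausdorff_gauge m U)%E.
Proof.
rewrite /hausdorff_gauge; case: ifPn => // /set0P[x Ux].
have [w w0 ->] := unit_ball_volume_pos (R := R) m.
apply: mule_ge0; first by rewrite lee_fin ltW.
apply: expe_ge0; apply: mule_ge0; first by rewrite lee_fin.
by apply: le_trans (eucl_norm_le_diam Ux Ux); rewrite lee_fin sqrtr_ge0.
Qed.

(** Contents are defined by sequences, so the finite cover is padded with empty sets: their gauge is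
    0 by definition and their diameter, a supremum over nothing, is [-oo]. *)
Lemma hausdorff_content_finite (I : finType) (U : I -> set 'rV[R]_n) m (delta : R) A :
  A `<=` \bigcup_i U i -> (forall i, Defs.diam (U i) <= delta%:E)%E ->
  (hausdorff_content m delta A <= \sum_i hausdorff_gauge m (U i))%E.
Proof.
move=> AU Ud; pose V k := nth set0 [seq U i | i <- enum I] k.
apply: ereal_inf_lbound; exists V.
  split=> [x /AU[i _ Ui]|k].
    exists (index i (enum I)) => //.
    by rewrite /V (nth_map i) ?nth_index ?mem_enum// index_mem mem_enum.
  rewrite /V; have [kI|kI] := ltnP k (size [seq U i | i <- enum I]).
    by have /mapP[i _ ->] := mem_nth set0 kI.
  by rewrite nth_default// /Defs.diam set0X image_set0 ereal_sup0 leNye.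
rewrite (nneseries_split 0 #|I|)//; last by move=> k _; exact: hausdorff_gauge_ge0.
rewrite add0n eseries0 ?adde0; last first.
  move=> k kI _; rewrite /V nth_default; first by rewrite /hausdorff_gauge eqxx.
  by rewrite size_map -cardE.
rewrite (_ : (\sum_i _)%E = (\sum_(i <- enum I) hausdorff_gauge m (U i))%E); last by rewrite big_enum.
by rewrite -(big_map U xpredT (hausdorff_gauge m)) [RHS](big_nth set0) size_map [in LHS]cardE.
Qed.

End hausdorff.

Section rectangle_boundary.
Context {R : realType} {m : nat}.
Variables (a : 'rV[R]_m.+1) (Q : 'M[R]_m.+1) (l : 'I_m.+1 -> R).
Hypothesis QQ : Q *m Q^T = 1%:M.
Hypothesis l0 : forall i, 0 < l i.
Local Notation B := (rectangle a Q l).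
Local Notation y := (bcoord a Q).
Implicit Types (x z : 'rV[R]_m.+1).

Lemma eucl_norm_bcoord x z :
  eucl_norm (x - z) = eucl_norm (\row_i (y i x - y i z)).
Proof.
rewrite -(eucl_norm_mulmx (Q := Q^T)) ?trmxK ?trmx_orthonormal//.
congr eucl_norm; apply/rowP => i; rewrite [RHS]mxE /bcoord.
have -> : x - z = (x - a) - (z - a) by rewrite opprB subrKA.
by rewrite mulmxBl !mxE.
Qed.

Lemma boundary_rectangle x : Defs.boundary B x ->
  (exists i, y i x = 0 \/ y i x = l i) /\ forall i, 0 <= y i x <= l i.
Proof.
rewrite /Defs.boundary; have /interior_id -> := open_rectangle (a := a) (l := l) QQ.
move=> [clx nBx]; have yl i : 0 <= y i x <= l i.
  have c : closed (y i @^-1` `[0, l i]).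
    by apply: closed_comp => [z _|]; [exact: continuous_bcoord|exact: interval_closed].
  suff : (y i @^-1` `[0, l i]) x by rewrite /= in_itv.
  rewrite ((closure_id _).1 c); apply: closure_subset clx => z /(rectangleP a l QQ) zl.
  by rewrite /= in_itv/=; have /andP[/ltW -> /ltW ->] := zl i.
split=> //; apply: contrapT => /forallNP H; apply: nBx; apply/(rectangleP a l QQ) => i.
have /not_orP[/eqP y0 /eqP yl'] := H i; have /andP[h1 h2] := yl i.
by rewrite !lt_neqAle h1 h2 yl' eq_sym y0.
Qed.

(** Moving from [x] along row i of [Q] enters the open box at once, while [x] itself has
    [y i x = 0]. *)
Lemma face_boundary i x : y i x = 0 -> (forall j, 0 < y (lift i j) x < l (lift i j)) ->
  Defs.boundary B x.
Proof.
move=> yi0 yl; split; last first.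
  by move/interior_subset/(rectangleP a l QQ)/(_ i); rewrite yi0 ltxx.
move=> V Vx; pose f (t : R) : 'rV[R]_m.+1 := t *: row i Q + x.
have cf : f t @[t --> 0^'+] --> f 0.
  apply: cvg_at_right_filter; apply: cvgD; last exact: cvg_cst.
  by apply: cvgZl; exact: cvg_id.
rewrite {2}/f scale0r add0r in cf.
have near1 : \forall t \near 0^'+, V (f t) := cf V Vx.
near (0 : R)^'+ => t.
have t0 : 0 < t by near: t; exact: nbhs_right_gt.
have tl : t < l i by near: t; exact: nbhs_right_lt.
have Vt : V (f t) by near: t.
exists (f t); split=> //; apply/(rectangleP a l QQ) => j.
have -> : y j (f t) = t * (i == j)%:R + y j x.
  by rewrite bcoord_line -row_mul QQ !mxE.
case: (unliftP i j) => [k ->|->]; last by rewrite eqxx yi0 mulr1 addr0 t0 tl.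
by rewrite (negPf (neq_lift _ _)) mulr0 add0r yl.
Unshelve. all: by end_near. Qed.

End rectangle_boundary.

Lemma card_dffun_prod (I : finType) (T : I -> finType) :
  #|{dffun forall i, T i}| = (\prod_i #|T i|)%N.
Proof. by rewrite card_dep_ffun foldrE big_image. Qed.

Section hausdorff_rectangle.
Context {R : realType} {m : nat}.
Variables (a : 'rV[R]_m.+1) (Q : 'M[R]_m.+1) (l : 'I_m.+1 -> R).
Hypothesis QQ : Q *m Q^T = 1%:M.
Hypothesis l0 : forall i, 0 < l i.
Local Notation B := (rectangle a Q l).
Local Notation y := (bcoord a Q).
Variables (w : R) (w0 : 0 < w) (wE : unit_ball_volume R m = w%:E).

Lemma hausdorff_boundary_le :
  (hausdorff_measure m (Defs.boundary B) <=
    (2 * w * m.+1%:R ^+ m * \sum_(i < m.+1) \prod_(j < m) l (lift i j))%:E)%E.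
Proof.
apply: ge_ereal_sup => _ [delta /= d0 <-].
(* The cell side is at most [delta / (m + 1)] to make diameters admissible, and at most every [l i]
   so that a side needs no more than [2 * l i / eta] cells. The powers of [eta] then cancel against
   the gauges. *)
pose eta := \big[Num.min/(delta / m.+1%:R)]_i l i.
have eta0 : 0 < eta by apply/bigmin_gtP; split=> //; rewrite divr_gt0.
have etal i : eta <= l i by exact: bigmin_le.
have etad : m.+1%:R * eta <= delta.
  by rewrite mulrC -ler_pdivlMr//; exact: bigmin_le_id.
pose M j := (Num.truncn (l j / eta)).+1.
pose F (i : 'I_m.+1) : finType := (bool * {dffun forall j : 'I_m, 'I_(M (lift i j))})%type.
pose J : finType := {i : 'I_m.+1 & F i}.
(* An index consists of the direction orthogonal to a facet, the choice between its two facets, and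
   a cell of the grid on that facet. *)
pose U (c : J) := [set x | y (tag c) x = (if (tagged c).1 then l (tag c) else 0) /\
  forall j, ((tagged c).2 j)%:R * eta <= y (lift (tag c) j) x
             <= ((tagged c).2 j).+1%:R * eta].
have Ud c : (Defs.diam (U c) <= (m.+1%:R * eta)%:E)%E.
  apply: diam_le => x z [xb xk] [zb zk]; rewrite (eucl_norm_bcoord a QQ).
  apply: eucl_norm_le => [|j]; first exact: ltW.
  rewrite mxE; case: (unliftP (tag c) j) => [k ->|->]; last first.
    by rewrite xb zb subrr normr0 ltW.
  have := xk k; have := zk k; rewrite -natr1 !mulrDl mul1r ler_norml.
  by move=> /andP[? ?] /andP[? ?]; apply/andP; split; lra.
have cover : Defs.boundary B `<=` \bigcup_c U c.
  move=> x /(boundary_rectangle QQ)[[i yi] yl].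
  have kM (j : 'I_m) : (Num.truncn (y (lift i j) x / eta) < M (lift i j))%N.
    rewrite ltnS; apply: le_truncn; rewrite ler_pM2r ?invr_gt0//.
    by have /andP[] := yl (lift i j).
  have kb (j : 'I_m) : (Num.truncn (y (lift i j) x / eta))%:R * eta <= y (lift i j) x
       <= (Num.truncn (y (lift i j) x / eta)).+1%:R * eta.
    have /andP[y0 _] := yl (lift i j).
    have /truncn_itv/andP[h1 h2] : 0 <= y (lift i j) x / eta by rewrite divr_ge0// ltW.
    by rewrite -ler_pdivlMr// h1 -ler_pdivrMr// ltW.
  have [b yb] : exists b : bool, y i x = if b then l i else 0.
    by case: yi => ?; [exists false|exists true].
  exists (Tagged F (b, finfun (fun j : 'I_m => Ordinal (kM j)))) => //=.
  by split=> //= j; rewrite ffunE; exact: kb.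
apply: (le_trans (hausdorff_content_finite (U := U) m (delta := delta) cover _)).
  by move=> c; apply: le_trans (Ud c) _; rewrite lee_fin.
pose K := w * (m.+1%:R * eta / 2) ^+ m.
apply: (@le_trans _ _ (\sum_(c : J) K%:E)%E).
  apply: lee_sum => c _; have [U0|/set0P U0] := eqVneq (U c) set0.
    by rewrite /hausdorff_gauge U0 eqxx lee_fin mulr_ge0 ?exprn_ge0 ?divr_ge0 ?mulr_ge0 ?ltW.
  have [d [/andP[d00 dm] _ ->]] := hausdorff_gaugeE wE U0 (Ud c).
  rewrite lee_fin ler_pM2l// lerXn2r ?nnegrE ?divr_ge0 ?mulr_ge0 ?(ltW eta0)//.
  by rewrite ler_pM2r.
rewrite sumEFin lee_fin sumr_const.
have -> : #|J| = (\sum_(i < m.+1) (2 * \prod_(j < m) M (lift i j)))%N.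
  rewrite card_tagged sumnE big_map big_enum; apply: eq_bigr => i _.
  rewrite card_prod card_bool card_dffun_prod; congr (_ * _)%N.
  by apply: eq_bigr => j _; rewrite card_ord.
rewrite -(mulr_natr K) natr_sum !mulr_sumr; apply: ler_sum => i _.
rewrite natrM natr_prod.
have Ml : \prod_(j < m) (M (lift i j))%:R <= (2 / eta) ^+ m * \prod_(j < m) l (lift i j).
  rewrite -[X in _ ^+ X]card_ord -prodr_const -big_split/=.
  apply: ler_prod => j _; rewrite ler0n/=.
  have t1 : 1 <= l (lift i j) / eta by rewrite ler_pdivlMr// mul1r.
  have /truncn_itv/andP[h1 _] : 0 <= l (lift i j) / eta by apply: le_trans t1.
  rewrite /M -natr1; have -> : 2 / eta * l (lift i j) = 2 * (l (lift i j) / eta) by ring.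
  by move: h1 t1; set t := _ / _; set k := _%:R => h1 t1; lra.
apply: (@le_trans _ _ (K * (2 * ((2 / eta) ^+ m * \prod_(j < m) l (lift i j))))).
  apply: ler_wpM2l; last exact: ler_wpM2l.
  by rewrite mulr_ge0 ?exprn_ge0 ?divr_ge0 ?mulr_ge0 ?(ltW eta0) ?(ltW w0).
have -> : m.+1%:R = (m.+1%:R * eta / 2) * (2 / eta) :> R.
  by field; rewrite gt_eqF.
by rewrite (exprMn m (_ / 2)) /K le_eqVlt; apply/orP; left; apply/eqP; ring.
Qed.

(** A covering set of diameter d projects into a cube of side [2 * d]. Its gauge [w * (d / 2) ^+ m]
    is [w / 4 ^+ m] times the volume of that cube, and the cubes cover the projected facet. *)
Lemma hausdorff_boundary_ge (i : 'I_m.+1) :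
  ((w / 4 ^+ m * \prod_(j < m) l (lift i j))%:E <=
    hausdorff_measure m (Defs.boundary B))%E.
Proof.
(* One admissible [delta] bounds the supremum from below; fixing it to 1 makes all diameters
   finite. *)
apply: (@le_trans _ _ (hausdorff_content m 1 (Defs.boundary B))); last first.
  by apply: ereal_sup_ubound; exists 1 => //=.
apply: le_ereal_inf_tmp => _ [U [cover Ud] <-].
pose p x : 'rV[R]_m := \row_j y (lift i j) x.
have c0 : 0 <= w / 4 ^+ m by rewrite divr_ge0 ?exprn_ge0// ltW.
have /choice[V VP] : forall k, exists V : set 'rV[R]_m, [/\ measurable V,
    forall x, U k x -> V (p x) &
    ((w / 4 ^+ m)%:E * lebesgue_rV R m V <= hausdorff_gauge m (U k))%E].
  move=> k; have [U0|/set0P U0] := eqVneq (U k) set0.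
    by exists set0; rewrite U0 measure0 mule0; split=> //; exact: hausdorff_gauge_ge0.
  have [d [/andP[d0 d1] dE gE]] := hausdorff_gaugeE wE U0 (Ud k).
  have [x0 Ux0] := U0.
  exists [set z | forall j, z 0 j \in `[p x0 0 j - d, p x0 0 j + d]]; split.
  - exact: measurable_cube.
  - move=> x Ux j; rewrite in_itv/= -ler_distl !mxE.
    have := abs_coord_eucl_norm (\row_i (y i x - y i x0)) (lift i j).
    rewrite mxE -(eucl_norm_bcoord a QQ) => /le_trans; apply.
    by rewrite -lee_fin -dE; exact: eucl_norm_le_diam.
  - rewrite (lebesgue_rV_cube (p x0 0) d0) gE -EFinM lee_fin le_eqVlt.
    apply/orP; left; apply/eqP; rewrite -mulrA -exprVn -exprMn; congr (_ * _ ^+ _).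
    by field.
pose E := [set z : 'rV[R]_m | forall j, `]0, l (lift i j)[%classic (z 0 j)].
have mE : measurable E.
  rewrite (_ : E = \bigcap_(j in [set: 'I_m])
      ((fun z : 'rV[R]_m => z 0 j : measurableTypeR R) @^-1` `]0, l (lift i j)[)).
    apply: fin_bigcap_measurable => // j _.
    by rewrite -[X in measurable X]setTI; exact: measurable_coord.
  by apply/seteqP; split => [z H j _|z H j]; exact: H.
have EE : lebesgue_rV R m E = (\prod_(j < m) l (lift i j))%:E.
  apply: (lebesgue_rV_box (S := fun j => `]0, l (lift i j)[%classic)) => // j.
  by rewrite lebesgue_measure_itv/= lte_fin l0 oppr0 adde0.
have EV : E `<=` \bigcup_k V k.
  (* [z'] lifts a point of the projection back to the facet by inserting 0 as i-th coordinate. *)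
  move=> z Ez; pose z' : 'rV[R]_m.+1 := \row_j if unlift i j is Some k then z 0 k else 0.
  have yz j : y j (a + z' *m Q) = z' 0 j.
    by rewrite /bcoord addrAC subrr add0r -mulmxA QQ mulmx1.
  have /cover[k _ Uk] : Defs.boundary B (a + z' *m Q).
    apply: (face_boundary QQ l0 (i := i)) => [|j]; rewrite yz mxE ?unlift_none ?liftK//.
    by have := Ez j; rewrite /= in_itv.
  exists k => //; have [_ /(_ _ Uk) + _] := VP k.
  by congr (V k _); apply/rowP => j; rewrite mxE yz mxE liftK.
rewrite EFinM -EE; apply: (@le_trans _ _
    ((w / 4 ^+ m)%:E * \sum_(k <oo) lebesgue_rV R m (V k))%E).
  apply: lee_wpmul2l; first by rewrite lee_fin.
  by apply: measure_sigma_subadditive => // k; have [] := VP k.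
rewrite -nneseriesZl//; apply: lee_nneseries => [k _ _|k _].
  by rewrite mule_ge0.
by have [] := VP k.
Qed.

End hausdorff_rectangle.

(** * The isoperimetric ratio *)

Section isoperimetric.
Context {R : realType}.

(** The facet orthogonal to edge i has area [p / l i], and these areas add up to [p * S]. The lower
    bound is obtained for each facet separately and averaged, whence the divisor [m + 1] in [c].
    Raising to the power [m + 1] and dividing by [p ^+ m] leaves [p * S ^+ m.+1]. *)
Lemma isoperimetric_ratio_bounds m : exists c C : R, [/\ 0 < c, 0 < C &
  forall (a : 'rV[R]_m.+1) Q (l : 'I_m.+1 -> R),
  Q *m Q^T = 1%:M -> (forall i, 0 < l i) ->
  exists2 I : R, isoperimetric_ratio (rectangle a Q l) = I%:E &
    c * (\prod_i l i * (\sum_i (l i)^-1) ^+ m.+1) <= I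
      <= C * (\prod_i l i * (\sum_i (l i)^-1) ^+ m.+1)].
Proof.
have [w w0 wE] := unit_ball_volume_pos (R := R) m.
pose c := w / 4 ^+ m / m.+1%:R; pose C := 2 * w * m.+1%:R ^+ m.
have c0 : 0 < c by rewrite !divr_gt0 ?exprn_gt0.
have C0 : 0 < C by rewrite !mulr_gt0 ?exprn_gt0.
exists (c ^+ m.+1), (C ^+ m.+1); split; [exact: exprn_gt0|exact: exprn_gt0|].
move=> a Q l QQ l0; set p := \prod_i l i; set S := \sum_i (l i)^-1.
have p0 : 0 < p by exact: prodr_gt0.
have S0 : 0 <= S by apply: sumr_ge0 => i _; rewrite invr_ge0 ltW.
set H := hausdorff_measure m (Defs.boundary (rectangle a Q l)).
have facet (i : 'I_m.+1) : \prod_(j < m) l (lift i j) = p / l i.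
  by rewrite /p (bigD1_ord i)//= mulrAC divff ?mul1r// gt_eqF.
have Hle : (H <= (C * (p * S))%:E)%E.
  have := hausdorff_boundary_le a QQ l0 w0 wE; rewrite -/H -/C.
  by under eq_bigr do rewrite facet; rewrite -mulr_sumr.
have Hge i : ((w / 4 ^+ m * (p / l i))%:E <= H)%E.
  by rewrite -facet; exact: hausdorff_boundary_ge.
have H0 : (0 <= H)%E.
  apply: le_trans (Hge ord0).
  by rewrite lee_fin mulr_ge0 ?divr_ge0 ?exprn_ge0// ltW.
have fH : H \is a fin_num by rewrite ge0_fin_numE// (le_lt_trans Hle) ?ltry.
have [h hE] : exists h, H = h%:E by exists (fine H); rewrite fineK.
rewrite hE in Hle H0; rewrite !lee_fin in Hle H0.
have {}Hge : c * (p * S) <= h.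
  have : \sum_(i < m.+1) (w / 4 ^+ m * (p / l i)) <= \sum_(i < m.+1) h.
    by apply: ler_sum => i _; have := Hge i; rewrite hE lee_fin.
  rewrite sumr_const card_ord -mulr_sumr -mulr_sumr -(mulr_natr h).
  by rewrite -ler_pdivrMr// /c mulrAC.
exists (h ^+ m.+1 / p ^+ m).
  rewrite /isoperimetric_ratio -[m.+1.-1]/m -/H hE (lebesgue_rectangle a QQ l0) -!EFin_expe.
  by rewrite inver gt_eqF ?exprn_gt0// -EFinM.
have key d : d ^+ m.+1 * (p * S ^+ m.+1) = (d * (p * S)) ^+ m.+1 / p ^+ m.
  by rewrite !exprMn [p ^+ m.+1]exprS; field; rewrite expf_neq0// gt_eqF.
have pS : 0 <= p * S by rewrite mulr_ge0// ltW.
rewrite !key !ler_pM2r ?invr_gt0 ?exprn_gt0//.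
by rewrite !lerXn2r ?nnegrE// mulr_ge0// ltW.
Qed.

End isoperimetric.

(** * Counting lattice points and comparing constants *)

Section rectangle_neumann_count.
Context {R : realType} {m : nat}.
Variables (a : 'rV[R]_m.+1) (Q : 'M[R]_m.+1) (l : 'I_m.+1 -> R).
Hypothesis QQ : Q *m Q^T = 1%:M.
Hypothesis l0 : forall i, 0 < l i.
Local Notation B := (rectangle a Q l).
Local Notation p := (\prod_i l i).
Local Notation S := (\sum_i (l i)^-1).
Local Notation n := m.+1.

Let box (M : 'I_n -> nat) : finType := {dffun forall j : 'I_n, 'I_(M j).+1}.

Let card_box M : #|box M|%:R = \prod_j (M j).+1%:R :> R.
Proof.
rewrite card_dffun_prod natr_prod; apply: eq_bigr => j _; by rewrite card_ord.
Qed.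

Let sumV_ge i : (l i)^-1 <= S.
Proof. by rewrite (bigD1 i)//= lerDl sumr_ge0// => j _; rewrite invr_ge0 ltW. Qed.

Lemma rectangle_neumann_count :
  ((p * S ^+ n / (16 * n%:R ^+ 2) ^+ n)%:E <= neumann_count B)%E /\
  (neumann_count B <= (3 ^+ n * (p * S ^+ n))%:E)%E.
Proof.
have [i il] : exists i, forall j, l i <= l j.
  by case: (@arg_minP _ _ _ (ord0 : 'I_n) xpredT l) => // i _ il; exists i => j; exact: il.
pose t := (l i)^-1; have t0 : 0 < t by rewrite invr_gt0.
have Sle : S <= n%:R * t.
  rewrite mulr_natl -[X in _ *+ X]card_ord -sumr_const; apply: ler_sum => j _.
  by rewrite lef_pV2 ?posrE.
have S0 : 0 < S by apply: lt_le_trans (sumV_ge i).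
have n0 : 0 < n%:R :> R by [].
have pi4 : pi <= 4 :> R by have := @pihalf_lt2 R; lra.
(* For [k j <= M j] the bound [pi <= 4] keeps each frequency below [t / (4 * n)]. The n squares then
   sum to at most [t ^+ 2 / 16], the lower Dirichlet bound for the shortest side. *)
pose M j := Num.truncn (l j * t / (16 * n%:R)).
(* An eigenvalue at most [2 * lam (1, .., 1)] forces [(k j / l j) ^+ 2 <= 2 * S ^+ 2], hence
   [k j <= 2 * l j * S]. *)
pose M' j := Num.truncn (2 * l j * S).
have inj : injective (fun (d : box M) (j : 'I_n) => val (d j)).
  move=> d d' dd; apply/ffunP => j; apply: val_inj.
  exact: (congr1 (fun f => f j) dd).
have low (d : box M) : laplace_eigenvalue l (fun j => val (d j)) <= (16 * l i ^+ 2)^-1.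
  have -> : (16 * l i ^+ 2)^-1 = \sum_(j < n) (t ^+ 2 / (16 * n%:R)) :> R.
    rewrite sumr_const card_ord -[RHS]mulr_natr invfM -exprVn -/t.
    by field; rewrite nat1r pnatr_eq0.
  apply: ler_sum => j _; apply: (@le_trans _ _ ((t / (4 * n%:R)) ^+ 2)).
    rewrite lerXn2r ?nnegrE ?divr_ge0 ?mulr_ge0 ?pi_ge0 ?(ltW (l0 _)) ?(ltW t0)//.
    have : (val (d j))%:R <= l j * t / (16 * n%:R) :> R.
      have := ltn_ord (d j); rewrite ltnS => dj.
      apply: le_trans (_ : (M j)%:R <= _); first by rewrite ler_nat.
      by rewrite truncn_le divr_ge0 ?mulr_ge0 ?(ltW (l0 _)) ?(ltW t0).
    move=> dj; rewrite ler_pdivrMr//.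
    apply: (le_trans (ler_pM _ _ dj pi4)); rewrite ?pi_ge0//.
    by rewrite le_eqVlt; apply/orP; left; apply/eqP; field; rewrite nat1r pnatr_eq0.
  rewrite expr_div_n ler_pM2l ?exprn_gt0// lef_pV2 ?posrE ?mulr_gt0 ?exprn_gt0//.
  have : 1 <= n%:R :> R by rewrite ler1n.
  by move=> n1; rewrite (_ : (4 * n%:R) ^+ 2 = 16 * (n%:R * n%:R)) ?ler_pM2l ?ler_peMr//; ring.
have up k : laplace_eigenvalue l k <= 2 * laplace_eigenvalue l (fun=> 1%N) ->
    exists d : box M', (fun j => val (d j)) = k.
  move=> lk; have kM j : (k j < (M' j).+1)%N.
    rewrite ltnS truncn_ge_nat ?mulr_ge0 ?(ltW S0) ?(ltW (l0 _))//.
    have pp : 0 < pi :> R := pi_gt0 R.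
    have h : (k j)%:R * pi / l j <= 2 * pi * S.
      rewrite -(@ler_pXn2r _ 2) ?nnegrE ?divr_ge0 ?mulr_ge0 ?(ltW S0) ?(ltW pp) ?(ltW (l0 _))//.
      apply: (@le_trans _ _ (laplace_eigenvalue l k)).
        by rewrite /laplace_eigenvalue (bigD1 j)//= lerDl sumr_ge0// => ? _; exact: sqr_ge0.
      apply: (le_trans lk).
      apply: (@le_trans _ _ (2 * (pi ^+ 2 * S ^+ 2))).
        rewrite ler_pM2l// [S ^+ 2]expr2 mulr_suml mulr_sumr.
        apply: ler_sum => q _.
        rewrite /freq mul1r expr_div_n ler_pM2l ?exprn_gt0// -exprVn expr2.
        by rewrite ler_pM2l ?invr_gt0.
      have : 0 <= pi ^+ 2 * S ^+ 2 by rewrite mulr_ge0 ?sqr_ge0.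
      by rewrite !exprMn; lra.
    move: h; rewrite ler_pdivrMr// => h; rewrite -(ler_pM2r pp); apply: (le_trans h).
    by rewrite le_eqVlt; apply/orP; left; apply/eqP; ring.
  by exists (finfun (fun j => Ordinal (kM j))); apply/funext => j; rewrite ffunE.
have pos : 0 < laplace_eigenvalue l (fun=> 1%N).
  rewrite /laplace_eigenvalue (bigD1 i)//= ltr_pwDl ?sumr_ge0// => [|? _]; last exact: sqr_ge0.
  by rewrite exprn_gt0// /freq mul1r divr_gt0// pi_gt0.
have [lo hi] := neumann_count_bounds a QQ l0 (i := i) inj low up pos.
split; [apply: le_trans lo|apply: (le_trans hi)]; rewrite lee_fin card_box.
  (* The index 0 is counted too, and [(M j).+1] exceeds the truncated real even when [M j] is 0, so
     the product bound holds for arbitrarily thin boxes. *)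
  apply: (@le_trans _ _ (\prod_j (l j * (t / (16 * n%:R))))).
    rewrite big_split/= prodr_const card_ord -mulrA -expr_div_n ler_pM2l ?prodr_gt0//.
    rewrite lerXn2r ?nnegrE ?divr_ge0 ?mulr_ge0 ?(ltW S0) ?(ltW t0)//.
    rewrite ler_pdivrMr ?mulr_gt0 ?exprn_gt0//; apply: (le_trans Sle).
    by rewrite le_eqVlt; apply/orP; left; apply/eqP; field; rewrite nat1r pnatr_eq0.
  apply: ler_prod => j _; rewrite !mulr_ge0 ?invr_ge0 ?mulr_ge0 ?(ltW t0) ?(ltW (l0 _))//=.
  by rewrite mulrA; apply/ltW/truncnS_gt.
apply: (@le_trans _ _ (\prod_j (3 * (l j * S)))).
  apply: ler_prod => j _; rewrite ler0n/= -natr1.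
  (* This absorbs the extra 1 of [(M' j).+1] and yields the factor 3 per direction. *)
  have h1 : 1 <= l j * S.
    by rewrite -(mulfV (lt0r_neq0 (l0 j))) ler_pM2l.
  have : (M' j)%:R <= 2 * l j * S.
    by rewrite truncn_le !mulr_ge0 ?(ltW S0) ?(ltW (l0 _)).
  by move: h1; rewrite -mulrA; set s := _ * S; set k := _%:R; lra.
by rewrite !big_split/= !prodr_const card_ord.
Qed.

End rectangle_neumann_count.

Theorem theorem2 (R : realType) (n : nat) (n_gt0 : (0 < n)%N) :
  exists c1 c2 : R, [/\ 0 < c1, 0 < c2 &
    forall (a : 'rV[R]_n) (Q : 'M[R]_n) (l : 'I_n -> R),
      Q *m Q^T = 1%:M -> (forall i, 0 < l i) ->
      let B := rectangle a Q l in
      (c1%:E * isoperimetric_ratio B <= neumann_count B)%E /\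
      (neumann_count B <= c2%:E * isoperimetric_ratio B)%E].
Proof.
case: n n_gt0 => // m _; have [c [C [c0 C0 iso]]] := isoperimetric_ratio_bounds (R := R) m.
pose K : R := (16 * m.+1%:R ^+ 2) ^+ m.+1.
have K0 : 0 < K by rewrite exprn_gt0// mulr_gt0// exprn_gt0.
exists (C * K)^-1, (3 ^+ m.+1 / c); split.
- by rewrite invr_gt0 mulr_gt0.
- by rewrite divr_gt0// exprn_gt0.
move=> a Q l QQ l0 B; have [I IE /andP[cI IC]] := iso a Q l QQ l0.
have [lo hi] := rectangle_neumann_count a QQ l0.
rewrite /B IE -!EFinM; split.
  apply: le_trans lo; rewrite lee_fin -/K ler_pdivlMr// invfM mulrAC divfK ?gt_eqF//.
  by rewrite mulrC ler_pdivrMr// mulrC.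
apply: (le_trans hi); rewrite lee_fin -mulrA ler_pM2l ?exprn_gt0//.
by rewrite [leRHS]mulrC ler_pdivlMr// [leLHS]mulrC.
Qed.
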